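(* Let $A_0,A_1,B_0,B_1,B_2,B_3$ be smooth functions of two real variables $(y,y')$ on an open set on which $y'\neq 0$, and consider the autonomous fourth order ordinary differential equation for $y=y(x)$ $$y^{(4)}+\bigl(A_1(y,y')\,y''+A_0(y,y')\bigr)y'''+B_3(y,y')\,y''^3+B_2(y,y')\,y''^2+B_1(y,y')\,y''+B_0(y,y')=0 .$$ The third order ordinary differential equation for $u=u(y)$ obtained from this equation by the substitution $y'=u(y)$ is linearizable by a point transformation if and only if the following five identities hold, where subscripts $y$ and $y'$ denote partial derivatives with respect to the two independent arguments $y$ and $y'$ of the coefficients: $$y'^2A_{1y}-y'A_{0y'}+A_0=0,$$ $$-3y'^2A_{0yy'}+y'\bigl(3B_{1y'}+3A_{0y}-2A_0A_{0y'}\bigr)+\bigl(-6B_1+2A_0^2\bigr)=0,$$ $$3y'^2A_{1y}+y'\bigl(A_0A_1-3B_2\bigr)+A_0=0,$$ $$y'^2\bigl(3A_{1y'}-9B_3+A_1^2\bigr)-y'A_1-5=0,$$ $$-6y'^4A_{0y}A_{1y}+y'^3\bigl(9B_1A_{1y}-2A_0^2A_{1y}+9B_{1yy'}\bigr)+y'^2\bigl(-18B_{1y}-9A_1B_{0y'}-9B_0A_{1y'}+3A_0B_{1y'}-27B_{0y'y'}\bigr)+y'\bigl(27A_1B_0-6A_0B_1+126B_{0y'}\bigr)-180B_0=0 .$$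
   Context: The substitution $y'=u(y)$ means that $y$ is taken as the new independent variable and $u=y'$ as the new dependent variable. With $u',u'',u'''$ denoting derivatives of $u$ with respect to $y$, one has $y''=uu'$, $y'''=u^2u''+uu'^2$ and $y^{(4)}=u^3u'''+4u^2u'u''+uu'^3$. Substituting these and dividing by $u^3$ gives the reduced third order equation $$u'''+\Bigl(\bigl(A_1+\tfrac{4}{u}\bigr)u'+\tfrac{A_0}{u}\Bigr)u''+\Bigl(B_3+\tfrac{A_1}{u}+\tfrac{1}{u^2}\Bigr)u'^3+\Bigl(\tfrac{B_2}{u}+\tfrac{A_0}{u^2}\Bigr)u'^2+\tfrac{B_1}{u^2}u'+\tfrac{B_0}{u^3}=0,$$ where $A_i$ and $B_j$ are evaluated at $(y,u)$. A third order equation $u'''=f(y,u,u',u'')$ is called linearizable by a point transformation if, locally near each point $(y,u)$ of its domain, there is a smooth, locally invertible change of variables $t=\varphi(y,u)$, $s=\psi(y,u)$ that transforms it into a linear equation of the form $\dfrac{d^3s}{dt^3}+\alpha(t)\,s=0$ for some function $\alpha$. *)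

(* Defs.v *)
(* Stdlib real numbers with Coquelicot. *)
From Stdlib Require Export Reals.
From Stdlib Require Import Lra Lia.
From Coquelicot Require Export Coquelicot.

Open Scope R_scope.

Definition d1 (F : R -> R -> R) (a b : R) : R := Derive (fun z => F z b) a.
Definition d2 (F : R -> R -> R) (a b : R) : R := Derive (fun z => F a z) b.

(* On an open set this is C^infinity: [ex_diff_n F n] asks for all iterated
   partial derivatives up to order [n] to exist and be jointly continuous. *)
Definition smooth_on (D : R * R -> Prop) (F : R -> R -> R) : Prop :=
  forall a b, D (a, b) -> forall n, ex_diff_n F n a b.

(* All orders [k <= 3] are listed because [Derive] is total, so that
   [ex_derive_n v 3] alone says nothing about the lower derivatives. *)
Definition thrice_differentiable_near (v : R -> R) (a : R) : Prop :=
  locally a (fun z => forall k, (k <= 3)%nat -> ex_derive_n v k z).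

(* [p], [y2], [y3], [y4] stand for y', y'', y''', y''''. *)
Definition fourth_order_lhs (A0 A1 B0 B1 B2 B3 : R -> R -> R)
    (y p y2 y3 y4 : R) : R :=
  y4 + (A1 y p * y2 + A0 y p) * y3 + B3 y p * y2 ^ 3 + B2 y p * y2 ^ 2
  + B1 y p * y2 + B0 y p.

(* The reduced equation is u''' = reduced_rhs y u u' u''; the lemmas below
   check that it is the one produced by the substitution y' = u(y). *)
Definition reduced_rhs (A0 A1 B0 B1 B2 B3 : R -> R -> R)
    (y u u1 u2 : R) : R :=
  - (((A1 y u + 4 / u) * u1 + A0 y u / u) * u2
     + (B3 y u + A1 y u / u + 1 / u ^ 2) * u1 ^ 3
     + (B2 y u / u + A0 y u / u ^ 2) * u1 ^ 2
     + B1 y u / u ^ 2 * u1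
     + B0 y u / u ^ 3).

Lemma fourth_order_lhs_subst (A0 A1 B0 B1 B2 B3 : R -> R -> R)
    (y u u1 u2 u3 : R) : u <> 0 ->
  fourth_order_lhs A0 A1 B0 B1 B2 B3 y u (u * u1) (u ^ 2 * u2 + u * u1 ^ 2)
    (u ^ 3 * u3 + 4 * u ^ 2 * u1 * u2 + u * u1 ^ 3)
  = u ^ 3 * (u3 - reduced_rhs A0 A1 B0 B1 B2 B3 y u u1 u2).
Proof.
intros Hu; unfold fourth_order_lhs, reduced_rhs; field; exact Hu.
Qed.

Lemma reduction (A0 A1 B0 B1 B2 B3 : R -> R -> R)
    (Y u : R -> R) (x : R) :
  locally x (fun z => is_derive Y z (u (Y z))) ->
  thrice_differentiable_near u (Y x) -> u (Y x) <> 0 ->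
  fourth_order_lhs A0 A1 B0 B1 B2 B3 (Y x) (Derive Y x)
    (Derive_n Y 2 x) (Derive_n Y 3 x) (Derive_n Y 4 x) = 0
  <-> Derive_n u 3 (Y x)
      = reduced_rhs A0 A1 B0 B1 B2 B3 (Y x) (u (Y x))
          (Derive u (Y x)) (Derive_n u 2 (Y x)).
Proof.
intros HY Hu Hux.
set (u1 := Derive u); set (u2 := Derive_n u 2); set (u3 := Derive_n u 3).
assert (Hnear : locally x (fun z => is_derive Y z (u (Y z)) /\
    is_derive u (Y z) (u1 (Y z)) /\ is_derive u1 (Y z) (u2 (Y z)) /\
    is_derive u2 (Y z) (u3 (Y z)))).
{ apply filter_and; [exact HY |].
  assert (HcY : filterlim Y (locally x) (locally (Y x))).
  { apply (ex_derive_continuous (K := R_AbsRing) (V := R_NormedModule)).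
    exists (u (Y x)); exact (locally_singleton _ _ HY). }
  generalize (HcY _ Hu); unfold filtermap; apply filter_imp; intros z Hz.
  split; [| split]; apply Derive_correct.
  - exact (Hz 1%nat ltac:(lia)).
  - exact (Hz 2%nat ltac:(lia)).
  - exact (Hz 3%nat ltac:(lia)). }
pose (F2 := fun z => u (Y z) * u1 (Y z)).
pose (F3 := fun z => u (Y z) ^ 2 * u2 (Y z) + u (Y z) * u1 (Y z) ^ 2).
assert (E1 : locally x (fun z => Derive_n Y 1 z = u (Y z))).
{ revert Hnear; apply filter_imp; intros z [H _].
  exact (is_derive_unique _ _ _ H). }
assert (E2 : locally x (fun z => Derive_n Y 2 z = F2 z)).
{ generalize (locally_locally _ _ E1), Hnear; intros Ha Hb.
  generalize (filter_and _ _ Ha Hb); apply filter_imp.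
  intros z [H (H0 & H1 & _)].
  change (Derive (Derive_n Y 1) z = F2 z).
  rewrite (Derive_ext_loc _ _ _ H); apply is_derive_unique.
  exact (is_derive_comp u Y z _ _ H1 H0). }
assert (E3 : locally x (fun z => Derive_n Y 3 z = F3 z)).
{ generalize (locally_locally _ _ E2), Hnear; intros Ha Hb.
  generalize (filter_and _ _ Ha Hb); apply filter_imp.
  intros z [H (H0 & H1 & H2 & _)]; clearbody u1 u2 u3.
  change (Derive (Derive_n Y 2) z = F3 z).
  rewrite (Derive_ext_loc _ _ _ H); apply is_derive_unique; unfold F2, F3.
  auto_derive.
  - repeat split; eexists; eassumption.
  - apply is_derive_unique in H0, H1, H2.
    change (Derive (fun t : R => Y t) z = u (Y z)) in H0.
    change (Derive (fun t : R => u t) (Y z) = u1 (Y z)) in H1.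
    change (Derive (fun t : R => u1 t) (Y z) = u2 (Y z)) in H2.
    rewrite H0, H1, H2.
    ring. }
assert (E4 : Derive_n Y 4 x
  = u (Y x) ^ 3 * u3 (Y x) + 4 * u (Y x) ^ 2 * u1 (Y x) * u2 (Y x)
    + u (Y x) * u1 (Y x) ^ 3).
{ destruct (locally_singleton _ _ Hnear) as (H0 & H1 & H2 & H3).
  clearbody u1 u2 u3.
  change (Derive_n Y 4 x) with (Derive (Derive_n Y 3) x).
  rewrite (Derive_ext_loc _ _ _ E3); apply is_derive_unique; unfold F3.
  auto_derive.
  - repeat split; eexists; eassumption.
  - apply is_derive_unique in H0, H1, H2, H3.
    change (Derive (fun t : R => Y t) x = u (Y x)) in H0.
    change (Derive (fun t : R => u t) (Y x) = u1 (Y x)) in H1.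
    change (Derive (fun t : R => u1 t) (Y x) = u2 (Y x)) in H2.
    change (Derive (fun t : R => u2 t) (Y x) = u3 (Y x)) in H3.
    rewrite H0, H1, H2, H3.
    ring. }
change (Derive Y x) with (Derive_n Y 1 x).
rewrite (locally_singleton _ _ E1), (locally_singleton _ _ E2),
  (locally_singleton _ _ E3), E4.
unfold F2, F3; rewrite fourth_order_lhs_subst by exact Hux.
fold (u1 (Y x)).
assert (Hu3 : u (Y x) ^ 3 <> 0) by (apply pow_nonzero; exact Hux).
split; intros H.
- apply Rmult_integral in H; destruct H as [H | H]; [contradiction | lra].
- rewrite H; ring.
Qed.

(* t = phi(y,u), s = psi(y,u) is a smooth bijection of the open set U onto the
   open set V, with smooth inverse y = eta(t,s), u = theta(t,s). *)
Definition change_of_variables (U V : R * R -> Prop)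
    (phi psi eta theta : R -> R -> R) : Prop :=
  open U /\ open V /\
  smooth_on U phi /\ smooth_on U psi /\
  smooth_on V eta /\ smooth_on V theta /\
  (forall y u, U (y, u) -> V (phi y u, psi y u) /\
     eta (phi y u) (psi y u) = y /\ theta (phi y u) (psi y u) = u) /\
  (forall t s, V (t, s) -> U (eta t s, theta t s) /\
     phi (eta t s) (theta t s) = t /\ psi (eta t s) (theta t s) = s).

(* Whenever the graph of u, near one of its points, is carried by (phi, psi)
   to the graph of a function s of t (hence the condition dt/dy <> 0), the
   equation u''' = f(y,u,u',u'') at that point is equivalent to
   s''' + alpha(t) s = 0 at the image point. *)
Definition transforms_to_linear (U : R * R -> Prop) (phi psi : R -> R -> R)
    (f : R -> R -> R -> R -> R) (alpha : R -> R) : Prop :=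
  forall (u s : R -> R) (y : R),
    let t := fun z => phi z (u z) in
    U (y, u y) ->
    thrice_differentiable_near u y ->
    Derive t y <> 0 ->
    thrice_differentiable_near s (t y) ->
    locally y (fun z => s (t z) = psi z (u z)) ->
    (Derive_n u 3 y = f y (u y) (Derive u y) (Derive_n u 2 y)
     <-> Derive_n s 3 (t y) + alpha (t y) * s (t y) = 0).

Definition linearizable_by_point_transformation (Omega : R * R -> Prop)
    (f : R -> R -> R -> R -> R) : Prop :=
  forall y0 u0, Omega (y0, u0) ->
  exists (U V : R * R -> Prop) (phi psi eta theta : R -> R -> R)
         (alpha : R -> R),
    U (y0, u0) /\
    (forall y u, U (y, u) -> Omega (y, u)) /\
    change_of_variables U V phi psi eta theta /\
    transforms_to_linear U phi psi f alpha.

(* Main.v *)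
Require Import Defs.
From Stdlib Require Import Lra Lia ClassicalEpsilon Ranalysis5.

(** Under t = phi(y), s = psi(y,u) the equation s''' + alpha(t) s = 0 pulls back
    to an equation u''' + (a1 u' + a0) u'' + b3 u'^3 + b2 u'^2 + b1 u' + b0 = 0;
    if phi depended on u, a term in u''^2 would appear.  With P = psi_u,
    chi = phi''/phi', q = 2 chi^2 - chi' and c = alpha(phi) phi'^3, comparing
    coefficients gives
      a1 P = 3 P_u,  a0 P = 3 (P_y - chi P),  b3 P = P_uu,
      b2 P = 3 (P_yu - chi P_u),  b1 P = 3 P_yy - 6 chi P_y + q P,
      b0 P = psi_yyy - 3 chi psi_yy + q psi_y + c psi.
    The five identities are the compatibility conditions of this system: they
    follow by differentiating it, and the last one expresses that c does not
    depend on u, so no derivative of alpha is needed.  Conversely, 3 b1 - a0^2 -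
    3 a0_y is then a function of y alone, so that chi is found from a Riccati
    equation; P is the exponential of a potential of a closed form; and psi is
    the integral of P in u plus a function of y, which is found by solving a
    linear third order equation on the axis u = u0. *)

(** * Smooth functions of two variables *)

(** Linearizability is a statement about functions u and s, not about jet variables. Necessity
    therefore has to realize every jet (y, u, p, q, w) with dt/dy <> 0 by an actual curve, and to
    produce a function s whose graph is the image of that curve; only then does the equivalence of
    the two equations become a polynomial identity whose coefficients can be compared. Since [alpha]
    is an arbitrary function, it is never differentiated, only treated as constant along vertical
    segments.

    Sufficiency must deliver smooth functions with a smooth inverse, and [smooth_on] asks for
    partial derivatives of every order. All such proofs go through one coinduction: exhibit a class
    of continuous functions closed under partial derivatives. Implicit functions, integrals with a
    parameter and solutions of linear differential equations all fit, because their derivatives are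
    expressed through functions of the same kind. The construction is local for two reasons: linear
    equations are solved by contraction on a short interval, and the solution of the Riccati
    equation exists only as long as w does not vanish. Hence the shrinking squares around (y0,
    u0). *)

Definition partials (D : R * R -> Prop) (F F1 F2 : R -> R -> R) : Prop :=
  forall a b, D (a, b) ->
    is_derive (fun z => F z b) a (F1 a b) /\
    is_derive (fun z => F a z) b (F2 a b).

Lemma is_derive_Rmult (f g : R -> R) (x df dg : R) :
  is_derive f x df -> is_derive g x dg ->
  is_derive (fun z => f z * g z) x (df * g x + f x * dg).
Proof.
intros Hf Hg; exact (is_derive_mult f g x df dg Hf Hg Rmult_comm).
Qed.

Lemma is_derive_Rcomp (f g : R -> R) (x df dg : R) :
  is_derive f (g x) df -> is_derive g x dg ->
  is_derive (fun z => f (g z)) x (dg * df).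
Proof. exact (is_derive_comp f g x df dg). Qed.

Lemma is_derive_cont (f : R -> R) (x l : R) :
  is_derive f x l -> continuous f x.
Proof. intros H; apply (ex_derive_continuous f); exists l; exact H. Qed.

Lemma open_locally_2d (D : R * R -> Prop) (a b : R) :
  open D -> D (a, b) -> locally_2d (fun u v => D (u, v)) a b.
Proof.
intros HD Hab; apply locally_2d_locally.
apply filter_imp with (2 := HD _ Hab); now intros [u v].
Qed.

Lemma open_section1 (D : R * R -> Prop) (a b : R) :
  open D -> D (a, b) -> locally a (fun z => D (z, b)).
Proof.
intros HD Hab; destruct (open_locally_2d D a b HD Hab) as [d Hd].
exists d; intros z Hz; apply Hd; [exact Hz |].
rewrite Rminus_diag, Rabs_R0; apply cond_pos.
Qed.

Lemma open_section2 (D : R * R -> Prop) (a b : R) :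
  open D -> D (a, b) -> locally b (fun z => D (a, z)).
Proof.
intros HD Hab; destruct (open_locally_2d D a b HD Hab) as [d Hd].
exists d; intros z Hz; apply Hd; [| exact Hz].
rewrite Rminus_diag, Rabs_R0; apply cond_pos.
Qed.

Lemma partials_ext (D : R * R -> Prop) (F G F1 F2 : R -> R -> R) :
  open D -> (forall a b, D (a, b) -> F a b = G a b) ->
  partials D F F1 F2 -> partials D G F1 F2.
Proof.
intros HD E H a b Hab; destruct (H a b Hab) as [H1 H2]; split.
- apply is_derive_ext_loc with (2 := H1).
  generalize (open_section1 D a b HD Hab); apply filter_imp.
  intros z Hz; exact (E _ _ Hz).
- apply is_derive_ext_loc with (2 := H2).
  generalize (open_section2 D a b HD Hab); apply filter_imp.
  intros z Hz; exact (E _ _ Hz).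
Qed.

Lemma partials_eq (D : R * R -> Prop) (F F1 F2 : R -> R -> R) (a b : R) :
  partials D F F1 F2 -> D (a, b) -> d1 F a b = F1 a b /\ d2 F a b = F2 a b.
Proof.
intros H Hab; destruct (H a b Hab) as [H1 H2].
split; apply is_derive_unique; assumption.
Qed.

Lemma smooth_ext (D : R * R -> Prop) (F G : R -> R -> R) :
  open D -> (forall a b, D (a, b) -> F a b = G a b) ->
  smooth_on D F -> smooth_on D G.
Proof.
intros HD E H a b Hab n; apply ex_diff_n_ext_loc with (2 := H a b Hab n).
destruct (open_locally_2d D a b HD Hab) as [d Hd].
exists d; intros u v Hu Hv; apply E, Hd; assumption.
Qed.

Lemma smooth_subset (D D' : R * R -> Prop) (F : R -> R -> R) :
  (forall a b, D' (a, b) -> D (a, b)) -> smooth_on D F -> smooth_on D' F.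
Proof. intros I H a b Hab; exact (H a b (I a b Hab)). Qed.

Lemma smooth_cont (D : R * R -> Prop) (F : R -> R -> R) (a b : R) :
  smooth_on D F -> D (a, b) -> continuity_2d_pt F a b.
Proof. intros H Hab; exact (proj1 (H a b Hab 0%nat)). Qed.

Lemma smooth_d1 (D : R * R -> Prop) (F : R -> R -> R) :
  smooth_on D F -> smooth_on D (d1 F).
Proof. intros H a b Hab n; exact (proj1 (proj2 (proj2 (proj2 (H a b Hab (S n)))))). Qed.

Lemma smooth_d2 (D : R * R -> Prop) (F : R -> R -> R) :
  smooth_on D F -> smooth_on D (d2 F).
Proof. intros H a b Hab n; exact (proj2 (proj2 (proj2 (proj2 (H a b Hab (S n)))))). Qed.

Lemma smooth_partials (D : R * R -> Prop) (F : R -> R -> R) :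
  smooth_on D F -> partials D F (d1 F) (d2 F).
Proof.
intros H a b Hab; destruct (H a b Hab 1%nat) as (_ & H1 & H2 & _).
split; apply Derive_correct; assumption.
Qed.

(* Coinduction principle for smoothness. *)
Lemma smooth_of_class (D : R * R -> Prop) (S : (R -> R -> R) -> Prop) :
  open D ->
  (forall F a b, S F -> D (a, b) -> continuity_2d_pt F a b) ->
  (forall F, S F -> exists F1 F2, S F1 /\ S F2 /\ partials D F F1 F2) ->
  forall F, S F -> smooth_on D F.
Proof.
intros HD Hc Hp.
(* The induction runs over functions [F] that agree on [D] with a member [G] of the class, because
   [d1 F] and [d2 F] agree with the members [F1] and [F2] only on [D]. *)
assert (main : forall n F G, S G -> (forall a b, D (a, b) -> G a b = F a b) ->
          forall a b, D (a, b) -> ex_diff_n F n a b).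
{ assert (cont : forall F G, S G ->
            (forall a b, D (a, b) -> G a b = F a b) ->
            forall a b, D (a, b) -> continuity_2d_pt F a b).
  { intros F G HG E a b Hab; apply continuity_2d_pt_ext_loc with (f := G).
    - destruct (open_locally_2d D a b HD Hab) as [d Hd].
      exists d; intros u v Hu Hv; apply E, Hd; assumption.
    - exact (Hc G a b HG Hab). }
  induction n as [| n IH]; intros F G HG E a b Hab.
  - split; [exact (cont F G HG E a b Hab) | exact I].
  - destruct (Hp G HG) as (F1 & F2 & S1 & S2 & P).
    assert (PF := partials_ext D G F F1 F2 HD E P).
    destruct (PF a b Hab) as [H1 H2].
    split; [exact (cont F G HG E a b Hab) |].
    split; [exists (F1 a b); exact H1 |].
    split; [exists (F2 a b); exact H2 |].
    split; [apply (IH _ F1 S1) | apply (IH _ F2 S2)]; try exact Hab;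
      intros a' b' H'; symmetry; destruct (PF a' b' H') as [K1 K2];
      apply is_derive_unique; assumption. }
intros F HF a b Hab n; exact (main n F F HF (fun _ _ _ => eq_refl) a b Hab).
Qed.

(** Derivatives of products, inverses and exponentials are sums of products, so closure under
    differentiation is obtained for all operations at once. The base [B] is a parameter, so that
    composites, integrals and solutions of differential equations can be added to it. *)
Inductive generated (D : R * R -> Prop) (B : (R -> R -> R) -> Prop) :
    (R -> R -> R) -> Prop :=
| gen_base F : B F -> generated D B F
| gen_const c : generated D B (fun _ _ => c)
| gen_plus F G : generated D B F -> generated D B G ->
    generated D B (fun a b => F a b + G a b)
| gen_mult F G : generated D B F -> generated D B G ->
    generated D B (fun a b => F a b * G a b)
| gen_inv F : (forall a b, D (a, b) -> F a b <> 0) -> generated D B F ->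
    generated D B (fun a b => / F a b)
| gen_exp F : generated D B F -> generated D B (fun a b => exp (F a b)).

(** The partial derivatives of a base function need not lie in the base, only be expressions in it,
    which is exactly what a differential equation provides. *)
Lemma generated_smooth (D : R * R -> Prop) (B : (R -> R -> R) -> Prop) :
  open D ->
  (forall F a b, B F -> D (a, b) -> continuity_2d_pt F a b) ->
  (forall F, B F -> exists F1 F2,
     generated D B F1 /\ generated D B F2 /\ partials D F F1 F2) ->
  forall F, generated D B F -> smooth_on D F.
Proof.
intros HD Hc Hp; apply smooth_of_class; [exact HD | |].
- intros F a b HF Hab; induction HF.
  + now apply Hc.
  + apply continuity_2d_pt_const.
  + now apply continuity_2d_pt_plus.
  + now apply continuity_2d_pt_mult.
  + apply continuity_2d_pt_inv; [assumption | now apply H].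
  + apply continuity_1d_2d_pt_comp with (f := exp); [| assumption].
    apply derivable_continuous_pt, derivable_pt_exp.
- intros F HF; induction HF as [F HF | c | F G HF [F1 [F2 [g1 [g2 P]]]] HG
      [G1 [G2 [k1 [k2 Q]]]] | F G HF [F1 [F2 [g1 [g2 P]]]] HG
      [G1 [G2 [k1 [k2 Q]]]] | F N HF [F1 [F2 [g1 [g2 P]]]]
      | F HF [F1 [F2 [g1 [g2 P]]]]].
  + exact (Hp F HF).
  + exists (fun _ _ => 0), (fun _ _ => 0).
    split; [apply gen_const | split; [apply gen_const |]].
    intros a b _; split; apply (is_derive_const c).
  + exists (fun a b => F1 a b + G1 a b), (fun a b => F2 a b + G2 a b).
    split; [now apply gen_plus | split; [now apply gen_plus |]].
    intros a b Hab; destruct (P a b Hab) as [P1 P2], (Q a b Hab) as [Q1 Q2].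
    split.
    * exact (is_derive_plus (fun z => F z b) (fun z => G z b) _ _ _ P1 Q1).
    * exact (is_derive_plus (fun z => F a z) (fun z => G a z) _ _ _ P2 Q2).
  + exists (fun a b => F1 a b * G a b + F a b * G1 a b),
      (fun a b => F2 a b * G a b + F a b * G2 a b).
    split; [apply gen_plus; now apply gen_mult |].
    split; [apply gen_plus; now apply gen_mult |].
    intros a b Hab; destruct (P a b Hab) as [P1 P2], (Q a b Hab) as [Q1 Q2].
    split.
    * exact (is_derive_Rmult (fun z => F z b) (fun z => G z b) _ _ _ P1 Q1).
    * exact (is_derive_Rmult (fun z => F a z) (fun z => G a z) _ _ _ P2 Q2).
  (* The derivative of the inverse is written with products and inverses only, to be visibly a
     member of the class. *)
  + exists (fun a b => -1 * F1 a b * (/ F a b * / F a b)),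
      (fun a b => -1 * F2 a b * (/ F a b * / F a b)).
    assert (I : generated D B (fun a b => / F a b)) by now apply gen_inv.
    split; [apply gen_mult; apply gen_mult; trivial; apply gen_const |].
    split; [apply gen_mult; apply gen_mult; trivial; apply gen_const |].
    intros a b Hab; specialize (N a b Hab); destruct (P a b Hab) as [P1 P2].
    split.
    * replace (-1 * F1 a b * (/ F a b * / F a b)) with (- F1 a b / F a b ^ 2)
        by now field.
      exact (is_derive_inv (fun z => F z b) _ _ P1 N).
    * replace (-1 * F2 a b * (/ F a b * / F a b)) with (- F2 a b / F a b ^ 2)
        by now field.
      exact (is_derive_inv (fun z => F a z) _ _ P2 N).
  + exists (fun a b => F1 a b * exp (F a b)), (fun a b => F2 a b * exp (F a b)).
    assert (I : generated D B (fun a b => exp (F a b))) by now apply gen_exp.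
    split; [now apply gen_mult | split; [now apply gen_mult |]].
    intros a b Hab; destruct (P a b Hab) as [P1 P2].
    split.
    * exact (is_derive_Rcomp exp (fun z => F z b) _ _ _ (is_derive_exp _) P1).
    * exact (is_derive_Rcomp exp (fun z => F a z) _ _ _ (is_derive_exp _) P2).
Qed.

Lemma smooth_generated (D : R * R -> Prop) (F : R -> R -> R) :
  open D -> generated D (smooth_on D) F -> smooth_on D F.
Proof.
intros HD; apply generated_smooth; [exact HD | |].
- intros G a b HG Hab; now apply smooth_cont with D.
- intros G HG; exists (d1 G), (d2 G).
  split; [apply gen_base, smooth_d1, HG |].
  split; [apply gen_base, smooth_d2, HG | apply smooth_partials, HG].
Qed.

Lemma smooth_const (D : R * R -> Prop) (c : R) :
  open D -> smooth_on D (fun _ _ => c).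
Proof. intros HD; apply smooth_generated; [exact HD | apply gen_const]. Qed.

Lemma smooth_plus (D : R * R -> Prop) (F G : R -> R -> R) :
  open D -> smooth_on D F -> smooth_on D G ->
  smooth_on D (fun a b => F a b + G a b).
Proof.
intros HD HF HG; apply smooth_generated; [exact HD |].
apply gen_plus; now apply gen_base.
Qed.

Lemma smooth_mult (D : R * R -> Prop) (F G : R -> R -> R) :
  open D -> smooth_on D F -> smooth_on D G ->
  smooth_on D (fun a b => F a b * G a b).
Proof.
intros HD HF HG; apply smooth_generated; [exact HD |].
apply gen_mult; now apply gen_base.
Qed.

Lemma smooth_inv (D : R * R -> Prop) (F : R -> R -> R) :
  open D -> (forall a b, D (a, b) -> F a b <> 0) -> smooth_on D F ->
  smooth_on D (fun a b => / F a b).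
Proof.
intros HD N HF; apply smooth_generated; [exact HD |].
apply gen_inv; [exact N | now apply gen_base].
Qed.

Lemma smooth_exp (D : R * R -> Prop) (F : R -> R -> R) :
  open D -> smooth_on D F -> smooth_on D (fun a b => exp (F a b)).
Proof.
intros HD HF; apply smooth_generated; [exact HD |].
apply gen_exp; now apply gen_base.
Qed.

Lemma smooth_opp (D : R * R -> Prop) (F : R -> R -> R) :
  open D -> smooth_on D F -> smooth_on D (fun a b => - F a b).
Proof.
intros HD HF; apply smooth_ext with (F := fun a b => -1 * F a b);
  [exact HD | intros; ring |].
apply smooth_mult; trivial; now apply smooth_const.
Qed.

Lemma smooth_minus (D : R * R -> Prop) (F G : R -> R -> R) :
  open D -> smooth_on D F -> smooth_on D G ->
  smooth_on D (fun a b => F a b - G a b).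
Proof.
intros HD HF HG; apply smooth_plus; trivial; now apply smooth_opp.
Qed.

Lemma smooth_div (D : R * R -> Prop) (F G : R -> R -> R) :
  open D -> (forall a b, D (a, b) -> G a b <> 0) ->
  smooth_on D F -> smooth_on D G ->
  smooth_on D (fun a b => F a b / G a b).
Proof.
intros HD N HF HG; apply smooth_mult; trivial; now apply smooth_inv.
Qed.

Lemma smooth_pow (D : R * R -> Prop) (F : R -> R -> R) (n : nat) :
  open D -> smooth_on D F -> smooth_on D (fun a b => F a b ^ n).
Proof.
intros HD HF; induction n as [| n IH]; simpl.
- now apply smooth_const.
- now apply smooth_mult.
Qed.

Lemma smooth_fst (D : R * R -> Prop) : open D -> smooth_on D (fun a _ => a).
Proof.
intros HD.
apply generated_smooth with (B := fun F => F = fun a _ => a);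
  [exact HD | | | now apply gen_base].
- intros F a b -> _; apply continuity_2d_pt_id1.
- intros F ->; exists (fun _ _ => 1), (fun _ _ => 0).
  split; [apply gen_const | split; [apply gen_const |]].
  intros a b _; split; [apply (is_derive_id a) | apply (is_derive_const a)].
Qed.

Lemma smooth_snd (D : R * R -> Prop) : open D -> smooth_on D (fun _ b => b).
Proof.
intros HD.
apply generated_smooth with (B := fun F => F = fun _ b => b);
  [exact HD | | | now apply gen_base].
- intros F a b -> _; apply continuity_2d_pt_id2.
- intros F ->; exists (fun _ _ => 0), (fun _ _ => 1).
  split; [apply gen_const | split; [apply gen_const |]].
  intros a b _; split; [apply (is_derive_const b) | apply (is_derive_id b)].
Qed.

(** Existence of both partial derivatives together with continuity of the first one gives the total
    derivative, which the chain rule along curves requires. *)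
Lemma smooth_differentiable (D : R * R -> Prop) (F : R -> R -> R) (a b : R) :
  open D -> smooth_on D F -> D (a, b) ->
  differentiable_pt_lim F a b (d1 F a b) (d2 F a b).
Proof.
intros HD HF Hab; apply filterdiff_differentiable_pt_lim.
apply (is_derive_filterdiff F a b (d1 F) (d2 F a b)).
- apply (filter_imp D); [| exact (HD _ Hab)].
  intros [u v] Huv; exact (proj1 (smooth_partials D F HF u v Huv)).
- exact (proj2 (smooth_partials D F HF a b Hab)).
- apply continuity_2d_pt_filterlim.
  exact (smooth_cont D (d1 F) a b (smooth_d1 D F HF) Hab).
Qed.

Lemma is_derive_curve (D : R * R -> Prop) (F : R -> R -> R) (f g : R -> R)
    (x df dg : R) :
  open D -> smooth_on D F -> D (f x, g x) ->
  is_derive f x df -> is_derive g x dg ->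
  is_derive (fun z => F (f z) (g z)) x
    (d1 F (f x) (g x) * df + d2 F (f x) (g x) * dg).
Proof.
intros HD HF Hx Hf Hg; apply is_derive_Reals.
apply derivable_pt_lim_comp_2d.
- now apply smooth_differentiable with D.
- now apply is_derive_Reals.
- now apply is_derive_Reals.
Qed.

Lemma continuity_2d_comp (F g1 g2 : R -> R -> R) (a b : R) :
  continuity_2d_pt F (g1 a b) (g2 a b) ->
  continuity_2d_pt g1 a b -> continuity_2d_pt g2 a b ->
  continuity_2d_pt (fun u v => F (g1 u v) (g2 u v)) a b.
Proof.
intros HF H1 H2 eps; destruct (HF eps) as [d Hd].
destruct (H1 d) as [e1 He1], (H2 d) as [e2 He2].
assert (Hm : 0 < Rmin e1 e2) by (apply Rmin_pos; apply cond_pos).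
exists (mkposreal _ Hm); simpl; intros u v Hu Hv; apply Hd.
- apply He1; eapply Rlt_le_trans; eauto; apply Rmin_l.
- apply He2; eapply Rlt_le_trans; eauto; apply Rmin_r.
Qed.

Lemma smooth_comp (D D' : R * R -> Prop) (F g1 g2 : R -> R -> R) :
  open D -> open D' -> smooth_on D' F -> smooth_on D g1 -> smooth_on D g2 ->
  (forall a b, D (a, b) -> D' (g1 a b, g2 a b)) ->
  smooth_on D (fun a b => F (g1 a b) (g2 a b)).
Proof.
intros HD HD' HF H1 H2 M.
(* The chain rule replaces [F] by [d1 F] and [d2 F] and brings in derivatives of [g1] and [g2]. The
   base therefore contains the composites with every smooth [K] and all smooth functions on [D]. *)
apply generated_smooth with (B := fun G => smooth_on D G \/
  exists K, smooth_on D' K /\ G = fun a b => K (g1 a b) (g2 a b));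
  [exact HD | | | apply gen_base; right; now exists F].
- intros G a b [HG | (K & HK & ->)] Hab.
  + now apply smooth_cont with D.
  + apply continuity_2d_comp.
    * apply smooth_cont with D'; [exact HK | now apply M].
    * now apply smooth_cont with D.
    * now apply smooth_cont with D.
- intros G [HG | (K & HK & ->)].
  + exists (d1 G), (d2 G).
    split; [apply gen_base; left; apply smooth_d1, HG |].
    split; [apply gen_base; left; apply smooth_d2, HG |].
    apply smooth_partials, HG.
  + exists (fun a b => d1 K (g1 a b) (g2 a b) * d1 g1 a b
                       + d2 K (g1 a b) (g2 a b) * d1 g2 a b),
      (fun a b => d1 K (g1 a b) (g2 a b) * d2 g1 a b
                       + d2 K (g1 a b) (g2 a b) * d2 g2 a b).
    split; [| split].
    1, 2: apply gen_plus; apply gen_mult; apply gen_base;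
      [right; eexists; split; [| reflexivity]
      | left | right; eexists; split; [| reflexivity] | left];
      now (apply smooth_d1 || apply smooth_d2).
    intros a b Hab; destruct (smooth_partials D g1 H1 a b Hab) as [P1 P2],
      (smooth_partials D g2 H2 a b Hab) as [Q1 Q2]; split.
    * apply (is_derive_curve D' K (fun z => g1 z b) (fun z => g2 z b)); auto.
    * apply (is_derive_curve D' K (fun z => g1 a z) (fun z => g2 a z)); auto.
Qed.

Lemma smooth_schwarz (D : R * R -> Prop) (F : R -> R -> R) (a b : R) :
  open D -> smooth_on D F -> D (a, b) -> d2 (d1 F) a b = d1 (d2 F) a b.
Proof.
intros HD HF Hab; symmetry; apply Schwarz.
- destruct (open_locally_2d D a b HD Hab) as [d Hd].
  exists d; intros u v Hu Hv; specialize (Hd u v Hu Hv).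
  destruct (smooth_partials D F HF u v Hd) as [P1 P2].
  destruct (smooth_partials D _ (smooth_d1 D F HF) u v Hd) as [Q1 Q2].
  destruct (smooth_partials D _ (smooth_d2 D F HF) u v Hd) as [S1 S2].
  repeat split; eexists; eassumption.
- apply (smooth_cont D (d1 (d2 F))); [| exact Hab].
  now apply smooth_d1, smooth_d2.
- apply (smooth_cont D (d2 (d1 F))); [| exact Hab].
  now apply smooth_d2, smooth_d1.
Qed.

Ltac smooth :=
  lazymatch goal with
  | |- smooth_on ?D (fun _ _ => ?c) => apply (smooth_const D c); smooth
  | |- smooth_on ?D (fun a _ => a) => apply (smooth_fst D); smooth
  | |- smooth_on ?D (fun _ b => b) => apply (smooth_snd D); smooth
  | |- smooth_on ?D (fun a b => @?f a b + @?g a b) =>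
      apply (smooth_plus D f g); smooth
  | |- smooth_on ?D (fun a b => @?f a b - @?g a b) =>
      apply (smooth_minus D f g); smooth
  | |- smooth_on ?D (fun a b => @?f a b * @?g a b) =>
      apply (smooth_mult D f g); smooth
  | |- smooth_on ?D (fun a b => @?f a b / @?g a b) =>
      apply (smooth_div D f g); smooth
  | |- smooth_on ?D (fun a b => - @?f a b) => apply (smooth_opp D f); smooth
  | |- smooth_on ?D (fun a b => / @?f a b) => apply (smooth_inv D f); smooth
  | |- smooth_on ?D (fun a b => @?f a b ^ ?n) => apply (smooth_pow D f n); smooth
  | |- smooth_on ?D (fun a b => exp (@?f a b)) => apply (smooth_exp D f); smooth
  | |- smooth_on ?D (fun a b => ?f a b) => change (smooth_on D f); smooth
  | |- smooth_on ?D (d1 ?f) =>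
      first [assumption | apply (smooth_d1 D f); smooth]
  | |- smooth_on ?D (d2 ?f) =>
      first [assumption | apply (smooth_d2 D f); smooth]
  | |- _ => try assumption
  end.

(** * Implicit functions on a box *)

(** In a square, horizontal and vertical segments between points with coordinates in range stay
    inside, as the mean value theorem and integration in u require; and the range of y does not
    depend on u, so that functions of y alone make sense on it. *)
Definition box (y0 u0 r : R) (q : R * R) : Prop :=
  Rabs (fst q - y0) < r /\ Rabs (snd q - u0) < r.

Lemma open_of_locally_2d (D : R * R -> Prop) :
  (forall a b, D (a, b) -> locally_2d (fun u v => D (u, v)) a b) -> open D.
Proof.
intros H [a b] Hab; generalize (H a b Hab); intros L.
apply locally_2d_locally in L; apply filter_imp with (2 := L); now intros [u v].
Qed.

Lemma box_open (y0 u0 r : R) : open (box y0 u0 r).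
Proof.
apply open_of_locally_2d; intros a b [H1 H2]; simpl in H1, H2.
assert (Hm : 0 < Rmin (r - Rabs (a - y0)) (r - Rabs (b - u0)))
  by (apply Rmin_pos; lra).
exists (mkposreal _ Hm); simpl; intros u v Hu Hv.
assert (L1 := Rmin_l (r - Rabs (a - y0)) (r - Rabs (b - u0))).
assert (L2 := Rmin_r (r - Rabs (a - y0)) (r - Rabs (b - u0))).
split; simpl.
- assert (T := Rabs_triang (u - a) (a - y0)).
  replace (u - a + (a - y0)) with (u - y0) in T by ring; lra.
- assert (T := Rabs_triang (v - b) (b - u0)).
  replace (v - b + (b - u0)) with (v - u0) in T by ring; lra.
Qed.

Lemma box_center (y0 u0 r : R) : 0 < r -> box y0 u0 r (y0, u0).
Proof. intros Hr; split; simpl; rewrite Rminus_diag, Rabs_R0; exact Hr. Qed.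

Lemma box_in_open (D : R * R -> Prop) (y0 u0 : R) :
  open D -> D (y0, u0) ->
  exists r, 0 < r /\ forall a b, box y0 u0 r (a, b) -> D (a, b).
Proof.
intros HD H0; destruct (open_locally_2d D y0 u0 HD H0) as [d Hd].
exists d; split; [apply cond_pos |].
intros a b [H1 H2]; exact (Hd a b H1 H2).
Qed.

Lemma Rabs_between (x a b c r : R) :
  Rmin a b <= x <= Rmax a b -> Rabs (a - c) < r -> Rabs (b - c) < r ->
  Rabs (x - c) < r.
Proof.
intros Hx Ha Hb; apply Rabs_def2 in Ha, Hb; apply Rabs_def1;
  unfold Rmin, Rmax in Hx; destruct (Rle_dec a b); lra.
Qed.

Lemma Rabs_between_le (x a b : R) :
  Rmin a b <= x <= Rmax a b -> Rabs (x - a) <= Rabs (b - a).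
Proof.
unfold Rmin, Rmax; intros Hx; destruct (Rle_dec a b).
- rewrite !Rabs_pos_eq; lra.
- rewrite !Rabs_left1; lra.
Qed.

Lemma MVT_between (f df : R -> R) (a b : R) :
  (forall x, Rmin a b <= x <= Rmax a b -> is_derive f x (df x)) ->
  exists c, Rmin a b <= c <= Rmax a b /\ f b - f a = df c * (b - a).
Proof.
intros H; apply (MVT_gen f a b df).
- intros x Hx; apply H; lra.
- intros x Hx; apply continuity_pt_filterlim, is_derive_cont with (df x), H, Hx.
Qed.

Lemma derive_zero_constant (f : R -> R) (c r : R) :
  (forall x, Rabs (x - c) < r -> is_derive f x 0) ->
  forall x, Rabs (x - c) < r -> f x = f c.
Proof.
intros H x Hx.
assert (Hc : Rabs (c - c) < r).
{ rewrite Rminus_diag, Rabs_R0; generalize (Rabs_pos (x - c)); lra. }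
destruct (MVT_between f (fun _ => 0) c x) as (d & _ & E); [| lra].
intros z Hz; apply H; now apply Rabs_between with c x.
Qed.

Section Implicit.

Variables (y0 u0 r : R) (F : R -> R -> R).
Hypothesis F_smooth : smooth_on (box y0 u0 r) F.
Hypothesis F_incr : forall y u, box y0 u0 r (y, u) -> 0 < d2 F y u.

Let D := box y0 u0 r.

(** The image of the box under (y, u) -> (y, F y u); the implicit function is the second component
    of the inverse of this map. *)
Definition implicit_domain (q : R * R) : Prop :=
  exists u, box y0 u0 r (fst q, u) /\ F (fst q) u = snd q.

(** The value is arbitrary outside [implicit_domain]; inside, the strict monotonicity of [F] in u
    makes it unique. *)
Definition implicit_function (y s : R) : R :=
  epsilon (inhabits 0) (fun u => box y0 u0 r (y, u) /\ F y u = s).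

Lemma implicit_spec (y s : R) : implicit_domain (y, s) ->
  box y0 u0 r (y, implicit_function y s) /\ F y (implicit_function y s) = s.
Proof. exact (epsilon_spec (inhabits 0) _). Qed.

Lemma section_incr (y u v : R) : D (y, u) -> D (y, v) -> u < v -> F y u < F y v.
Proof.
intros [Hy Hu] [_ Hv] Huv; simpl in *.
assert (B : forall x, Rmin u v <= x <= Rmax u v -> D (y, x)).
{ intros x Hx; split; [exact Hy | now apply Rabs_between with u v]. }
destruct (MVT_between (F y) (d2 F y) u v) as (c & Hc & E).
{ intros x Hx; exact (proj2 (smooth_partials D F F_smooth y x (B x Hx))). }
generalize (Rmult_lt_0_compat _ _ (F_incr y c (B c Hc)) (proj2 (Rlt_0_minus u v) Huv)).
lra.
Qed.

Lemma section_inj (y u v : R) : D (y, u) -> D (y, v) -> F y u = F y v -> u = v.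
Proof.
intros Hu Hv E; destruct (Rtotal_order u v) as [L | [L | L]]; [| exact L |].
- generalize (section_incr y u v Hu Hv L); lra.
- generalize (section_incr y v u Hv Hu L); lra.
Qed.

Lemma implicit_left (y u : R) : D (y, u) -> implicit_function y (F y u) = u.
Proof.
intros H; destruct (implicit_spec y (F y u)) as [H1 H2]; [now exists u |].
now apply section_inj with y.
Qed.

(** The intermediate value theorem on [u - k, u + k]: for (y', s') close to (y, F y u), the end
    values of [F y'] lie strictly on either side of s'. The existence of u' gives openness of the
    domain, its distance to u gives continuity of the implicit function. *)
Lemma implicit_near (y u : R) (e : R) : D (y, u) -> 0 < e ->
  locally_2d (fun y' s' => exists u', D (y', u') /\ F y' u' = s' /\
    Rabs (u' - u) < e) y (F y u).
Proof.
intros Hyu He.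
destruct Hyu as [Hy Hu]; simpl in Hy, Hu.
(* Half the distance to the edge keeps both [u - k] and [u + k] in the box; [e / 2] makes the root
   strictly closer to [u] than [e]. *)
set (k := Rmin (e / 2) ((r - Rabs (u - u0)) / 2)).
assert (Hk : 0 < k) by (apply Rmin_pos; lra).
assert (Hke : k <= e / 2) by apply Rmin_l.
assert (Hkr : k <= (r - Rabs (u - u0)) / 2) by apply Rmin_r.
assert (Bm : Rabs (u - k - u0) < r /\ Rabs (u + k - u0) < r).
{ split.
  - replace (u - k - u0) with ((u - u0) + - k) by ring.
    generalize (Rabs_triang (u - u0) (- k)); rewrite Rabs_Ropp, (Rabs_pos_eq k); lra.
  - replace (u + k - u0) with ((u - u0) + k) by ring.
    generalize (Rabs_triang (u - u0) k); rewrite (Rabs_pos_eq k); lra. }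
destruct Bm as [B1 B2].
assert (I1 : F y (u - k) < F y u)
  by (apply section_incr; [split | split |]; trivial; lra).
assert (I2 : F y u < F y (u + k))
  by (apply section_incr; [split | split |]; trivial; lra).
(* Half of the smaller gap: the values of [F] at the two ends and s' may each move by less than [m]
   without changing their order. *)
set (m := Rmin (F y u - F y (u - k)) (F y (u + k) - F y u) / 2).
assert (Hm : 0 < m).
{ unfold m; apply Rdiv_lt_0_compat; [apply Rmin_pos; lra | lra]. }
assert (Hm1 : 2 * m <= F y u - F y (u - k)).
{ unfold m; generalize (Rmin_l (F y u - F y (u - k)) (F y (u + k) - F y u)); lra. }
assert (Hm2 : 2 * m <= F y (u + k) - F y u).
{ unfold m; generalize (Rmin_r (F y u - F y (u - k)) (F y (u + k) - F y u)); lra. }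
destruct (smooth_cont D F y (u - k) F_smooth (conj Hy B1) (mkposreal m Hm))
  as [da Ha].
destruct (smooth_cont D F y (u + k) F_smooth (conj Hy B2) (mkposreal m Hm))
  as [db Hb].
simpl in Ha, Hb.
destruct (box_open y0 u0 r (y, u) (conj Hy Hu)) as [dc Hc].
set (d := Rmin (Rmin da db) (Rmin dc m)).
assert (Hd : 0 < d) by (repeat apply Rmin_pos; trivial; apply cond_pos).
assert (Hdab : d <= da /\ d <= db /\ d <= dc /\ d <= m).
{ unfold d; generalize (Rmin_l (Rmin da db) (Rmin dc m)),
    (Rmin_r (Rmin da db) (Rmin dc m)), (Rmin_l da db), (Rmin_r da db),
    (Rmin_l dc m), (Rmin_r dc m); lra. }
exists (mkposreal d Hd); simpl; intros y' s' Hy' Hs'.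
assert (Hy'r : Rabs (y' - y0) < r).
{ refine (proj1 (Hc (y', u) _)); split.
  - change (Rabs (y' - y) < dc); lra.
  - apply ball_center. }
assert (Z : forall x, Rabs (x - x) = 0) by (intros; rewrite Rminus_diag; apply Rabs_R0).
specialize (Ha y' (u - k)); specialize (Hb y' (u + k)).
rewrite !Z in Ha, Hb; generalize (cond_pos da), (cond_pos db); intros Pa Pb.
assert (Ha' := Ha ltac:(lra) Pa); assert (Hb' := Hb ltac:(lra) Pb).
apply Rabs_def2 in Ha', Hb', Hs'.
destruct (IVT_interv (fun x => F y' x - s') (u - k) (u + k)) as [x [Hx Ex]].
- intros x Hx; apply continuity_pt_filterlim.
  refine (is_derive_cont (fun x => F y' x - s') x (minus (d2 F y' x) zero) _).
  apply (is_derive_minus (F y') (fun _ => s')); [| apply (is_derive_const s')].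
  { apply (smooth_partials D F F_smooth y' x); split; simpl; [exact Hy'r |].
    apply Rabs_between with (u - k) (u + k); trivial.
    rewrite Rmin_left, Rmax_right; lra. }
- lra.
- lra.
- lra.
- exists x; repeat split; simpl.
  + exact Hy'r.
  + apply Rabs_between with (u - k) (u + k); trivial.
    rewrite Rmin_left, Rmax_right; lra.
  + lra.
  + apply Rabs_def1; lra.
Qed.

Lemma implicit_domain_open : open implicit_domain.
Proof.
apply open_of_locally_2d; intros y s (u & Hu & E); simpl in Hu, E; subst s.
destruct (implicit_near y u 1 Hu Rlt_0_1) as [d Hd].
exists d; intros y' s' Hy' Hs'; destruct (Hd y' s' Hy' Hs') as (u' & H1 & H2 & _).
now exists u'.
Qed.

Lemma implicit_continuous (y s : R) : implicit_domain (y, s) ->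
  continuity_2d_pt implicit_function y s.
Proof.
intros (u & Hu & E) eps; simpl in Hu, E; subst s.
destruct (implicit_near y u eps Hu (cond_pos eps)) as [d Hd].
exists d; intros y' s' Hy' Hs'; destruct (Hd y' s' Hy' Hs') as (u' & H1 & H2 & H3).
rewrite <- H2, !implicit_left; trivial.
Qed.

(* The mean value theorem in each variable, along an L-shaped path. *)
Lemma increment_2d (y u y' u' : R) : D (y, u) -> D (y', u') ->
  exists c c', Rabs (c - u) <= Rabs (u' - u) /\ Rabs (c' - y) <= Rabs (y' - y) /\
    D (y', c) /\
    F y' u' - F y u = d2 F y' c * (u' - u) + d1 F c' u * (y' - y).
Proof.
intros [Hy Hu] [Hy' Hu']; simpl in *.
assert (B1 : forall x, Rmin u u' <= x <= Rmax u u' -> D (y', x)).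
{ intros x Hx; split; [exact Hy' | now apply Rabs_between with u u']. }
assert (B2 : forall x, Rmin y y' <= x <= Rmax y y' -> D (x, u)).
{ intros x Hx; split; [now apply Rabs_between with y y' | exact Hu]. }
destruct (MVT_between (F y') (d2 F y') u u') as (c & Hc & E).
{ intros x Hx; exact (proj2 (smooth_partials D F F_smooth y' x (B1 x Hx))). }
destruct (MVT_between (fun z => F z u) (fun z => d1 F z u) y y') as (c' & Hc' & E').
{ intros x Hx; exact (proj1 (smooth_partials D F F_smooth x u (B2 x Hx))). }
exists c, c'; repeat split.
- now apply Rabs_between_le.
- now apply Rabs_between_le.
- apply (B1 c Hc).
- apply (B1 c Hc).
- lra.
Qed.

(** The values of [F] at both ends are known, so [increment_2d] gives the difference quotient
    exactly, through partial derivatives of [F] at intermediate points. Continuity of the implicit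
    function drives these points to (y, u). *)
Lemma implicit_partials : partials implicit_domain implicit_function
  (fun y s => - d1 F y (implicit_function y s) / d2 F y (implicit_function y s))
  (fun y s => / d2 F y (implicit_function y s)).
Proof.
intros y s Hys.
destruct (implicit_spec y s Hys) as [Hu E].
set (u := implicit_function y s) in *.
assert (C := implicit_continuous y s Hys).
assert (C2 : continuity_2d_pt (fun a b => / d2 F a b) y u).
{ apply continuity_2d_pt_inv.
  - apply smooth_cont with D; [apply smooth_d2, F_smooth | exact Hu].
  - generalize (F_incr y u Hu); lra. }
assert (C1 : continuity_2d_pt (d1 F) y u).
{ apply smooth_cont with D; [apply smooth_d1, F_smooth | exact Hu]. }
destruct (open_locally_2d _ _ _ implicit_domain_open Hys) as [dV HV].
split; apply is_derive_Reals; intros eps Heps.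
- assert (CK : continuity_2d_pt (fun a b => - a * b) (d1 F y u) (/ d2 F y u)).
  { apply continuity_2d_pt_mult; [apply continuity_2d_pt_opp |].
    - apply continuity_2d_pt_id1.
    - apply continuity_2d_pt_id2. }
  destruct (CK (mkposreal eps Heps)) as [dk Hk]; simpl in Hk.
  destruct (C1 dk) as [e1 He1], (C2 dk) as [e2 He2].
  destruct (C e2) as [e3 He3].
  assert (Hd : 0 < Rmin (Rmin dV e1) (Rmin e2 e3))
    by (repeat apply Rmin_pos; apply cond_pos).
  exists (mkposreal _ Hd); simpl; intros h Hh0 Hh.
  generalize (Rmin_l (Rmin dV e1) (Rmin e2 e3)),
    (Rmin_r (Rmin dV e1) (Rmin e2 e3)), (Rmin_l dV e1), (Rmin_r dV e1),
    (Rmin_l e2 e3), (Rmin_r e2 e3), (cond_pos dV), (cond_pos e1), (cond_pos e3);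
    intros.
  assert (Z : Rabs (s - s) = 0) by (rewrite Rminus_diag; apply Rabs_R0).
  assert (Z' : Rabs (u - u) = 0) by (rewrite Rminus_diag; apply Rabs_R0).
  assert (Hyh : y + h - y = h) by ring.
  assert (V' : implicit_domain (y + h, s)) by (apply HV; rewrite ?Hyh; lra).
  destruct (implicit_spec (y + h) s V') as [Hu' E'].
  assert (Hc3 := He3 (y + h) s ltac:(rewrite Hyh; lra) ltac:(lra)).
  fold u in Hc3.
  set (u' := implicit_function (y + h) s) in *.
  destruct (increment_2d y u (y + h) u' Hu Hu') as (c & c' & K1 & K2 & K3 & K4).
  rewrite Hyh in K2, K4.
  assert (P := F_incr _ _ K3).
  (* Both ends lie on the level set [F = s], so the two terms of the increment cancel and the
     quotient can be solved for. *)
  fold u; replace ((u' - u) / h) with (- d1 F c' u * / d2 F (y + h) c).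
  + apply Hk.
    * apply He1; lra.
    * apply He2; [rewrite Hyh; lra | lra].
  + rewrite E, E' in K4.
    assert (K5 : d1 F c' u = - d2 F (y + h) c * (u' - u) / h).
    { apply Rmult_eq_reg_r with h; [| exact Hh0].
      replace (- d2 F (y + h) c * (u' - u) / h * h)
        with (- d2 F (y + h) c * (u' - u)) by now field.
      lra. }
    rewrite K5; field; split; [exact Hh0 | lra].
- destruct (C2 (mkposreal eps Heps)) as [e2 He2]; simpl in He2.
  destruct (C e2) as [e3 He3].
  assert (Hd : 0 < Rmin dV e3) by (apply Rmin_pos; apply cond_pos).
  exists (mkposreal _ Hd); simpl; intros h Hh0 Hh.
  generalize (Rmin_l dV e3), (Rmin_r dV e3), (cond_pos dV), (cond_pos e3),
    (cond_pos e2); intros.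
  assert (Z : Rabs (y - y) = 0) by (rewrite Rminus_diag; apply Rabs_R0).
  assert (Hsh : s + h - s = h) by ring.
  assert (V' : implicit_domain (y, s + h)) by (apply HV; rewrite ?Hsh; lra).
  destruct (implicit_spec y (s + h) V') as [Hu' E'].
  assert (Hc3 := He3 y (s + h) ltac:(lra) ltac:(rewrite Hsh; lra)).
  fold u in Hc3.
  set (u' := implicit_function y (s + h)) in *.
  destruct (increment_2d y u y u' Hu Hu') as (c & c' & K1 & K2 & K3 & K4).
  assert (P := F_incr _ _ K3).
  fold u.
  replace ((u' - u) / h) with (/ d2 F y c).
  + apply He2; lra.
  + rewrite E, E', Rminus_diag, Rmult_0_r, Rplus_0_r, Rplus_minus_l in K4.
    assert (u' - u <> 0) by (intros N; rewrite N in K4; lra).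
    rewrite K4; field; split; [assumption | lra].
Qed.

(** The class consists of the functions K(y, g(y, s)) with K smooth on the box and g the implicit
    function. The partial derivatives of g have this form, hence by the chain rule so do those of
    every member. *)
Lemma implicit_smooth : smooth_on implicit_domain implicit_function.
Proof.
assert (HD : open D) by apply box_open.
apply smooth_of_class with (S := fun G => exists K, smooth_on D K /\
  forall y s, G y s = K y (implicit_function y s)).
- apply implicit_domain_open.
- intros G y s (K & HK & E) Hys.
  apply continuity_2d_pt_ext with (fun y s => K y (implicit_function y s)).
  { intros; symmetry; apply E. }
  apply continuity_2d_comp.
  + apply smooth_cont with D; [exact HK | now apply implicit_spec].
  + apply continuity_2d_pt_id1.
  + now apply implicit_continuous.
- intros G (K & HK & E).
  assert (N : forall y u, D (y, u) -> d2 F y u <> 0)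
    by (intros y u H; generalize (F_incr y u H); lra).
  assert (S1 := smooth_d1 D F F_smooth); assert (S2 := smooth_d2 D F F_smooth).
  assert (K1 := smooth_d1 D K HK); assert (K2 := smooth_d2 D K HK).
  exists (fun y s => (fun a b => d1 K a b * 1 + d2 K a b * (- d1 F a b / d2 F a b))
            y (implicit_function y s)),
    (fun y s => (fun a b => d1 K a b * 0 + d2 K a b * / d2 F a b)
            y (implicit_function y s)).
  split; [| split].
  + exists (fun a b => d1 K a b * 1 + d2 K a b * (- d1 F a b / d2 F a b));
      split; [| reflexivity].
    smooth.
  + exists (fun a b => d1 K a b * 0 + d2 K a b * / d2 F a b);
      split; [| reflexivity].
    smooth.
  + apply partials_ext with (F := fun y s => K y (implicit_function y s)).
    { apply implicit_domain_open. }
    { intros; symmetry; apply E. }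
    intros y s Hys; destruct (implicit_partials y s Hys) as [P1 P2].
    assert (B := proj1 (implicit_spec y s Hys)); split.
    * apply (is_derive_curve D K (fun z => z) (fun z => implicit_function z s));
        trivial; apply (is_derive_id y).
    * apply (is_derive_curve D K (fun z => y) (fun z => implicit_function y z));
        trivial; apply (is_derive_const y).
- exists (fun _ u => u); split; [now apply smooth_snd | trivial].
Qed.

End Implicit.

(** * Integrals with a parameter and linear integral equations *)

Lemma Rabs_minus_self (x : R) : Rabs (x - x) = 0.
Proof. now rewrite Rminus_diag, Rabs_R0. Qed.

Lemma continuity_2d_section2 (F : R -> R -> R) (a b : R) :
  continuity_2d_pt F a b -> continuous (F a) b.
Proof.
intros H; apply continuity_pt_filterlim; intros e He.
destruct (H (mkposreal e He)) as [d Hd].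
exists d; split; [apply cond_pos |].
intros x [_ Hx]; apply Hd; [rewrite Rabs_minus_self; apply cond_pos | exact Hx].
Qed.

Lemma continuity_2d_section1 (F : R -> R -> R) (a b : R) :
  continuity_2d_pt F a b -> continuous (fun z => F z b) a.
Proof.
intros H; apply continuity_pt_filterlim; intros e He.
destruct (H (mkposreal e He)) as [d Hd].
exists d; split; [apply cond_pos |].
intros x [_ Hx]; apply Hd; [exact Hx | rewrite Rabs_minus_self; apply cond_pos].
Qed.

(** A local bound on the derivative in the second variable controls the way from (u, v) to (u, b),
    and continuity in the first variable controls the rest. It serves for integrals, whose
    derivative in the upper limit is the integrand. *)
Lemma continuity_2d_of_derive2 (K F : R -> R -> R) (a b : R) :
  locally_2d (fun u v => is_derive (K u) v (F u v)) a b ->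
  continuity_2d_pt F a b -> continuous (fun z => K z b) a ->
  continuity_2d_pt K a b.
Proof.
intros [d1 H1] HF Hc eps.
destruct (HF (mkposreal 1 Rlt_0_1)) as [d2 H2]; simpl in H2.
apply continuity_pt_filterlim in Hc.
destruct (Hc (eps / 2)) as [d3 [P3 H3]].
{ generalize (cond_pos eps); lra. }
set (M := Rabs (F a b) + 1).
assert (HM : 0 < M) by (unfold M; generalize (Rabs_pos (F a b)); lra).
assert (Pd : 0 < Rmin (Rmin d1 d2) (Rmin d3 (eps / 2 / M))).
{ repeat apply Rmin_pos; try apply cond_pos; trivial.
  apply Rdiv_lt_0_compat; [generalize (cond_pos eps); lra | exact HM]. }
exists (mkposreal _ Pd); simpl; intros u v Hu Hv.
generalize (Rmin_l (Rmin d1 d2) (Rmin d3 (eps / 2 / M))),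
  (Rmin_r (Rmin d1 d2) (Rmin d3 (eps / 2 / M))), (Rmin_l d1 d2), (Rmin_r d1 d2),
  (Rmin_l d3 (eps / 2 / M)), (Rmin_r d3 (eps / 2 / M)); intros.
assert (B : Rabs (b - b) < Rmin d1 d2)
  by (rewrite Rabs_minus_self; apply Rmin_pos; apply cond_pos).
destruct (MVT_between (K u) (F u) b v) as (c & Hc' & E).
{ intros x Hx; apply H1; [lra |].
  apply Rle_lt_trans with (Rabs (v - b)); [now apply Rabs_between_le | lra]. }
assert (HFc : Rabs (F u c) < M).
{ assert (L := Rabs_between_le c b v Hc').
  assert (T := H2 u c ltac:(lra) ltac:(lra)).
  generalize (Rabs_triang (F u c - F a b) (F a b)).
  replace (F u c - F a b + F a b) with (F u c) by ring; unfold M; lra. }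
replace (K u v - K a b) with (F u c * (v - b) + (K u b - K a b)) by lra.
apply Rle_lt_trans with (1 := Rabs_triang _ _).
assert (E1 : Rabs (F u c * (v - b)) <= eps / 2).
{ rewrite Rabs_mult.
  replace (eps / 2) with (M * (eps / 2 / M)) by (field; lra).
  apply Rmult_le_compat; try apply Rabs_pos; lra. }
assert (E2 : Rabs (K u b - K a b) < eps / 2).
(* The definition of [continuity_pt] speaks only of points different from [a]. *)
{ destruct (Req_dec a u) as [-> | N].
  - rewrite Rabs_minus_self; generalize (cond_pos eps); lra.
  - apply H3; split; [split; [exact I | exact N] |].
    change (Rabs (u - a) < d3); lra. }
lra.
Qed.

Lemma RInt_primitive (f : R -> R) (c r x : R) :
  (forall z, Rabs (z - c) < r -> continuous f z) -> Rabs (x - c) < r ->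
  is_derive (fun z => RInt f c z) x (f x).
Proof.
intros Hf Hx; apply (is_derive_RInt f (fun z => RInt f c z) c x); [| now apply Hf].
assert (P : 0 < r - Rabs (x - c)) by lra.
exists (mkposreal _ P); intros z Hz; change (Rabs (z - x) < r - Rabs (x - c)) in Hz.
apply (RInt_correct f), (ex_RInt_continuous f); intros t Ht; apply Hf.
apply Rabs_between with (1 := Ht).
- rewrite Rabs_minus_self; generalize (Rabs_pos (x - c)); lra.
- generalize (Rabs_triang (z - x) (x - c)).
  replace (z - x + (x - c)) with (z - c) by ring; lra.
Qed.

Section Integral.

Variables (y0 u0 r : R).
Let D := box y0 u0 r.

Definition integral2 (F : R -> R -> R) (y u : R) : R := RInt (F y) u0 u.

Lemma box_segment (y u v : R) : D (y, u) -> Rmin u0 u <= v <= Rmax u0 u -> D (y, v).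
Proof.
intros [Hy Hu] Hv; split; [exact Hy | simpl in *].
apply Rabs_between with u0 u; trivial.
rewrite Rabs_minus_self; generalize (Rabs_pos (u - u0)); lra.
Qed.

Lemma integral2_partials (F : R -> R -> R) : smooth_on D F ->
  partials D (integral2 F) (integral2 (d1 F)) F.
Proof.
intros HF y u Hyu.
assert (CF : forall z v, D (z, v) -> continuous (F z) v).
{ intros z v H; apply continuity_2d_section2; now apply smooth_cont with D. }
split.
- assert (Ly := open_section1 D y u (box_open y0 u0 r) Hyu).
  apply (is_derive_RInt_param F u0 u y).
  + apply filter_imp with (2 := Ly); intros z Hz t Ht.
    eexists; exact (proj1 (smooth_partials D F HF z t (box_segment z u t Hz Ht))).
  + intros t Ht; apply (smooth_cont D (d1 F)); [apply smooth_d1, HF |].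
    exact (box_segment y u t Hyu Ht).
  + apply filter_imp with (2 := Ly); intros z Hz.
    apply (ex_RInt_continuous (F z)); intros t Ht; apply CF.
    exact (box_segment z u t Hz Ht).
- destruct Hyu as [Hy Hu]; apply (RInt_primitive (F y) u0 r); [| exact Hu].
  intros z Hz; apply CF; now split.
Qed.

(** The derivative in the parameter is again an integral, of [d1 K], and the derivative in the upper
    limit is [K] itself; so smooth functions and their integrals together are closed under partial
    derivatives. *)
Lemma integral2_smooth (F : R -> R -> R) : smooth_on D F ->
  smooth_on D (integral2 F).
Proof.
intros HF; assert (HD : open D) by apply box_open.
apply generated_smooth with (B := fun G => smooth_on D G \/
  exists K, smooth_on D K /\ G = integral2 K); [exact HD | | |
  apply gen_base; right; now exists F].
- intros G a b [HG | (K & HK & ->)] Hab; [now apply smooth_cont with D |].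
  apply continuity_2d_of_derive2 with K.
  + destruct (open_locally_2d D a b HD Hab) as [d Hd].
    exists d; intros u v Hu Hv; apply (integral2_partials K HK); now apply Hd.
  + now apply smooth_cont with D.
  + eapply is_derive_cont; exact (proj1 (integral2_partials K HK a b Hab)).
- intros G [HG | (K & HK & ->)].
  + exists (d1 G), (d2 G).
    split; [apply gen_base; left; apply smooth_d1, HG |].
    split; [apply gen_base; left; apply smooth_d2, HG |].
    apply smooth_partials, HG.
  + exists (integral2 (d1 K)), K.
    split; [apply gen_base; right; exists (d1 K); split; [apply smooth_d1, HK | easy] |].
    split; [apply gen_base; now left | now apply integral2_partials].
Qed.

End Integral.

(** * Fixed points of contractions and linear Volterra equations *)

(** Banach's theorem for the uniform distance with ratio 1/2, stated through explicit bounds on the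
    real line. The iterates start at 0 and converge uniformly, which makes the limit continuous. *)
Lemma contraction_fixpoint (T : (R -> R) -> R -> R) (A : R) :
  (forall f, (forall x, continuous f x) -> forall x, continuous (T f) x) ->
  (forall f g K, (forall x, continuous f x) -> (forall x, continuous g x) ->
     (forall x, Rabs (f x - g x) <= K) ->
     forall x, Rabs (T f x - T g x) <= K / 2) ->
  (forall x, Rabs (T (fun _ => 0) x) <= A) ->
  exists z, (forall x, continuous z x) /\ forall x, T z x = z x.
Proof.
intros Tc Tk T0.
set (u := fix u n := match n with O => fun _ => 0 | S n => T (u n) end).
assert (uc : forall n x, continuous (u n) x).
{ induction n; [intros x; apply continuous_const | simpl; now apply Tc]. }
(* The sum of the steps A / 2^k over k >= n, hence a bound for the distance from iterate n to the
   limit. *)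
set (B := fun n => 2 * A * (/ 2) ^ n).
assert (HA : 0 <= A) by (generalize (T0 0), (Rabs_pos (T (fun _ => 0) 0)); lra).
assert (Bh : forall n, B (S n) = B n / 2) by (intros n; unfold B; simpl; field).
assert (step : forall n x, Rabs (u (S n) x - u n x) <= B n / 2).
{ induction n as [| n IH]; intros x.
  - simpl; unfold B; simpl; rewrite Rminus_0_r; generalize (T0 x); lra.
  - rewrite Bh; apply (Tk (u (S n)) (u n) (B n / 2)); trivial. }
assert (far : forall n k x, Rabs (u (n + k)%nat x - u n x) <= B n - B (n + k)%nat).
{ intros n k x; induction k as [| k IH].
  - rewrite Nat.add_0_r, Rabs_minus_self; lra.
  - rewrite Nat.add_succ_r, Bh.
    replace (u (S (n + k)) x - u n x)
      with (u (S (n + k)) x - u (n + k)%nat x + (u (n + k)%nat x - u n x)) by ring.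
    apply Rle_trans with (1 := Rabs_triang _ _).
    generalize (step (n + k)%nat x); lra. }
assert (Bp : forall n, 0 <= B n).
{ intros n; unfold B; apply Rmult_le_pos; [lra | apply pow_le; lra]. }
assert (B0 : forall eps : posreal, exists n, B n < eps).
{ intros eps; destruct (pow_lt_1_zero (/ 2)) with (y := eps / (2 * A + 1)) as [n Hn].
  - rewrite Rabs_pos_eq; lra.
  - apply Rdiv_lt_0_compat; [apply cond_pos | lra].
  - exists n; specialize (Hn n (le_n n)).
    rewrite Rabs_pos_eq in Hn by (apply pow_le; lra).
    apply Rle_lt_trans with ((2 * A + 1) * (/ 2) ^ n).
    + unfold B; apply Rmult_le_compat_r; [apply pow_le |]; lra.
    + replace (pos eps) with ((2 * A + 1) * (eps / (2 * A + 1))) by (field; lra).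
      apply Rmult_lt_compat_l; lra. }
assert (lim : forall x, ex_finite_lim_seq (fun n => u n x)).
{ intros x; apply ex_lim_seq_cauchy_corr; intros eps.
  destruct (B0 (pos_div_2 eps)) as [N HN]; simpl in HN; exists N.
  intros n m Hn Hm.
  assert (P : forall k, (N <= k)%nat -> Rabs (u k x - u N x) < eps / 2).
  { intros k Hk; replace k with (N + (k - N))%nat by lia.
    generalize (far N (k - N)%nat x), (Bp (N + (k - N))%nat); lra. }
  replace (u n x - u m x) with (u n x - u N x + - (u m x - u N x)) by ring.
  apply Rle_lt_trans with (1 := Rabs_triang _ _); rewrite Rabs_Ropp.
  generalize (P n Hn), (P m Hm); lra. }
set (z := fun x => real (Lim_seq (fun n => u n x))).
assert (close : forall n x, Rabs (z x - u n x) <= B n).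
{ intros n x.
  assert (L : is_lim_seq (fun k => u (k + n)%nat x) (z x)).
  { apply is_lim_seq_incr_n with (u := fun n => u n x).
    exact (Lim_seq_correct' _ (lim x)). }
  assert (Q : forall k, u n x - B n <= u (k + n)%nat x <= u n x + B n).
  { intros k; rewrite (Nat.add_comm k n).
    assert (F := far n k x); apply Rabs_le_between in F.
    generalize (Bp (n + k)%nat); lra. }
  assert (H1 := is_lim_seq_le (fun _ => u n x - B n) _ (u n x - B n) _
    (fun k => proj1 (Q k)) (is_lim_seq_const _) L).
  assert (H2 := is_lim_seq_le _ (fun _ => u n x + B n) _ (u n x + B n)
    (fun k => proj2 (Q k)) L (is_lim_seq_const _)).
  simpl in H1, H2; apply Rabs_le_between; lra. }
assert (zc : forall x, continuous z x).
{ intros x; apply continuity_pt_filterlim; intros eps Heps.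
  assert (He3 : 0 < eps / 3) by lra.
  destruct (B0 (mkposreal _ He3)) as [n Hn]; simpl in Hn.
  assert (C := uc n x); apply continuity_pt_filterlim in C.
  destruct (C (eps / 3) He3) as [d [Pd Hd]]; exists d; split; [exact Pd |].
  intros y Hy; specialize (Hd y Hy); simpl in *; unfold Rdist in *.
  replace (z y - z x) with (z y - u n y + (u n y - u n x) + - (z x - u n x)) by ring.
  apply Rle_lt_trans with (1 := Rabs_triang _ _); rewrite Rabs_Ropp.
  generalize (Rabs_triang (z y - u n y) (u n y - u n x)), (close n x), (close n y);
    lra. }
exists z; split; [exact zc |]; intros x.
(* For every n, both [T z] and [z] are within B n / 2 of iterate n + 1, so they cannot differ at
   [x]. *)
destruct (Req_dec (T z x) (z x)) as [E | N]; [exact E | exfalso].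
assert (P : 0 < Rabs (T z x - z x)) by (apply Rabs_pos_lt; lra).
destruct (B0 (mkposreal _ P)) as [n Hn]; simpl in Hn.
assert (H1 := Tk z (u n) (B n) zc (uc n) (close n) x).
assert (H2 := close (S n) x); rewrite Bh in H2; simpl in H2.
generalize (Rabs_triang (T z x - T (u n) x) (- (z x - T (u n) x))).
rewrite Rabs_Ropp; replace (T z x - T (u n) x + - (z x - T (u n) x))
  with (T z x - z x) by ring; lra.
Qed.

(** A retraction onto [c - rho, c + rho]. Composing with it turns functions controlled on this
    interval only into functions continuous and bounded on the whole line, where the fixed point
    theorem is stated. *)
Definition clip (c rho x : R) : R := Rmax (c - rho) (Rmin (c + rho) x).

Lemma clip_bound (c rho x : R) : 0 <= rho -> Rabs (clip c rho x - c) <= rho.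
Proof.
intros H; unfold clip, Rmax, Rmin; apply Rabs_le_between.
destruct (Rle_dec (c + rho) x); destruct (Rle_dec _ _); lra.
Qed.

Lemma clip_id (c rho x : R) : Rabs (x - c) <= rho -> clip c rho x = x.
Proof.
intros H; apply Rabs_le_between in H; unfold clip, Rmax, Rmin.
destruct (Rle_dec (c + rho) x); destruct (Rle_dec _ _); lra.
Qed.

Lemma clip_continuous (c rho x : R) : continuous (clip c rho) x.
Proof.
apply continuity_pt_filterlim; intros e He; exists e; split; [exact He |].
intros y [_ Hy]; simpl in *; unfold Rdist in *.
apply Rle_lt_trans with (2 := Hy).
unfold clip, Rmax, Rmin.
destruct (Rle_dec (c + rho) y); destruct (Rle_dec (c + rho) x);
  repeat destruct (Rle_dec _ _); unfold Rabs; repeat destruct (Rcase_abs _); lra.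
Qed.

Definition primitive (c : R) (f : R -> R) (x : R) : R := RInt f c x.

Section Volterra.

Variables (c : R).

Lemma primitive_derive (f : R -> R) (x : R) :
  (forall z, continuous f z) -> is_derive (primitive c f) x (f x).
Proof.
intros Hf; apply (RInt_primitive f c (Rabs (x - c) + 1)); [trivial | lra].
Qed.

Lemma primitive_continuous (f : R -> R) (x : R) :
  (forall z, continuous f z) -> continuous (primitive c f) x.
Proof. intros Hf; eapply is_derive_cont, primitive_derive, Hf. Qed.

Lemma primitive_at (f : R -> R) : primitive c f c = 0.
Proof. apply (RInt_point c f). Qed.

Lemma primitive_close (f g : R -> R) (rho K : R) :
  (forall z, continuous f z) -> (forall z, continuous g z) ->
  (forall x, Rabs (x - c) <= rho -> Rabs (f x - g x) <= K) ->
  forall x, Rabs (x - c) <= rho ->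
    Rabs (primitive c f x - primitive c g x) <= K * rho.
Proof.
intros Hf Hg H x Hx.
destruct (MVT_between (fun z => primitive c f z - primitive c g z)
  (fun z => f z - g z) c x) as (d & Hd & E).
{ intros z _.
  apply (is_derive_minus (primitive c f) (primitive c g) z (f z) (g z));
    now apply primitive_derive. }
rewrite !primitive_at in E.
assert (Ld := Rabs_between_le d c x Hd).
replace (primitive c f x - primitive c g x) with ((f d - g d) * (x - c)) by lra.
rewrite Rabs_mult; apply Rmult_le_compat; try apply Rabs_pos; trivial.
apply H; lra.
Qed.

Lemma continuous_bounded_near (f : R -> R) : continuous f c ->
  exists d A, 0 < d /\ 0 <= A /\ forall x, Rabs (x - c) <= d -> Rabs (f x) <= A.
Proof.
intros Hf; apply continuity_pt_filterlim in Hf.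
destruct (Hf 1 Rlt_0_1) as [d [Pd Hd]].
exists (d / 2), (Rabs (f c) + 1).
split; [lra | split; [generalize (Rabs_pos (f c)); lra |]].
intros x Hx; destruct (Req_dec c x) as [<- | N]; [lra |].
assert (H : Rabs (f x - f c) < 1).
{ apply Hd; split; [split; [exact I | exact N] |].
  change (Rabs (x - c) < d); lra. }
generalize (Rabs_triang (f x - f c) (f c)).
replace (f x - f c + f c) with (f x) by ring; lra.
Qed.

(* A linear differential equation, written as an integral equation for the
   derivative of highest order. *)
Lemma volterra (b a1 a2 a3 : R -> R) (r : R) : 0 < r ->
  (forall x, Rabs (x - c) < r -> continuous b x /\ continuous a1 x /\
     continuous a2 x /\ continuous a3 x) ->
  exists rho z, 0 < rho <= r /\ (forall x, continuous z x) /\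
    forall x, Rabs (x - c) < rho ->
      z x = b x + a1 x * primitive c z x
            + a2 x * primitive c (primitive c z) x
            + a3 x * primitive c (primitive c (primitive c z)) x.
Proof.
intros Hr Hc.
assert (Hcc : Rabs (c - c) < r) by (rewrite Rabs_minus_self; exact Hr).
destruct (Hc c Hcc) as (Cb & C1 & C2 & C3).
destruct (continuous_bounded_near b Cb) as (db & Ab & Pdb & PAb & Bb).
destruct (continuous_bounded_near a1 C1) as (e1 & A1 & Pd1 & PA1 & B1).
destruct (continuous_bounded_near a2 C2) as (e2 & A2 & Pd2 & PA2 & B2).
destruct (continuous_bounded_near a3 C3) as (e3 & A3 & Pd3 & PA3 & B3).
(* With rho <= 1 / S, the contraction ratio (A1 + A2 + A3) rho is at most 1/2; the summand 1 forces
   S >= 1, hence rho <= 1. *)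
set (S := 2 * (A1 + A2 + A3) + 1).
set (rho := Rmin (Rmin (r / 2) (/ S)) (Rmin (Rmin db e1) (Rmin e2 e3))).
assert (PS : 1 <= S) by (unfold S; lra).
assert (PiS : 0 < / S) by (apply Rinv_0_lt_compat; lra).
assert (HS : / S * S = 1) by (field; lra).
assert (Prho : 0 < rho) by (repeat apply Rmin_pos; lra).
assert (Lrho : rho <= r / 2 /\ rho <= / S /\ rho <= db /\ rho <= e1 /\
          rho <= e2 /\ rho <= e3).
{ generalize (Rmin_l (Rmin (r / 2) (/ S)) (Rmin (Rmin db e1) (Rmin e2 e3))),
    (Rmin_r (Rmin (r / 2) (/ S)) (Rmin (Rmin db e1) (Rmin e2 e3))),
    (Rmin_l (r / 2) (/ S)), (Rmin_r (r / 2) (/ S)),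
    (Rmin_l (Rmin db e1) (Rmin e2 e3)), (Rmin_r (Rmin db e1) (Rmin e2 e3)),
    (Rmin_l db e1), (Rmin_r db e1), (Rmin_l e2 e3), (Rmin_r e2 e3).
  fold rho; lra. }
destruct Lrho as (L0 & LS & Lb & L1 & L2 & L3); clearbody rho.
assert (Hrho1 : rho <= 1).
{ apply Rle_trans with (1 := LS).
  rewrite <- Rinv_1; apply Rinv_le_contravar; lra. }
set (k := clip c rho).
assert (Hk : forall x, Rabs (k x - c) <= rho) by (intros x; apply clip_bound; lra).
assert (kc : forall (f : R -> R) x, (forall x, Rabs (x - c) < r -> continuous f x) ->
          continuous (fun x => f (k x)) x).
{ intros f x Hf; apply (continuous_comp k f); [apply clip_continuous |].
  apply Hf; generalize (Hk x); lra. }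
(* Coefficients and primitives are evaluated at the clipped point, so the bounds near [c] hold for
   every [x]. On the interval itself [k] is the identity and the fixed point solves the integral
   equation. *)
set (T := fun f x => b (k x) + a1 (k x) * primitive c f (k x)
            + a2 (k x) * primitive c (primitive c f) (k x)
            + a3 (k x) * primitive c (primitive c (primitive c f)) (k x)).
assert (pc : forall f : R -> R, (forall x, continuous f x) ->
          forall x, continuous (primitive c f) x)
  by (intros f Hf x; now apply primitive_continuous).
destruct (contraction_fixpoint T Ab) as (z & zc & Ez).
- intros f Hf x.
  assert (term : forall a g : R -> R,
            (forall x, Rabs (x - c) < r -> continuous a x) ->
            (forall x, continuous g x) -> continuous (fun x => a (k x) * g (k x)) x).
  { intros a g Ha Hg; apply (continuous_mult (fun x => a (k x)) (fun x => g (k x)));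
      [now apply (kc a) | now apply (kc g)]. }
  apply (continuous_plus (fun x => b (k x) + a1 (k x) * primitive c f (k x)
      + a2 (k x) * primitive c (primitive c f) (k x))
    (fun x => a3 (k x) * primitive c (primitive c (primitive c f)) (k x))).
  1: apply (continuous_plus (fun x => b (k x) + a1 (k x) * primitive c f (k x))
    (fun x => a2 (k x) * primitive c (primitive c f) (k x))).
  1: apply (continuous_plus (fun x => b (k x))
    (fun x => a1 (k x) * primitive c f (k x))).
  + apply (kc b); intros y Hy; apply (Hc y Hy).
  + apply (term a1); [intros y Hy; apply (Hc y Hy) | now apply pc].
  + apply (term a2); [intros y Hy; apply (Hc y Hy) | now apply pc, pc].
  + apply (term a3); [intros y Hy; apply (Hc y Hy) | now apply pc, pc, pc].
- intros f g K Hf Hg Hfg x.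
  assert (PK : 0 <= K) by (generalize (Hfg 0), (Rabs_pos (f 0 - g 0)); lra).
  (* Because rho <= 1, the bound obtained for one primitive can be fed to the next, and all three
     iterated primitives satisfy the bound K rho. *)
  assert (shrink : forall t, t <= K * rho -> t <= K).
  { intros t Ht; apply Rle_trans with (1 := Ht).
    rewrite <- (Rmult_1_r K) at 2; apply Rmult_le_compat_l; lra. }
  assert (Q1 := primitive_close f g rho K Hf Hg (fun x _ => Hfg x)).
  assert (Q2 := primitive_close _ _ rho K (pc f Hf) (pc g Hg)
    (fun x Hx => shrink _ (Q1 x Hx))).
  assert (Q3 := primitive_close _ _ rho K (pc _ (pc f Hf)) (pc _ (pc g Hg))
    (fun x Hx => shrink _ (Q2 x Hx))).
  specialize (Q1 (k x) (Hk x)); specialize (Q2 (k x) (Hk x));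
    specialize (Q3 (k x) (Hk x)).
  assert (H1 := B1 (k x) ltac:(generalize (Hk x); lra)).
  assert (H2 := B2 (k x) ltac:(generalize (Hk x); lra)).
  assert (H3 := B3 (k x) ltac:(generalize (Hk x); lra)).
  assert (M : forall a A p, Rabs a <= A -> Rabs p <= K * rho ->
            Rabs (a * p) <= A * (K * rho)).
  { intros a A p Ha Hp; rewrite Rabs_mult.
    apply Rmult_le_compat; trivial; apply Rabs_pos. }
  assert (M1 := M _ _ _ H1 Q1); assert (M2 := M _ _ _ H2 Q2);
    assert (M3 := M _ _ _ H3 Q3).
  assert (tot : (A1 + A2 + A3) * (K * rho) <= K / 2).
  { apply Rle_trans with ((A1 + A2 + A3) * (K * / S)).
    - apply Rmult_le_compat_l; [lra | now apply Rmult_le_compat_l].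
    - assert (PKS : 0 <= K * / S) by (apply Rmult_le_pos; lra).
      assert (EN : A1 + A2 + A3 = (S - 1) / 2) by (unfold S; lra).
      replace ((A1 + A2 + A3) * (K * / S)) with (K / 2 - K * / S / 2).
      2: { rewrite EN; clear - PS; clearbody S; field; lra. }
      lra. }
  unfold T.
  match goal with |- Rabs ?e <= _ => replace e with
    (a1 (k x) * (primitive c f (k x) - primitive c g (k x))
     + a2 (k x) * (primitive c (primitive c f) (k x)
                   - primitive c (primitive c g) (k x))
     + a3 (k x) * (primitive c (primitive c (primitive c f)) (k x)
                   - primitive c (primitive c (primitive c g)) (k x))) by ring end.
  apply Rle_trans with (1 := Rabs_triang _ _).
  eapply Rle_trans; [apply Rplus_le_compat_r, Rabs_triang |]; lra.
- intros x; unfold T.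
  assert (Z : forall f : R -> R, (forall x, f x = 0) -> forall x, primitive c f x = 0).
  { intros f Hf y; unfold primitive; rewrite (RInt_ext f (fun _ => 0)).
    - rewrite RInt_const; exact (Rmult_0_r (y - c)).
    - intros; apply Hf. }
  assert (Z1 := Z (fun _ => 0) (fun _ => eq_refl)).
  assert (Z2 := Z _ Z1); assert (Z3 := Z _ Z2).
  rewrite Z1, Z2, Z3, !Rmult_0_r, !Rplus_0_r; apply Bb.
  generalize (Hk x); lra.
- exists rho, z; split; [lra | split; [exact zc |]].
  intros x Hx; rewrite <- Ez at 1; unfold T, k; rewrite clip_id by lra; reflexivity.
Qed.

End Volterra.

(** * Jets along a curve and the transformed third derivative *)

(** The total derivatives of orders 1, 2, 3 of [F] along a curve with u' = p, u'' = q, u''' = w,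
    each obtained by differentiating the preceding one formally. *)
Definition jet1 (F : R -> R -> R) (y u p : R) : R :=
  d1 F y u + d2 F y u * p.

Definition jet2 (F : R -> R -> R) (y u p q : R) : R :=
  jet1 (d1 F) y u p + jet1 (d2 F) y u p * p + d2 F y u * q.

Definition jet3 (F : R -> R -> R) (y u p q w : R) : R :=
  jet2 (d1 F) y u p q + jet2 (d2 F) y u p q * p
  + 2 * jet1 (d2 F) y u p * q + d2 F y u * w.

Lemma thrice_derivatives (u : R -> R) (y : R) :
  thrice_differentiable_near u y ->
  locally y (fun z => is_derive u z (Derive u z) /\
    is_derive (Derive u) z (Derive_n u 2 z) /\
    is_derive (Derive_n u 2) z (Derive_n u 3 z)).
Proof.
unfold thrice_differentiable_near; apply filter_imp; intros z H.
split; [| split]; apply Derive_correct.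
- exact (H 1%nat ltac:(lia)).
- exact (H 2%nat ltac:(lia)).
- exact (H 3%nat ltac:(lia)).
Qed.

Lemma is_derive_Rplus (f g : R -> R) (x df dg : R) :
  is_derive f x df -> is_derive g x dg ->
  is_derive (fun z => f z + g z) x (df + dg).
Proof. exact (is_derive_plus f g x df dg). Qed.

(** Stated on a neighbourhood of [y], because identities along the curve are differentiated again
    afterwards; the graph stays in the open set [U] by continuity of [u]. *)
Lemma curve_jets (U : R * R -> Prop) (F : R -> R -> R) (u : R -> R) (y : R) :
  open U -> smooth_on U F -> U (y, u y) -> thrice_differentiable_near u y ->
  locally y (fun z =>
    is_derive (fun x => F x (u x)) z (jet1 F z (u z) (Derive u z)) /\
    is_derive (fun x => jet1 F x (u x) (Derive u x)) z
      (jet2 F z (u z) (Derive u z) (Derive_n u 2 z)) /\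
    is_derive (fun x => jet2 F x (u x) (Derive u x) (Derive_n u 2 x)) z
      (jet3 F z (u z) (Derive u z) (Derive_n u 2 z) (Derive_n u 3 z))).
Proof.
intros HU HF Hy Hu; apply thrice_derivatives in Hu.
assert (HyU : locally y (fun z => U (z, u z))).
{ assert (C1 := is_derive_cont u y _ (proj1 (locally_singleton _ _ Hu))).
  destruct (open_locally_2d U y (u y) HU Hy) as [d Hd].
  generalize (C1 _ (locally_ball (u y) d)); unfold filtermap; intros C2.
  generalize (filter_and _ _ C2 (locally_ball y d)); apply filter_imp.
  intros z [B1 B2]; now apply Hd. }
generalize (filter_and _ _ HyU Hu); apply filter_imp.
intros z (Hz & U1 & U2 & U3).
set (u1 := Derive u) in *; set (u2 := Derive_n u 2) in *;
  set (u3 := Derive_n u 3) in *.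
assert (J1 : forall G, smooth_on U G ->
          is_derive (fun x => G x (u x)) z (jet1 G z (u z) (u1 z))).
{ intros G HG; replace (jet1 G z (u z) (u1 z))
    with (d1 G z (u z) * 1 + d2 G z (u z) * u1 z) by (unfold jet1; ring).
  apply (is_derive_curve U G (fun x => x)); trivial; apply (is_derive_id z). }
assert (J2 : forall G, smooth_on U G ->
          is_derive (fun x => jet1 G x (u x) (u1 x)) z
            (jet2 G z (u z) (u1 z) (u2 z))).
{ intros G HG.
  replace (jet2 G z (u z) (u1 z) (u2 z)) with (jet1 (d1 G) z (u z) (u1 z) +
    (jet1 (d2 G) z (u z) (u1 z) * u1 z + d2 G z (u z) * u2 z))
    by (unfold jet2; ring).
  apply (is_derive_Rplus (fun x => d1 G x (u x)) (fun x => d2 G x (u x) * u1 x)).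
  - apply J1; smooth.
  - apply (is_derive_Rmult (fun x => d2 G x (u x)) u1); [| exact U2].
    apply J1; smooth. }
split; [now apply J1 | split; [now apply J2 |]].
replace (jet3 F z (u z) (u1 z) (u2 z) (u3 z))
  with (jet2 (d1 F) z (u z) (u1 z) (u2 z)
        + (jet2 (d2 F) z (u z) (u1 z) (u2 z) * u1 z
           + jet1 (d2 F) z (u z) (u1 z) * u2 z)
        + (jet1 (d2 F) z (u z) (u1 z) * u2 z + d2 F z (u z) * u3 z))
  by (unfold jet3; ring).
apply (is_derive_Rplus
  (fun x => jet1 (d1 F) x (u x) (u1 x) + jet1 (d2 F) x (u x) (u1 x) * u1 x)
  (fun x => d2 F x (u x) * u2 x)).
- apply (is_derive_Rplus (fun x => jet1 (d1 F) x (u x) (u1 x))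
    (fun x => jet1 (d2 F) x (u x) (u1 x) * u1 x)).
  + apply J2; smooth.
  + apply (is_derive_Rmult (fun x => jet1 (d2 F) x (u x) (u1 x)) u1);
      [apply J2; smooth | exact U2].
- apply (is_derive_Rmult (fun x => d2 F x (u x)) u2); [apply J1; smooth | exact U3].
Qed.

(** The numerator of the third derivative of a parametrized curve: d^3 s / dt^3 times (dt/dy)^5,
    which is a polynomial in the jets of [phi] and [psi]. *)
Definition transformed_third (phi psi : R -> R -> R) (y u p q w : R) : R :=
  jet3 psi y u p q w * jet1 phi y u p ^ 2
  - 3 * jet2 psi y u p q * jet1 phi y u p * jet2 phi y u p q
  - jet1 psi y u p * jet1 phi y u p * jet3 phi y u p q w
  + 3 * jet1 psi y u p * jet2 phi y u p q ^ 2.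

Lemma locally_is_derive_eq (f g df dg : R -> R) (y : R) :
  locally y (fun z => f z = g z) -> locally y (fun z => is_derive f z (df z)) ->
  locally y (fun z => is_derive g z (dg z)) -> locally y (fun z => df z = dg z).
Proof.
intros E Hf Hg.
generalize (filter_and _ _ (locally_locally _ _ E) (filter_and _ _ Hf Hg)).
apply filter_imp; intros z (Ez & Hfz & Hgz).
apply (is_derive_ext_loc f g) in Hfz; [| exact Ez].
now rewrite <- (is_derive_unique _ _ _ Hfz), <- (is_derive_unique _ _ _ Hgz).
Qed.

(** Differentiating s(t(z)) = psi(z, u(z)) three times gives a triangular system for s', s'', s''';
    the combination in [transformed_third] eliminates s' and s''. *)
Lemma third_derivative (U : R * R -> Prop) (phi psi : R -> R -> R)
    (u s : R -> R) (y : R) :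
  let t := fun z => phi z (u z) in
  open U -> smooth_on U phi -> smooth_on U psi -> U (y, u y) ->
  thrice_differentiable_near u y -> thrice_differentiable_near s (t y) ->
  locally y (fun z => s (t z) = psi z (u z)) ->
  Derive_n s 3 (t y) * jet1 phi y (u y) (Derive u y) ^ 5
  = transformed_third phi psi y (u y) (Derive u y) (Derive_n u 2 y) (Derive_n u 3 y).
Proof.
intros t HU Hphi Hpsi Hy Hu Hs E.
assert (T := curve_jets U phi u y HU Hphi Hy Hu).
assert (P := curve_jets U psi u y HU Hpsi Hy Hu).
fold t in T.
assert (Ct : continuous t y)
  by (eapply is_derive_cont; exact (proj1 (locally_singleton _ _ T))).
apply thrice_derivatives, Ct in Hs; unfold filtermap in Hs.
unfold transformed_third.
set (t1 := fun z => jet1 phi z (u z) (Derive u z)) in *.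
set (t2 := fun z => jet2 phi z (u z) (Derive u z) (Derive_n u 2 z)) in *.
set (t3 := fun z => jet3 phi z (u z) (Derive u z) (Derive_n u 2 z) (Derive_n u 3 z)) in *.
set (p0 := fun z => psi z (u z)) in *.
set (p1 := fun z => jet1 psi z (u z) (Derive u z)) in *.
set (p2 := fun z => jet2 psi z (u z) (Derive u z) (Derive_n u 2 z)) in *.
set (p3 := fun z => jet3 psi z (u z) (Derive u z) (Derive_n u 2 z) (Derive_n u 3 z)) in *.
set (s1 := Derive s) in *; set (s2 := Derive_n s 2) in *; set (s3 := Derive_n s 3) in *.
change (s3 (t y) * t1 y ^ 5
  = p3 y * t1 y ^ 2 - 3 * p2 y * t1 y * t2 y - p1 y * t1 y * t3 y + 3 * p1 y * t2 y ^ 2).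
change (locally y (fun z => is_derive t z (t1 z) /\ is_derive t1 z (t2 z) /\
  is_derive t2 z (t3 z))) in T.
change (locally y (fun z => is_derive p0 z (p1 z) /\ is_derive p1 z (p2 z) /\
  is_derive p2 z (p3 z))) in P.
assert (E1 : locally y (fun z => p1 z = s1 (t z) * t1 z)).
{ apply (locally_is_derive_eq p0 (fun z => s (t z))).
  - generalize E; apply filter_imp; now intros z ->.
  - generalize P; apply filter_imp; tauto.
  - generalize (filter_and _ _ T Hs); apply filter_imp; intros z ((T1 & _) & S1 & _).
    rewrite Rmult_comm; now apply is_derive_Rcomp. }
assert (E2 : locally y (fun z => p2 z = s2 (t z) * t1 z ^ 2 + s1 (t z) * t2 z)).
{ apply (locally_is_derive_eq p1 (fun z => s1 (t z) * t1 z)); [exact E1 | |].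
  - generalize P; apply filter_imp; tauto.
  - generalize (filter_and _ _ T Hs); apply filter_imp.
    intros z ((T1 & T2 & _) & S1 & S2 & _).
    replace (s2 (t z) * t1 z ^ 2 + s1 (t z) * t2 z)
      with (t1 z * s2 (t z) * t1 z + s1 (t z) * t2 z) by ring.
    apply (is_derive_Rmult (fun z => s1 (t z)) t1); [| exact T2].
    now apply is_derive_Rcomp. }
assert (E3 : locally y (fun z => p3 z = s3 (t z) * t1 z ^ 3
                          + 3 * s2 (t z) * t1 z * t2 z + s1 (t z) * t3 z)).
{ apply (locally_is_derive_eq p2
    (fun z => s2 (t z) * (t1 z * t1 z) + s1 (t z) * t2 z)).
  - generalize E2; apply filter_imp; intros z ->; ring.
  - generalize P; apply filter_imp; tauto.
  - generalize (filter_and _ _ T Hs); apply filter_imp.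
    intros z ((T1 & T2 & T3) & S1 & S2 & S3).
    replace (s3 (t z) * t1 z ^ 3 + 3 * s2 (t z) * t1 z * t2 z + s1 (t z) * t3 z)
      with (t1 z * s3 (t z) * (t1 z * t1 z)
            + s2 (t z) * (t2 z * t1 z + t1 z * t2 z)
            + (t1 z * s2 (t z) * t2 z + s1 (t z) * t3 z)) by ring.
    apply (is_derive_Rplus (fun z => s2 (t z) * (t1 z * t1 z))
      (fun z => s1 (t z) * t2 z)).
    + apply (is_derive_Rmult (fun z => s2 (t z)) (fun z => t1 z * t1 z)).
      * now apply is_derive_Rcomp.
      * now apply is_derive_Rmult.
    + apply (is_derive_Rmult (fun z => s1 (t z)) t2); [| exact T3].
      now apply is_derive_Rcomp. }
apply locally_singleton in E1, E2, E3; rewrite E1, E2, E3; ring.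
Qed.

(** * Curves realizing prescribed jets *)

Lemma smooth_section_thrice (V : R * R -> Prop) (G : R -> R -> R) (a b : R) :
  open V -> smooth_on V G -> V (a, b) -> thrice_differentiable_near (G a) b.
Proof.
intros HV HG Hab; unfold thrice_differentiable_near.
generalize (open_section2 V a b HV Hab); apply filter_imp; intros z Hz k Hk.
assert (H2 := smooth_d2 V G HG); assert (H3 := smooth_d2 V _ H2).
destruct k as [| [| [| [| k]]]].
- exact I.
- eexists; exact (proj2 (smooth_partials V G HG a z Hz)).
- eexists; exact (proj2 (smooth_partials V (d2 G) H2 a z Hz)).
- eexists; exact (proj2 (smooth_partials V (d2 (d2 G)) H3 a z Hz)).
- lia.
Qed.

Lemma open_full : open (fun _ : R * R => True).
Proof. intros q _; apply filter_true. Qed.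

(** Since dt/dy = p <> 0, the map z -> phi(z, u(z)) has a smooth local inverse, and s is psi along
    the curve composed with that inverse. *)
Lemma curve_reparametrization (U : R * R -> Prop) (phi psi : R -> R -> R)
    (u : R -> R) (y p : R) :
  open U -> smooth_on U phi -> smooth_on U psi ->
  smooth_on (fun _ => True) (fun _ z => u z) ->
  U (y, u y) -> is_derive (fun z => phi z (u z)) y p -> p <> 0 ->
  exists s, thrice_differentiable_near s (phi y (u y)) /\
    locally y (fun z => s (phi z (u z)) = psi z (u z)).
Proof.
intros HU Hphi Hpsi Hu Hy Hp Np.
(* The implicit function theorem above assumes an increasing function; the sign of [p] is put in
   here and undone by evaluating at [sg * b]. *)
set (sg := if Rlt_dec 0 p then 1 else -1).
assert (Hsg : sg * sg = 1) by (unfold sg; destruct (Rlt_dec 0 p); ring).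
assert (Psg : 0 < sg * p) by (unfold sg; destruct (Rlt_dec 0 p); lra).
(* A dummy first variable makes the one-variable inverse function theorem an instance of the
   implicit one. *)
set (F := fun _ z : R => sg * phi z (u z)).
set (W := fun q : R * R => U (snd q, u (snd q))).
assert (HW : open W).
{ apply open_of_locally_2d; intros a b Hab.
  destruct (open_locally_2d U b (u b) HU Hab) as [d Hd].
  destruct (smooth_cont _ _ 0 b Hu I d) as [e He].
  assert (Pm : 0 < Rmin d e) by (apply Rmin_pos; apply cond_pos).
  exists (mkposreal _ Pm); simpl; intros a' b' _ Hb'.
  generalize (Rmin_l d e), (Rmin_r d e); intros.
  apply Hd; [simpl in *; lra |].
  apply (He 0 b'); [rewrite Rabs_minus_self; apply cond_pos | lra]. }
assert (HuW : smooth_on W (fun _ z => u z)) by (apply smooth_subset with (2 := Hu); easy).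
assert (Hsnd : smooth_on W (fun _ z => z)) by now apply smooth_snd.
assert (HF : smooth_on W F).
{ unfold F; apply (smooth_mult W (fun _ _ => sg) (fun _ z => phi z (u z))); trivial.
  - now apply smooth_const.
  - apply (smooth_comp W U phi (fun _ z => z) (fun _ z => u z)); auto. }
assert (HW0 : W (0, y)) by exact Hy.
assert (DF : d2 F 0 y = sg * p).
{ apply is_derive_unique; apply is_derive_Reals.
  apply (derivable_pt_lim_scal (fun z => phi z (u z))); now apply is_derive_Reals. }
assert (near : locally_2d (fun a b => W (a, b) /\ 0 < d2 F a b) 0 y).
{ apply locally_2d_and; [now apply open_locally_2d |].
  assert (C := smooth_cont W (d2 F) 0 y (smooth_d2 W F HF) HW0).
  rewrite <- DF in Psg; destruct (C (mkposreal _ Psg)) as [d Hd]; simpl in Hd.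
  exists d; intros a b Ha Hb; specialize (Hd a b Ha Hb); apply Rabs_def2 in Hd; lra. }
destruct near as [r Hr].
assert (B : forall a b, box 0 y r (a, b) -> W (a, b) /\ 0 < d2 F a b)
  by (intros a b [B1 B2]; now apply Hr).
assert (FB : smooth_on (box 0 y r) F)
  by (apply smooth_subset with (2 := HF); intros; now apply B).
assert (PB : forall a b, box 0 y r (a, b) -> 0 < d2 F a b) by (intros; now apply B).
set (V := implicit_domain 0 y r F).
set (eta := implicit_function 0 y r F).
assert (HV : open V) by (apply implicit_domain_open; trivial).
assert (Seta : smooth_on V eta) by (apply implicit_smooth; trivial).
set (V' := fun q : R * R => V (fst q, sg * snd q)).
assert (HV' : open V').
{ apply open_of_locally_2d; intros a b Hab.
  destruct (open_locally_2d V _ _ HV Hab) as [d Hd]; exists d.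
  intros a' b' Ha' Hb'; apply Hd; [exact Ha' |]; simpl.
  replace (sg * b' - sg * b) with (sg * (b' - b)) by ring; rewrite Rabs_mult.
  replace (Rabs sg) with 1; [lra |].
  unfold sg; destruct (Rlt_dec 0 p); rewrite ?Rabs_Ropp, ?Rabs_R1; trivial.
  unfold Rabs; destruct (Rcase_abs (-1)); lra. }
assert (Se : smooth_on V' (fun a b => eta a (sg * b))).
{ apply (smooth_comp V' V eta (fun a _ => a) (fun _ b => sg * b)); trivial; smooth;
    trivial. }
assert (EW : forall a b, V' (a, b) -> W (a, eta a (sg * b))).
{ intros a b Hab; apply B, implicit_spec, Hab. }
set (S := fun a b => psi (eta a (sg * b)) (u (eta a (sg * b)))).
assert (HS : smooth_on V' S).
{ apply (smooth_comp V' W (fun _ z => psi z (u z)) (fun a _ => a)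
    (fun a b => eta a (sg * b))); trivial.
  - apply (smooth_comp W U psi (fun _ z => z) (fun _ z => u z)); auto.
  - now apply smooth_fst. }
assert (By : box 0 y r (0, y)) by (apply box_center, cond_pos).
assert (inV : forall z, box 0 y r (0, z) -> V' (0, phi z (u z)) /\
          eta 0 (sg * phi z (u z)) = z).
{ intros z Hz; split; [now exists z |].
  apply (implicit_left 0 y r F FB PB 0 z Hz). }
exists (S 0); split.
- apply (smooth_section_thrice V'); trivial; now apply inV.
- exists r; intros z Hz.
  assert (Bz : box 0 y r (0, z))
    by (split; [apply By | exact Hz]).
  unfold S; now rewrite (proj2 (inV z Bz)).
Qed.

Lemma polynomial_with_jet (y c0 c1 c2 c3 : R) :
  exists u : R -> R, smooth_on (fun _ => True) (fun _ z => u z) /\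
    u y = c0 /\ Derive u y = c1 /\ Derive_n u 2 y = c2 /\ Derive_n u 3 y = c3.
Proof.
set (u := fun z => c0 + c1 * (z - y) + c2 / 2 * (z - y) ^ 2 + c3 / 6 * (z - y) ^ 3).
set (v1 := fun z => c1 + c2 * (z - y) + c3 / 2 * (z - y) ^ 2).
set (v2 := fun z => c2 + c3 * (z - y)).
assert (D1 : forall z, Derive u z = v1 z).
{ intros z; apply is_derive_unique; unfold u, v1; auto_derive; [easy | field]. }
assert (D2 : forall z, Derive v1 z = v2 z).
{ intros z; apply is_derive_unique; unfold v1, v2; auto_derive; [easy | field]. }
assert (D3 : Derive v2 y = c3).
{ apply is_derive_unique; unfold v2; auto_derive; [easy | ring]. }
assert (E2 : forall z, Derive_n u 2 z = v2 z).
{ intros z; rewrite <- D2; simpl; now apply Derive_ext. }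
exists u; repeat split.
- unfold u.
  assert (HO := open_full); smooth; trivial.
- unfold u; ring.
- rewrite D1; unfold v1; ring.
- rewrite E2; unfold v2; ring.
- rewrite <- D3; simpl; apply Derive_ext; intros z; exact (E2 z).
Qed.

(** The passage from curves to jets: a cubic polynomial realizes the given jet, its image is
    reparametrized as a graph, and multiplying the linear equation by the nonzero (dt/dy)^5 removes
    s. *)
Lemma jet_equivalence (U : R * R -> Prop) (phi psi : R -> R -> R)
    (f : R -> R -> R -> R -> R) (alpha : R -> R) (y c p q w : R) :
  open U -> smooth_on U phi -> smooth_on U psi ->
  transforms_to_linear U phi psi f alpha ->
  U (y, c) -> jet1 phi y c p <> 0 ->
  (w = f y c p q <-> transformed_third phi psi y c p q w
     + alpha (phi y c) * psi y c * jet1 phi y c p ^ 5 = 0).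
Proof.
intros HU Hphi Hpsi Htr Hyc Np.
destruct (polynomial_with_jet y c p q w) as (u & Su & <- & <- & <- & <-).
assert (Hu : thrice_differentiable_near u y)
  by exact (smooth_section_thrice _ _ 0 y open_full Su I).
assert (J := locally_singleton _ _ (curve_jets U phi u y HU Hphi Hyc Hu)).
destruct J as [J _].
destruct (curve_reparametrization U phi psi u y _ HU Hphi Hpsi Su Hyc J Np)
  as (s & Hs & E).
assert (T := third_derivative U phi psi u s y HU Hphi Hpsi Hyc Hu Hs E).
assert (Es := locally_singleton _ _ E).
assert (Dt : Derive (fun z => phi z (u z)) y <> 0).
{ intros Z; apply Np; rewrite <- Z; symmetry; exact (is_derive_unique _ _ _ J). }
assert (H := Htr u s y Hyc Hu Dt Hs E); cbv zeta beta in H, T.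
rewrite H; clear H; rewrite <- T, Es.
assert (N5 : jet1 phi y (u y) (Derive u y) ^ 5 <> 0) by now apply pow_nonzero.
split; intros H.
- rewrite <- Rmult_plus_distr_r, H; ring.
- apply (Rmult_eq_reg_r (jet1 phi y (u y) (Derive u y) ^ 5)); [| exact N5].
  rewrite Rmult_0_l, <- H; ring.
Qed.

(** * Pullback of the linear equation *)

Lemma partials_const (D : R * R -> Prop) (c : R) :
  partials D (fun _ _ => c) (fun _ _ => 0) (fun _ _ => 0).
Proof. intros a b _; split; apply (is_derive_const c). Qed.

Lemma partials_plus (D : R * R -> Prop) (F G F1 F2 G1 G2 : R -> R -> R) :
  partials D F F1 F2 -> partials D G G1 G2 ->
  partials D (fun a b => F a b + G a b) (fun a b => F1 a b + G1 a b)
    (fun a b => F2 a b + G2 a b).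
Proof.
intros P Q a b Hab; destruct (P a b Hab) as [P1 P2], (Q a b Hab) as [Q1 Q2].
split.
- exact (is_derive_Rplus (fun z => F z b) (fun z => G z b) _ _ _ P1 Q1).
- exact (is_derive_Rplus (fun z => F a z) (fun z => G a z) _ _ _ P2 Q2).
Qed.

Lemma partials_minus (D : R * R -> Prop) (F G F1 F2 G1 G2 : R -> R -> R) :
  partials D F F1 F2 -> partials D G G1 G2 ->
  partials D (fun a b => F a b - G a b) (fun a b => F1 a b - G1 a b)
    (fun a b => F2 a b - G2 a b).
Proof.
intros P Q a b Hab; destruct (P a b Hab) as [P1 P2], (Q a b Hab) as [Q1 Q2].
split.
- exact (is_derive_minus (fun z => F z b) (fun z => G z b) _ _ _ P1 Q1).
- exact (is_derive_minus (fun z => F a z) (fun z => G a z) _ _ _ P2 Q2).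
Qed.

Lemma partials_mult (D : R * R -> Prop) (F G F1 F2 G1 G2 : R -> R -> R) :
  partials D F F1 F2 -> partials D G G1 G2 ->
  partials D (fun a b => F a b * G a b)
    (fun a b => F1 a b * G a b + F a b * G1 a b)
    (fun a b => F2 a b * G a b + F a b * G2 a b).
Proof.
intros P Q a b Hab; destruct (P a b Hab) as [P1 P2], (Q a b Hab) as [Q1 Q2].
split.
- exact (is_derive_Rmult (fun z => F z b) (fun z => G z b) _ _ _ P1 Q1).
- exact (is_derive_Rmult (fun z => F a z) (fun z => G a z) _ _ _ P2 Q2).
Qed.

(** The two derivative functions are existential variables, filled in by the calculus rules along
    the syntax of the function. *)
Ltac partials :=
  lazymatch goal with
  | |- partials ?D (fun _ _ => ?c) _ _ => apply (partials_const D c)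
  | |- partials ?D (fun a b => @?f a b + @?g a b) _ _ =>
      eapply (partials_plus D f g); partials
  | |- partials ?D (fun a b => @?f a b - @?g a b) _ _ =>
      eapply (partials_minus D f g); partials
  | |- partials ?D (fun a b => @?f a b * @?g a b) _ _ =>
      eapply (partials_mult D f g); partials
  | |- partials ?D (fun a b => ?f a b) _ _ =>
      first [eassumption | apply (smooth_partials D f); smooth]
  | |- partials ?D ?f _ _ =>
      first [eassumption | apply (smooth_partials D f); smooth]
  end.

Lemma partials_congr (D : R * R -> Prop) (F G F1 F2 G1 G2 : R -> R -> R) (a b : R) :
  open D -> (forall a b, D (a, b) -> F a b = G a b) ->
  partials D F F1 F2 -> partials D G G1 G2 -> D (a, b) ->
  F1 a b = G1 a b /\ F2 a b = G2 a b.
Proof.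
intros HD E P Q Hab; assert (P' := partials_ext D F G F1 F2 HD E P).
destruct (partials_eq D G F1 F2 a b P' Hab) as [<- <-].
exact (partials_eq D G G1 G2 a b Q Hab).
Qed.

(* From an identity E between functions on the open set D, the two identities
   E1, E2 between their partial derivatives at each point. *)
Tactic Notation "differentiate" constr(HD) hyp(E) ident(E1) ident(E2) :=
  lazymatch type of E with
  | forall a b, ?D (a, b) -> @?F a b = @?G a b =>
      let F1 := open_constr:(_) in let F2 := open_constr:(_) in
      let G1 := open_constr:(_) in let G2 := open_constr:(_) in
      let PF := fresh in let PG := fresh in
      assert (PF : partials D F F1 F2) by partials;
      assert (PG : partials D G G1 G2) by partials;
      assert (E1 := fun a b H => proj1 (partials_congr D F G _ _ _ _ a b HD E PF PG H));
      assert (E2 := fun a b H => proj2 (partials_congr D F G _ _ _ _ a b HD E PF PG H));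
      cbv beta in E1, E2; clear PF PG
  end.

Lemma d1_congr (D : R * R -> Prop) (F G : R -> R -> R) (a b : R) :
  open D -> (forall a b, D (a, b) -> F a b = G a b) -> D (a, b) ->
  d1 F a b = d1 G a b.
Proof.
intros HD E Hab; apply Derive_ext_loc.
generalize (open_section1 D a b HD Hab); apply filter_imp; intros z; apply E.
Qed.

Lemma d2_congr (D : R * R -> Prop) (F G : R -> R -> R) (a b : R) :
  open D -> (forall a b, D (a, b) -> F a b = G a b) -> D (a, b) ->
  d2 F a b = d2 G a b.
Proof.
intros HD E Hab; apply Derive_ext_loc.
generalize (open_section2 D a b HD Hab); apply filter_imp; intros z; apply E.
Qed.

Lemma d1_zero (D : R * R -> Prop) (F : R -> R -> R) :
  open D -> (forall a b, D (a, b) -> F a b = 0) ->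
  forall a b, D (a, b) -> d1 F a b = 0.
Proof.
intros HD Z a b Hab; rewrite (d1_congr D F (fun _ _ => 0) a b HD Z Hab).
exact (Derive_const 0 a).
Qed.

Lemma d2_zero (D : R * R -> Prop) (F : R -> R -> R) :
  open D -> (forall a b, D (a, b) -> F a b = 0) ->
  forall a b, D (a, b) -> d2 F a b = 0.
Proof.
intros HD Z a b Hab; rewrite (d2_congr D F (fun _ _ => 0) a b HD Z Hab).
exact (Derive_const 0 b).
Qed.

(** Schwarz's theorem brings every mixed derivative to a normal form in which [d2 psi] is innermost
    and [d1] is applied before any further [d2]; the jets then are polynomials in p, q, w with these
    coefficients. *)
Lemma jet_expansion (U : R * R -> Prop) (psi : R -> R -> R) (y u p q w : R) :
  open U -> smooth_on U psi -> U (y, u) ->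
  let P := d2 psi in
  jet1 psi y u p = d1 psi y u + P y u * p /\
  jet2 psi y u p q = d1 (d1 psi) y u + 2 * d1 P y u * p + d2 P y u * p ^ 2
                     + P y u * q /\
  jet3 psi y u p q w = d1 (d1 (d1 psi)) y u + 3 * d1 (d1 P) y u * p
    + 3 * d2 (d1 P) y u * p ^ 2 + d2 (d2 P) y u * p ^ 3
    + 3 * (d1 P y u + d2 P y u * p) * q + P y u * w.
Proof.
intros HU Hpsi Hyu P.
assert (HP : smooth_on U P) by (apply smooth_d2, Hpsi).
assert (S1 : forall a b, U (a, b) -> d2 (d1 psi) a b = d1 P a b)
  by (intros; now apply smooth_schwarz with U).
assert (S2 : d2 (d1 (d1 psi)) y u = d1 (d1 P) y u).
{ rewrite (smooth_schwarz U); trivial; [now apply (d1_congr U) | smooth]. }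
assert (S3 : d1 (d2 (d1 psi)) y u = d1 (d1 P) y u) by now apply (d1_congr U).
assert (S4 : d2 (d2 (d1 psi)) y u = d2 (d1 P) y u) by now apply (d2_congr U).
assert (S5 : d1 (d2 P) y u = d2 (d1 P) y u)
  by (symmetry; now apply smooth_schwarz with U).
unfold jet3, jet2, jet1; fold P.
rewrite S2, S3, S4, S5, (S1 y u Hyu).
repeat split; ring.
Qed.

(* The equation s''' + alpha s = 0 pulled back along t = phi(y), s = psi(y,u),
   written with chi = phi''/phi' and c = alpha phi'^3. *)
Definition pullback_system (a0 a1 b0 b1 b2 b3 psi chi c : R -> R -> R)
    (y u : R) : Prop :=
  let P := d2 psi in let q := 2 * chi y u ^ 2 - d1 chi y u in
  a1 y u * P y u = 3 * d2 P y u /\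
  a0 y u * P y u = 3 * (d1 P y u - chi y u * P y u) /\
  b3 y u * P y u = d2 (d2 P) y u /\
  b2 y u * P y u = 3 * (d2 (d1 P) y u - chi y u * d2 P y u) /\
  b1 y u * P y u = 3 * d1 (d1 P) y u - 6 * chi y u * d1 P y u + q * P y u /\
  b0 y u * P y u = d1 (d1 (d1 psi)) y u - 3 * chi y u * d1 (d1 psi) y u
                   + q * d1 psi y u + c y u * psi y u.

Definition cubic_rhs (a0 a1 b0 b1 b2 b3 : R -> R -> R) (y u p q : R) : R :=
  - ((a1 y u * p + a0 y u) * q + b3 y u * p ^ 3 + b2 y u * p ^ 2
     + b1 y u * p + b0 y u).

(** * Changes of variables with t depending on y alone *)

Section Fiber_preserving.

Variables (U : R * R -> Prop) (phi psi : R -> R -> R).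
Hypothesis U_open : open U.
Hypothesis phi_smooth : smooth_on U phi.
Hypothesis psi_smooth : smooth_on U psi.
Hypothesis phi_2 : forall y u, U (y, u) -> d2 phi y u = 0.
Hypothesis phi_1 : forall y u, U (y, u) -> d1 phi y u <> 0.

Definition chi_of (y u : R) : R := d1 (d1 phi) y u / d1 phi y u.

Lemma d2_d1_zero (F : R -> R -> R) : smooth_on U F ->
  (forall y u, U (y, u) -> d2 F y u = 0) ->
  forall y u, U (y, u) -> d2 (d1 F) y u = 0.
Proof.
intros HF Z y u Hyu; rewrite (smooth_schwarz U F y u U_open HF Hyu).
now apply (d1_zero U).
Qed.

Lemma chi_smooth : smooth_on U chi_of.
Proof. unfold chi_of; smooth. Qed.

Lemma chi_d2 (y u : R) : U (y, u) -> d2 chi_of y u = 0.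
Proof.
intros Hyu; assert (Z1 := d2_d1_zero phi phi_smooth phi_2).
assert (Z2 := d2_d1_zero (d1 phi) ltac:(smooth) Z1).
(* Differentiating the product [chi * phi'] instead of the quotient keeps the derivatives of [chi]
   as unknowns of a linear equation. *)
assert (E : forall a b, U (a, b) -> chi_of a b * d1 phi a b = d1 (d1 phi) a b).
{ intros a b H; unfold chi_of; field; now apply phi_1. }
assert (HC := chi_smooth).
differentiate U_open E E1 E2; specialize (E2 y u Hyu).
rewrite (Z1 y u Hyu), (Z2 y u Hyu) in E2.
apply Rmult_eq_reg_r with (d1 phi y u); [| now apply phi_1]; lra.
Qed.

(** Here phi'' = chi phi' and phi''' = (chi' + chi^2) phi'. The factor of the first jet of [psi] is
    therefore 3 chi^2 - (chi' + chi^2) = 2 chi^2 - chi', after taking out phi'^2. *)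
Lemma transformed_third_fiber (y u p q w : R) : U (y, u) ->
  jet1 phi y u p = d1 phi y u /\
  transformed_third phi psi y u p q w = d1 phi y u ^ 2 *
    (jet3 psi y u p q w - 3 * chi_of y u * jet2 psi y u p q
     + (2 * chi_of y u ^ 2 - d1 chi_of y u) * jet1 psi y u p).
Proof.
intros Hyu; assert (Z1 := d2_d1_zero phi phi_smooth phi_2).
assert (Z2 := d2_d1_zero (d1 phi) ltac:(smooth) Z1).
destruct (jet_expansion U phi y u p q w U_open phi_smooth Hyu) as (J1 & J2 & J3).
assert (N := phi_1 y u Hyu).
assert (E : forall a b, U (a, b) -> chi_of a b * d1 phi a b = d1 (d1 phi) a b).
{ intros a b H; unfold chi_of; field; now apply phi_1. }
assert (HC := chi_smooth).
differentiate U_open E E1 E2; specialize (E1 y u Hyu).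
assert (W0 := phi_2 y u Hyu).
assert (V1 := d1_zero U (d2 phi) U_open phi_2).
assert (V2 := d2_zero U (d2 phi) U_open phi_2).
assert (W1 := V1 y u Hyu); assert (W2 := V2 y u Hyu).
assert (W3 := d1_zero U (d1 (d2 phi)) U_open V1 y u Hyu).
assert (W4 := d2_zero U (d1 (d2 phi)) U_open V1 y u Hyu).
assert (W5 := d2_zero U (d2 (d2 phi)) U_open V2 y u Hyu).
rewrite W0 in J1; rewrite W0, W1, W2 in J2; rewrite W0, W1, W2, W3, W4, W5 in J3.
split; [rewrite J1; ring |].
unfold transformed_third.
replace (jet1 phi y u p) with (d1 phi y u) by (rewrite J1; ring).
replace (jet2 phi y u p q) with (chi_of y u * d1 phi y u)
  by (rewrite J2, (E y u Hyu); ring).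
replace (jet3 phi y u p q w)
  with (d1 chi_of y u * d1 phi y u + chi_of y u * (chi_of y u * d1 phi y u))
  by (rewrite J3, (E y u Hyu), E1; ring).
ring.
Qed.

End Fiber_preserving.

(* The criterion of Ibragimov and Meleshko for
   u''' + (a1 u' + a0) u'' + b3 u'^3 + b2 u'^2 + b1 u' + b0 = 0. *)
Definition linearization_conditions (a0 a1 b0 b1 b2 b3 : R -> R -> R)
    (y u : R) : Prop :=
  d2 a0 y u = d1 a1 y u /\
  3 * d2 b1 y u - 2 * a0 y u * d2 a0 y u - 3 * d2 (d1 a0) y u = 0 /\
  3 * d1 a1 y u + a0 y u * a1 y u - 3 * b2 y u = 0 /\
  3 * d2 a1 y u + a1 y u ^ 2 - 9 * b3 y u = 0 /\
  (9 * b1 y u - 6 * d1 a0 y u - 2 * a0 y u ^ 2) * d1 a1 y u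
    + 9 * (d2 (d1 b1) y u - d2 a1 y u * b0 y u - a1 y u * d2 b0 y u)
    + 3 * a0 y u * d2 b1 y u - 27 * d2 (d2 b0) y u = 0.

(** A product rule that assumes of [c] only that it is constant in the second variable; it covers a
    [c] built from an arbitrary [alpha]. *)
Lemma d2_const_mult (D : R * R -> Prop) (G c F : R -> R -> R) (y u : R) :
  open D -> smooth_on D F -> D (y, u) ->
  locally u (fun z => c y z = c y u) ->
  (forall a b, D (a, b) -> G a b = c a b * F a b) ->
  d2 G y u = c y u * d2 F y u.
Proof.
intros HD HF Hyu Hc E; apply is_derive_unique.
apply (is_derive_ext_loc (fun z => c y u * F y z)).
- generalize (filter_and _ _ Hc (open_section2 D y u HD Hyu)); apply filter_imp.
  intros z [<- Hz]; symmetry; now apply E.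
- apply is_derive_Reals, (derivable_pt_lim_scal (F y)), is_derive_Reals.
  exact (proj2 (smooth_partials D F HF y u Hyu)).
Qed.

Lemma solve_product (x p e : R) : p <> 0 -> x * p = e -> x = e / p.
Proof. intros Np <-; now field. Qed.

Lemma solve_affine (x p r e : R) : p <> 0 -> x * p + r = e -> x = (e - r) / p.
Proof. intros Np <-; now field. Qed.

(** Elimination: all coefficients and derivatives that occur are solved for as rational expressions
    in the derivatives of P and chi, and the conditions become rational identities. Only b0 involves
    psi and c. One derivative in u turns psi into P, and c cancels in the last condition. *)
Lemma pullback_conditions (U : R * R -> Prop)
    (a0 a1 b0 b1 b2 b3 psi chi c : R -> R -> R) :
  open U -> smooth_on U a0 -> smooth_on U a1 -> smooth_on U b0 ->
  smooth_on U b1 -> smooth_on U psi -> smooth_on U chi ->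
  (forall y u, U (y, u) -> d2 chi y u = 0) ->
  (forall y u, U (y, u) -> d2 psi y u <> 0) ->
  (forall y u, U (y, u) -> locally u (fun z => c y z = c y u)) ->
  (forall y u, U (y, u) -> pullback_system a0 a1 b0 b1 b2 b3 psi chi c y u) ->
  forall y u, U (y, u) -> linearization_conditions a0 a1 b0 b1 b2 b3 y u.
Proof.
intros HU Ha0 Ha1 Hb0 Hb1 Hpsi Hchi X0 NP Hc HS y u Hyu.
set (P := d2 psi) in *.
assert (HP : smooth_on U P) by (unfold P; smooth).
assert (X1 : forall a b, U (a, b) -> d2 (d1 chi) a b = 0)
  by now apply d2_d1_zero.
assert (X2 : d2 (d1 (d1 chi)) y u = 0)
  by (apply (d2_d1_zero U HU (d1 chi)); trivial; smooth).
assert (Q1 : forall a b, U (a, b) -> d1 (d2 P) a b = d2 (d1 P) a b)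
  by (intros; symmetry; now apply smooth_schwarz with U).
assert (Q2 : forall a b, U (a, b) -> d1 (d2 (d1 P)) a b = d2 (d1 (d1 P)) a b)
  by (intros; symmetry; apply smooth_schwarz with U; trivial; smooth).
assert (R1 : forall a b, U (a, b) -> d2 (d1 psi) a b = d1 P a b)
  by (intros; now apply smooth_schwarz with U).
assert (R2 : forall a b, U (a, b) -> d2 (d1 (d1 psi)) a b = d1 (d1 P) a b).
{ intros a b H; rewrite (smooth_schwarz U); trivial; [| smooth].
  now apply (d1_congr U). }
assert (R3 : forall a b, U (a, b) -> d2 (d1 (d1 (d1 psi))) a b = d1 (d1 (d1 P)) a b).
{ intros a b H; rewrite (smooth_schwarz U); trivial; [| smooth].
  now apply (d1_congr U). }
assert (E1 : forall a b, U (a, b) -> a1 a b * P a b = 3 * d2 P a b)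
  by (intros a b H; apply (HS a b H)).
assert (E0 : forall a b, U (a, b) ->
          a0 a b * P a b = 3 * (d1 P a b - chi a b * P a b))
  by (intros a b H; apply (HS a b H)).
assert (E3 := proj1 (proj2 (proj2 (HS y u Hyu)))).
assert (E2 := proj1 (proj2 (proj2 (proj2 (HS y u Hyu))))).
assert (F1 : forall a b, U (a, b) -> b1 a b * P a b = 3 * d1 (d1 P) a b
          - 6 * (chi a b * d1 P a b)
          + (2 * (chi a b * chi a b) - d1 chi a b) * P a b).
{ intros a b H; destruct (HS a b H) as (_ & _ & _ & _ & K & _); cbv zeta in K;
  fold P in K; rewrite K; ring. }
assert (F0 : forall a b, U (a, b) ->
          b0 a b * P a b - (d1 (d1 (d1 psi)) a b - 3 * (chi a b * d1 (d1 psi) a b)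
          + (2 * (chi a b * chi a b) - d1 chi a b) * d1 psi a b)
          = c a b * psi a b).
{ intros a b H; destruct (HS a b H) as (_ & _ & _ & _ & _ & K);
  cbv zeta in K; fold P in K.
  rewrite K; ring. }
cbv zeta in E2, E3; fold P in E2, E3; clear HS.
differentiate HU E1 E1y E1u.
differentiate HU E0 E0y E0u.
differentiate HU E0y E0yy E0yu.
differentiate HU F1 F1y F1u.
differentiate HU F1y F1yy F1yu.
(* The equation for [b0] is differentiated twice in u; with [c] constant in u the right side passes
   from c psi to c P and then to c P_u. *)
assert (F0u : forall a b, U (a, b) ->
          d2 b0 a b * P a b + b0 a b * d2 P a b - (d1 (d1 (d1 P)) a b
          - 3 * (chi a b * d1 (d1 P) a b)
          + (2 * (chi a b * chi a b) - d1 chi a b) * d1 P a b)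
          = c a b * P a b).
{ intros a b H.
  assert (K := d2_const_mult U _ c psi a b HU Hpsi H (Hc a b H) F0).
  eassert (PK : partials U (fun a b =>
    b0 a b * P a b - (d1 (d1 (d1 psi)) a b - 3 * (chi a b * d1 (d1 psi) a b)
          + (2 * (chi a b * chi a b) - d1 chi a b) * d1 psi a b)) _ _) by partials.
  rewrite (proj2 (partials_eq U _ _ _ a b PK H)) in K; fold P in K.
  rewrite <- K, (R1 a b H), (R2 a b H), (R3 a b H), (X0 a b H), (X1 a b H); ring. }
assert (F0uu : d2 (d2 b0) y u * P y u + 2 * d2 b0 y u * d2 P y u
          + b0 y u * d2 (d2 P) y u - (d2 (d1 (d1 (d1 P))) y u
          - 3 * chi y u * d2 (d1 (d1 P)) y u
          + (2 * chi y u ^ 2 - d1 chi y u) * d2 (d1 P) y u)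
          = c y u * d2 P y u).
{ assert (K := d2_const_mult U _ c P y u HU HP Hyu (Hc y u Hyu) F0u).
  eassert (PK : partials U (fun a b =>
      d2 b0 a b * P a b + b0 a b * d2 P a b - (d1 (d1 (d1 P)) a b
          - 3 * (chi a b * d1 (d1 P) a b)
          + (2 * (chi a b * chi a b) - d1 chi a b) * d1 P a b)) _ _) by partials.
  rewrite (proj2 (partials_eq U _ _ _ y u PK Hyu)) in K.
  rewrite <- K, (X0 y u Hyu), (X1 y u Hyu); ring. }
specialize (E1 y u Hyu); specialize (E1y y u Hyu); specialize (E1u y u Hyu).
specialize (E0 y u Hyu); specialize (E0y y u Hyu); specialize (E0u y u Hyu).
specialize (E0yu y u Hyu).
specialize (F1 y u Hyu); specialize (F1y y u Hyu); specialize (F1u y u Hyu).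
specialize (F1yu y u Hyu); specialize (F0u y u Hyu).
specialize (NP y u Hyu); specialize (X0 y u Hyu); specialize (X1 y u Hyu).
specialize (Q1 y u Hyu); specialize (Q2 y u Hyu).
unfold linearization_conditions.
(* From here on the problem is algebraic: the values of all derivatives at the point become
   independent real variables. *)
clear - NP E1 E1y E1u E0 E0y E0u E0yu F1 F1y F1u F1yu F0u F0uu E2 E3 X0 X1 X2 Q1 Q2.
set (x := chi y u) in *; set (x' := d1 chi y u) in *.
set (x'' := d1 (d1 chi) y u) in *.
set (z0 := d2 chi y u) in *; set (z1 := d2 (d1 chi) y u) in *.
set (z2 := d2 (d1 (d1 chi)) y u) in *.
set (p := P y u) in *; set (py := d1 P y u) in *; set (pu := d2 P y u) in *.
set (pyy := d1 (d1 P) y u) in *; set (pyu := d2 (d1 P) y u) in *.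
set (puy := d1 (d2 P) y u) in *; set (puu := d2 (d2 P) y u) in *.
set (pyyy := d1 (d1 (d1 P)) y u) in *; set (pyyu := d2 (d1 (d1 P)) y u) in *.
set (pyuy := d1 (d2 (d1 P)) y u) in *; set (pyyyu := d2 (d1 (d1 (d1 P))) y u) in *.
set (va1 := a1 y u) in *; set (va1y := d1 a1 y u) in *; set (va1u := d2 a1 y u) in *.
set (va0 := a0 y u) in *; set (va0y := d1 a0 y u) in *; set (va0u := d2 a0 y u) in *.
set (va0yu := d2 (d1 a0) y u) in *.
set (vb1 := b1 y u) in *; set (vb1y := d1 b1 y u) in *; set (vb1u := d2 b1 y u) in *.
set (vb1yu := d2 (d1 b1) y u) in *.
set (vb0 := b0 y u) in *; set (vb0u := d2 b0 y u) in *; set (vb0uu := d2 (d2 b0) y u) in *.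
set (vb2 := b2 y u) in *; set (vb3 := b3 y u) in *; set (vc := c y u) in *.
clearbody x x' x'' z0 z1 z2 p py pu pyy pyu puy puu pyyy pyyu pyuy pyyyu va1 va1y va1u
  va0 va0y va0u va0yu vb1 vb1y vb1u vb1yu vb0 vb0u vb0uu vb2 vb3 vc.
subst z0 z1 z2 puy; try subst pyuy.
apply solve_product in E1, E0, F1, E2, E3; trivial; subst va1 va0 vb1 vb2 vb3.
assert (Y1 : va1u = (3 * puu - 3 * pu / p * pu) / p)
  by (apply solve_product; trivial; lra).
assert (Y2 : va1y = (3 * pyu - 3 * pu / p * py) / p)
  by (apply solve_product; trivial; lra).
assert (Y3 : va0u = (3 * (pyu - x * pu) - 3 * (py - x * p) / p * pu) / p)
  by (apply solve_product; trivial; lra).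
assert (Y4 : va0y = (3 * (pyy - (x' * p + x * py)) - 3 * (py - x * p) / p * py) / p)
  by (apply solve_product; trivial; lra).
clear E1y E1u E0u E0y; subst va1u va1y va0u va0y.
rewrite Rplus_assoc in E0yu, F1yu.
apply solve_affine in E0yu, F1y, F1u; trivial; subst va0yu vb1y vb1u.
apply solve_affine in F1yu; trivial; subst vb1yu.
assert (vb0u * p + (vb0 * pu - (pyyy - 3 * (x * pyy) + (2 * (x * x) - x') * py))
        = vc * p) as K by lra.
apply solve_affine in K; trivial; clear F0u; subst vb0u.
rewrite Rplus_assoc in F0uu; unfold Rminus at 1 in F0uu; rewrite Rplus_assoc in F0uu.
apply solve_affine in F0uu; trivial; subst vb0uu.
repeat split; field; exact NP.
Qed.

(** * Necessity *)

Lemma partials_id1 (D : R * R -> Prop) :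
  partials D (fun a _ => a) (fun _ _ => 1) (fun _ _ => 0).
Proof.
intros a b _; split; [apply (is_derive_id a) | apply (is_derive_const a)].
Qed.

Lemma partials_id2 (D : R * R -> Prop) :
  partials D (fun _ b => b) (fun _ _ => 0) (fun _ _ => 1).
Proof.
intros a b _; split; [apply (is_derive_const b) | apply (is_derive_id b)].
Qed.

Lemma partials_comp (D V : R * R -> Prop) (F g h : R -> R -> R) :
  open V -> smooth_on V F -> smooth_on D g -> smooth_on D h ->
  (forall a b, D (a, b) -> V (g a b, h a b)) ->
  partials D (fun a b => F (g a b) (h a b))
    (fun a b => d1 F (g a b) (h a b) * d1 g a b + d2 F (g a b) (h a b) * d1 h a b)
    (fun a b => d1 F (g a b) (h a b) * d2 g a b + d2 F (g a b) (h a b) * d2 h a b).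
Proof.
intros HV HF Hg Hh M a b Hab.
destruct (smooth_partials D g Hg a b Hab) as [G1 G2].
destruct (smooth_partials D h Hh a b Hab) as [H1 H2]; split.
- apply (is_derive_curve V F (fun z => g z b) (fun z => h z b)); auto.
- apply (is_derive_curve V F (fun z => g a z) (fun z => h a z)); auto.
Qed.

(** Differentiating the two inverse relations shows that the product of the Jacobian matrices is the
    identity, so the product of their determinants is 1. *)
Lemma jacobian_nonzero (U V : R * R -> Prop) (phi psi eta theta : R -> R -> R)
    (y u : R) :
  change_of_variables U V phi psi eta theta -> U (y, u) ->
  d1 phi y u * d2 psi y u - d2 phi y u * d1 psi y u <> 0.
Proof.
intros (HU & HV & S1 & S2 & S3 & S4 & HUV & _) Hyu N.
assert (M : forall a b, U (a, b) -> V (phi a b, psi a b)) by (intros; now apply HUV).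
destruct (partials_congr U _ _ _ _ _ _ y u HU
  (fun a b H => proj1 (proj2 (HUV a b H)))
  (partials_comp U V eta phi psi HV S3 S1 S2 M) (partials_id1 U) Hyu) as [E1 E2].
destruct (partials_congr U _ _ _ _ _ _ y u HU
  (fun a b H => proj2 (proj2 (HUV a b H)))
  (partials_comp U V theta phi psi HV S4 S1 S2 M) (partials_id2 U) Hyu) as [E3 E4].
set (e1 := d1 eta (phi y u) (psi y u)) in *.
set (e2 := d2 eta (phi y u) (psi y u)) in *.
set (h1 := d1 theta (phi y u) (psi y u)) in *.
set (h2 := d2 theta (phi y u) (psi y u)) in *.
assert (K : (e1 * h2 - e2 * h1)
  * (d1 phi y u * d2 psi y u - d2 phi y u * d1 psi y u)
  = (e1 * d1 phi y u + e2 * d1 psi y u) * (h1 * d2 phi y u + h2 * d2 psi y u)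
    - (e1 * d2 phi y u + e2 * d2 psi y u) * (h1 * d1 phi y u + h2 * d1 psi y u))
  by ring.
rewrite E1, E2, E3, E4, N in K; lra.
Qed.

Section Necessity.

Variables (U : R * R -> Prop) (a0 a1 b0 b1 b2 b3 phi psi : R -> R -> R)
  (alpha : R -> R).
Hypothesis U_open : open U.
Hypothesis phi_smooth : smooth_on U phi.
Hypothesis psi_smooth : smooth_on U psi.
Hypothesis jacobian : forall y u, U (y, u) ->
  d1 phi y u * d2 psi y u - d2 phi y u * d1 psi y u <> 0.
Hypothesis linear : transforms_to_linear U phi psi
  (cubic_rhs a0 a1 b0 b1 b2 b3) alpha.

Lemma transformed_third_zero (y u p q : R) : U (y, u) -> jet1 phi y u p <> 0 ->
  transformed_third phi psi y u p q (cubic_rhs a0 a1 b0 b1 b2 b3 y u p q)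
  + alpha (phi y u) * psi y u * jet1 phi y u p ^ 5 = 0.
Proof.
intros Hyu Np.
now apply (jet_equivalence U phi psi _ alpha y u p q _ U_open phi_smooth
  psi_smooth linear Hyu Np).
Qed.

(* The coefficient of u''^2 in the transformed equation is -3 phi_u times the
   Jacobian determinant. *)
Lemma fiber_preserving (y u : R) : U (y, u) -> d2 phi y u = 0.
Proof.
intros Hyu; assert (J := jacobian y u Hyu).
destruct (Req_dec (d2 phi y u) 0) as [Z | NZ]; [exact Z | exfalso].
assert (exists p, jet1 phi y u p <> 0) as [p Np].
{ unfold jet1; destruct (Req_dec (d1 phi y u) 0) as [Z' | NZ'].
  - exists 1; lra.
  - exists 0; lra. }
(* The second difference in q, over the values 1, 0, -1, isolates twice the coefficient of q^2; the
   term in w does not contribute, as the right side of the equation is affine in q. *)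
assert (E1 := transformed_third_zero y u p 1 Hyu Np).
assert (E2 := transformed_third_zero y u p (-1) Hyu Np).
assert (E3 := transformed_third_zero y u p 0 Hyu Np).
set (C := alpha (phi y u) * psi y u * jet1 phi y u p ^ 5) in *; clearbody C.
assert (K : -6 * d2 phi y u * (d1 phi y u * d2 psi y u - d2 phi y u * d1 psi y u) = 0).
{ transitivity (0 + 0 - 2 * 0); [rewrite <- E1 at 1; rewrite <- E2 at 1;
    rewrite <- E3; unfold transformed_third, cubic_rhs, jet3, jet2, jet1; ring | ring]. }
apply Rmult_integral in K; destruct K as [K | K]; [lra | contradiction].
Qed.

Lemma phi_1_nonzero (y u : R) : U (y, u) -> d1 phi y u <> 0.
Proof.
intros Hyu Z; apply (jacobian y u Hyu).
rewrite Z, (fiber_preserving y u Hyu); ring.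
Qed.

Lemma psi_2_nonzero (y u : R) : U (y, u) -> d2 psi y u <> 0.
Proof.
intros Hyu Z; apply (jacobian y u Hyu).
rewrite Z, (fiber_preserving y u Hyu); ring.
Qed.

Lemma pullback_system_holds (y u : R) : U (y, u) ->
  pullback_system a0 a1 b0 b1 b2 b3 psi (chi_of phi)
    (fun y u => alpha (phi y u) * d1 phi y u ^ 3) y u.
Proof.
intros Hyu; assert (N := phi_1_nonzero y u Hyu).
assert (E : forall p q,
  jet3 psi y u p q (cubic_rhs a0 a1 b0 b1 b2 b3 y u p q)
  - 3 * chi_of phi y u * jet2 psi y u p q
  + (2 * chi_of phi y u ^ 2 - d1 (chi_of phi) y u) * jet1 psi y u p
  + alpha (phi y u) * d1 phi y u ^ 3 * psi y u = 0).
{ intros p q.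
  destruct (transformed_third_fiber U phi psi U_open phi_smooth fiber_preserving
    phi_1_nonzero y u p q (cubic_rhs a0 a1 b0 b1 b2 b3 y u p q) Hyu) as [J T].
  assert (K := transformed_third_zero y u p q Hyu).
  rewrite J, T in K; specialize (K N).
  apply Rmult_eq_reg_l with (d1 phi y u ^ 2); [| now apply pow_nonzero].
  rewrite Rmult_0_r, <- K; ring. }
assert (X : forall p q, jet1 psi y u p = d1 psi y u + d2 psi y u * p /\
  jet2 psi y u p q = d1 (d1 psi) y u + 2 * d1 (d2 psi) y u * p
    + d2 (d2 psi) y u * p ^ 2 + d2 psi y u * q /\
  jet3 psi y u p q (cubic_rhs a0 a1 b0 b1 b2 b3 y u p q)
  = d1 (d1 (d1 psi)) y u + 3 * d1 (d1 (d2 psi)) y u * p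
    + 3 * d2 (d1 (d2 psi)) y u * p ^ 2 + d2 (d2 (d2 psi)) y u * p ^ 3
    + 3 * (d1 (d2 psi) y u + d2 (d2 psi) y u * p) * q
    + d2 psi y u * cubic_rhs a0 a1 b0 b1 b2 b3 y u p q).
{ intros p q; now apply jet_expansion with U. }
(* A polynomial in the monomials 1, p, p^2, p^3, q, pq is determined by its values at these six
   points: the four with q = 0 fix the cubic in p, the other two the coefficients of q and pq. *)
assert (K00 := E 0 0); assert (K01 := E 0 1); assert (K11 := E 1 1).
assert (K10 := E 1 0); assert (Km0 := E (-1) 0); assert (K20 := E 2 0).
rewrite (proj1 (X 0 0)), (proj1 (proj2 (X 0 0))), (proj2 (proj2 (X 0 0))) in K00.
rewrite (proj1 (X 0 1)), (proj1 (proj2 (X 0 1))), (proj2 (proj2 (X 0 1))) in K01.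
rewrite (proj1 (X 1 1)), (proj1 (proj2 (X 1 1))), (proj2 (proj2 (X 1 1))) in K11.
rewrite (proj1 (X 1 0)), (proj1 (proj2 (X 1 0))), (proj2 (proj2 (X 1 0))) in K10.
rewrite (proj1 (X (-1) 0)), (proj1 (proj2 (X (-1) 0))), (proj2 (proj2 (X (-1) 0)))
  in Km0.
rewrite (proj1 (X 2 0)), (proj1 (proj2 (X 2 0))), (proj2 (proj2 (X 2 0))) in K20.
unfold cubic_rhs in K00, K01, K11, K10, Km0, K20; clear E X.
unfold pullback_system; cbv zeta.
set (k := alpha (phi y u) * d1 phi y u ^ 3) in *.
set (x := chi_of phi y u) in *; set (x' := d1 (chi_of phi) y u) in *.
clearbody k x x'.
repeat split; lra.
Qed.

Lemma necessity :
  smooth_on U a0 -> smooth_on U a1 -> smooth_on U b0 -> smooth_on U b1 ->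
  forall y u, U (y, u) -> linearization_conditions a0 a1 b0 b1 b2 b3 y u.
Proof.
intros Ha0 Ha1 Hb0 Hb1.
assert (F := fiber_preserving).
apply pullback_conditions with psi (chi_of phi)
  (fun y u => alpha (phi y u) * d1 phi y u ^ 3); trivial.
- apply chi_smooth; trivial; exact phi_1_nonzero.
- apply chi_d2; trivial; exact phi_1_nonzero.
- exact psi_2_nonzero.
(* Both [phi] and [d1 phi] are constant along the vertical segment through (y, u), so [alpha] is
   evaluated at one and the same point there. *)
- intros y u Hyu; destruct (box_in_open U y u U_open Hyu) as (r & Hr & HB).
  exists (mkposreal r Hr); intros z Hz; change (Rabs (z - u) < r) in Hz.
  assert (cst : forall G, smooth_on U G -> (forall y u, U (y, u) -> d2 G y u = 0) ->
            G y z = G y u).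
  { intros G HG Z; apply (derive_zero_constant (G y) u r); [| exact Hz].
    intros v Hv; assert (Hyv : U (y, v)).
    { apply HB; split; [simpl; rewrite Rabs_minus_self; exact Hr | exact Hv]. }
    rewrite <- (Z y v Hyv); exact (proj2 (smooth_partials U G HG y v Hyv)). }
  rewrite (cst phi), (cst (d1 phi)); trivial; [smooth |].
  now apply d2_d1_zero.
- exact pullback_system_holds.
Qed.

End Necessity.

(** * Sufficiency *)

Lemma box_shrink (y0 u0 r rho : R) : rho <= r ->
  forall a b, box y0 u0 rho (a, b) -> box y0 u0 r (a, b).
Proof. intros H a b [H1 H2]; split; simpl in *; lra. Qed.

(** Functions of y alone are viewed as functions of (y, u), so that one notion of smoothness serves
    throughout. *)
Definition lift (h : R -> R) (y u : R) : R := h y.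

Lemma lift_partials (D : R * R -> Prop) (h h' : R -> R) :
  (forall y u, D (y, u) -> is_derive h y (h' y)) ->
  partials D (lift h) (lift h') (fun _ _ => 0).
Proof.
intros H y u Hyu; split; [exact (H y u Hyu) | apply (is_derive_const (h y))].
Qed.

(** Bootstrapping for differential equations: if the derivative of each member is an expression in
    smooth functions and members of the family, all members are smooth. *)
Lemma lift_family_smooth (D : R * R -> Prop) (L : (R -> R) -> Prop) :
  open D ->
  (forall h, L h -> exists G,
     generated D (fun F => smooth_on D F \/ exists k, L k /\ F = lift k) G /\
     forall y u, D (y, u) -> is_derive h y (G y u)) ->
  forall h, L h -> smooth_on D (lift h).
Proof.
intros HD HL h Hh.
apply generated_smooth with (B := fun F => smooth_on D F \/ exists k, L k /\ F = lift k);
  [exact HD | | | apply gen_base; right; now exists h].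
- intros F a b [HF | (k & Hk & ->)] Hab; [now apply smooth_cont with D |].
  destruct (HL k Hk) as (G & _ & HG).
  apply (continuity_1d_2d_pt_comp k (fun a _ => a)); [| apply continuity_2d_pt_id1].
  apply continuity_pt_filterlim, (is_derive_cont k a (G a b)), HG, Hab.
- intros F [HF | (k & Hk & ->)].
  + exists (d1 F), (d2 F).
    split; [apply gen_base; left; apply smooth_d1, HF |].
    split; [apply gen_base; left; apply smooth_d2, HF |].
    apply smooth_partials, HF.
  + destruct (HL k Hk) as (G & SG & HG).
    exists G, (fun _ _ => 0); split; [exact SG | split; [apply gen_const |]].
    intros y u Hyu; split; [exact (HG y u Hyu) | apply (is_derive_const (k y))].
Qed.

Lemma lift_continuous (y0 u0 r : R) (h : R -> R) (y : R) :
  smooth_on (box y0 u0 r) (lift h) -> Rabs (y - y0) < r -> continuous h y.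
Proof.
intros Hh Hy; apply (continuity_2d_section1 (lift h) y u0).
apply smooth_cont with (box y0 u0 r); [exact Hh |].
split; [exact Hy | simpl; rewrite Rabs_minus_self; generalize (Rabs_pos (y - y0)); lra].
Qed.

(** Solves h''' = b + k1 h'' + k2 h' + k3 h with zero initial data, where h3, h2, h1, z are h, h',
    h'', h'''. The Volterra equation yields a continuous z; smoothness of its primitives follows
    since the equation expresses z through them. *)
Lemma linear_ode (y0 u0 r : R) (b k1 k2 k3 : R -> R) : 0 < r ->
  smooth_on (box y0 u0 r) (lift b) -> smooth_on (box y0 u0 r) (lift k1) ->
  smooth_on (box y0 u0 r) (lift k2) -> smooth_on (box y0 u0 r) (lift k3) ->
  exists rho z h1 h2 h3, 0 < rho <= r /\
    h1 y0 = 0 /\ h2 y0 = 0 /\ h3 y0 = 0 /\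
    smooth_on (box y0 u0 rho) (lift h1) /\ smooth_on (box y0 u0 rho) (lift h2) /\
    smooth_on (box y0 u0 rho) (lift h3) /\
    forall y, Rabs (y - y0) < rho ->
      is_derive h3 y (h2 y) /\ is_derive h2 y (h1 y) /\ is_derive h1 y (z y) /\
      z y = b y + k1 y * h1 y + k2 y * h2 y + k3 y * h3 y.
Proof.
intros Hr Hb H1 H2 H3.
destruct (volterra y0 b k1 k2 k3 r Hr) as (rho & z & Hrho & zc & Ez).
{ intros x Hx; repeat split; now apply lift_continuous with y0 u0 r. }
set (p1 := primitive y0 z) in *; set (p2 := primitive y0 p1) in *;
  set (p3 := primitive y0 p2) in *.
assert (c1 : forall x, continuous p1 x) by (intros; now apply primitive_continuous).
assert (c2 : forall x, continuous p2 x) by (intros; now apply primitive_continuous).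
set (D := box y0 u0 rho).
assert (HD : open D) by apply box_open.
assert (sub : forall F, smooth_on (box y0 u0 r) F -> smooth_on D F).
{ intros F; apply smooth_subset, box_shrink; lra. }
assert (S : forall h, h = p1 \/ h = p2 \/ h = p3 -> smooth_on D (lift h)).
{ apply lift_family_smooth; [exact HD |].
  assert (B : forall h, h = p1 \/ h = p2 \/ h = p3 ->
    generated D (fun F => smooth_on D F \/
      exists k, (k = p1 \/ k = p2 \/ k = p3) /\ F = lift k) (lift h))
    by (intros h Hh; apply gen_base; right; now exists h).
  intros h [-> | [-> | ->]].
  - exists (fun y u => lift b y u + lift k1 y u * lift p1 y u
      + lift k2 y u * lift p2 y u + lift k3 y u * lift p3 y u); split.
    + repeat apply gen_plus; try apply gen_mult; try (apply B; tauto);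
        apply gen_base; left; now apply sub.
    + intros y u [Hy _]; unfold lift.
      rewrite <- (Ez y Hy); now apply primitive_derive.
  - exists (lift p1); split; [apply B; tauto |].
    intros y u _; exact (primitive_derive y0 p1 y c1).
  - exists (lift p2); split; [apply B; tauto |].
    intros y u _; exact (primitive_derive y0 p2 y c2). }
exists rho, z, p1, p2, p3; split; [exact Hrho |].
repeat split; try apply primitive_at; try (apply S; tauto);
  try (now apply primitive_derive).
now apply Ez.
Qed.

(* chi solves the Riccati equation 6 chi' - 3 chi^2 = g, through chi = -2 w'/w
   with w'' = -(g/12) w, and phi' = 1/w^2 has logarithmic derivative chi. *)
Lemma fiber_coordinate (y0 u0 r : R) (g : R -> R) : 0 < r ->
  smooth_on (box y0 u0 r) (lift g) ->
  exists rho phi phi1 chi, 0 < rho <= r /\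
    smooth_on (box y0 u0 rho) (lift phi) /\ smooth_on (box y0 u0 rho) (lift phi1) /\
    smooth_on (box y0 u0 rho) (lift chi) /\
    forall y, Rabs (y - y0) < rho ->
      is_derive phi y (phi1 y) /\ 0 < phi1 y /\ is_derive phi1 y (chi y * phi1 y) /\
      is_derive chi y (g y / 6 + chi y ^ 2 / 2).
Proof.
intros Hr Hg.
assert (Hk : smooth_on (box y0 u0 r) (lift (fun y => - g y / 12))).
{ assert (HO := box_open y0 u0 r).
  apply smooth_ext with (F := fun y u => -1 / 12 * lift g y u); trivial.
  - intros; unfold lift; field.
  - smooth; trivial. }
assert (H0 : smooth_on (box y0 u0 r) (lift (fun _ => 0)))
  by apply (smooth_const _ 0), box_open.
(* The source term and the coefficient of [h2] are both -g/12, so w = 1 + h2 satisfies w'' = -(g/12)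
   w with w(y0) = 1, although the solver starts from zero data. *)
destruct (linear_ode y0 u0 r _ _ _ _ Hr Hk H0 Hk H0)
  as (r1 & z & h1 & h2 & h3 & Hr1 & _ & Z2 & _ & S1 & S2 & _ & H).
set (w := fun y => 1 + h2 y).
(* The zeros of w are the poles of chi; the interval is shrunk until w is positive. *)
assert (near : exists r2, 0 < r2 <= r1 /\ forall y, Rabs (y - y0) < r2 -> 0 < w y).
{ assert (C := is_derive_cont h2 y0 _
    (proj1 (proj2 (H y0 ltac:(rewrite Rabs_minus_self; lra))))).
  destruct (C _ (locally_ball (h2 y0) (mkposreal 1 Rlt_0_1))) as [d Hd].
  exists (Rmin r1 d); split.
  - split; [apply Rmin_pos; [lra | apply cond_pos] | apply Rmin_l].
  - intros y Hy; assert (K := Hd y (Rlt_le_trans _ _ _ Hy (Rmin_r _ _))).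
    change (Rabs (h2 y - h2 y0) < 1) in K; rewrite Z2 in K.
    apply Rabs_def2 in K; unfold w; lra. }
destruct near as (r2 & Hr2 & W).
set (D := box y0 u0 r2).
assert (HD : open D) by apply box_open.
assert (sub : forall F, smooth_on (box y0 u0 r1) F -> smooth_on D F).
{ intros F; apply smooth_subset, box_shrink; lra. }
apply sub in S1; apply sub in S2.
assert (WD : forall y u, D (y, u) -> w y <> 0).
{ intros y u [Hy _]; generalize (W y Hy); simpl in *; lra. }
assert (Sw : smooth_on D (fun y u => 1 + lift h2 y u)) by (smooth; trivial).
set (phi1 := fun y => / (w y * w y)).
set (chi := fun y => -2 * h1 y / w y).
assert (Sphi1 : smooth_on D (lift phi1)).
{ change (smooth_on D (fun y u => / ((1 + lift h2 y u) * (1 + lift h2 y u)))).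
  smooth; trivial.
  intros y u Hyu; apply Rmult_integral_contrapositive; split; apply (WD y u Hyu). }
assert (Schi : smooth_on D (lift chi)).
{ change (smooth_on D (fun y u => -2 * lift h1 y u / (1 + lift h2 y u))).
  smooth; trivial. }
set (phi := fun y => RInt phi1 y0 y).
assert (Dphi : forall y, Rabs (y - y0) < r2 -> is_derive phi y (phi1 y)).
{ intros y Hy; apply (RInt_primitive phi1 y0 r2 y); [| exact Hy].
  intros x Hx; now apply lift_continuous with y0 u0 r2. }
exists r2, phi, phi1, chi.
split; [lra | split; [| split; [exact Sphi1 | split; [exact Schi |]]]].
- apply lift_family_smooth with (L := fun k => k = phi); trivial.
  intros k ->; exists (lift phi1); split; [now apply gen_base; left |].
  intros y u [Hy _]; now apply Dphi.
- intros y Hy; split; [now apply Dphi |].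
  assert (Wy := W y Hy); destruct (H y ltac:(lra)) as (_ & G2 & G1 & Ez).
  assert (Dw : is_derive w y (h1 y)).
  { replace (h1 y) with (0 + h1 y) by ring.
    apply (is_derive_Rplus (fun _ => 1) h2); [apply (is_derive_const 1) | exact G2]. }
  split; [apply Rinv_0_lt_compat; nra |]; split.
  + unfold phi1, chi; replace (-2 * h1 y / w y * / (w y * w y))
      with (- (h1 y * w y + w y * h1 y) / (w y * w y) ^ 2) by (field; lra).
    apply (is_derive_inv (fun y => w y * w y)); [| nra].
    now apply (is_derive_Rmult w w).
  + unfold chi.
    replace (g y / 6 + (-2 * h1 y / w y) ^ 2 / 2)
      with ((0 * h1 y + -2 * z y) * / w y + -2 * h1 y * (- h1 y / w y ^ 2)).
    * apply (is_derive_Rmult (fun y => -2 * h1 y) (fun y => / w y)).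
      -- apply (is_derive_Rmult (fun _ => -2) h1); [apply (is_derive_const (-2)) | exact G1].
      -- apply is_derive_inv; [exact Dw | lra].
    * rewrite Ez; unfold w in *; field; lra.
Qed.

Section Potential.

Variables (y0 u0 r : R) (a0 a1 : R -> R -> R) (phi1 chi : R -> R).
Let D := box y0 u0 r.
Hypothesis r_pos : 0 < r.
Hypothesis a0_smooth : smooth_on D a0.
Hypothesis a1_smooth : smooth_on D a1.
Hypothesis closed_form : forall y u, D (y, u) -> d2 a0 y u = d1 a1 y u.
Hypothesis phi1_smooth : smooth_on D (lift phi1).
Hypothesis phi1_pos : forall y, Rabs (y - y0) < r -> 0 < phi1 y.
Hypothesis phi1_derive : forall y, Rabs (y - y0) < r ->
  is_derive phi1 y (chi y * phi1 y).

Lemma box_axis (y u : R) : D (y, u) -> D (y, u0).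
Proof.
intros [Hy _]; split; [exact Hy | simpl; rewrite Rabs_minus_self; exact r_pos].
Qed.

Lemma axis_smooth (F : R -> R -> R) : smooth_on D F ->
  smooth_on D (lift (fun y => F y u0)).
Proof.
intros HF; assert (HD : open D) by apply box_open.
apply (smooth_comp D D F (fun a _ => a) (fun _ _ => u0)); trivial.
- now apply smooth_fst.
- now apply smooth_const.
- exact box_axis.
Qed.

Lemma integral2_axis (F : R -> R -> R) (y : R) : integral2 u0 F y u0 = 0.
Proof. exact (RInt_point u0 (F y)). Qed.

Lemma box_derive2_zero (F : R -> R -> R) :
  (forall y u, D (y, u) -> is_derive (F y) u 0) ->
  forall y u, D (y, u) -> F y u = F y u0.
Proof.
intros H y u [Hy Hu]; apply (derive_zero_constant (F y) u0 r); [| exact Hu].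
intros v Hv; apply H; now split.
Qed.

(** E is phi' exp(L) with L a potential of (a0 dy + a1 du)/3; the factor phi' adds chi to the
    logarithmic derivative in y. This E will be P = psi_u. *)
Lemma potential : exists E, smooth_on D E /\
  (forall y u, D (y, u) -> 0 < E y u) /\
  partials D E (fun y u => (a0 y u / 3 + chi y) * E y u)
    (fun y u => a1 y u / 3 * E y u).
Proof.
assert (HD : open D) by apply box_open.
set (l := fun y => RInt (fun t => a0 t u0) y0 y).
assert (Sa := axis_smooth a0 a0_smooth).
assert (Dl : forall y u, D (y, u) -> is_derive l y (a0 y u0)).
{ intros y u [Hy _]; apply (RInt_primitive (fun t => a0 t u0) y0 r y); [| exact Hy].
  intros x Hx; now apply (lift_continuous y0 u0 r (fun y => a0 y u0)). }
assert (Sl : smooth_on D (lift l)).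
{ apply lift_family_smooth with (L := fun k => k = l); trivial.
  intros k ->; exists (lift (fun y => a0 y u0)); split; [now apply gen_base; left |].
  exact Dl. }
set (L := fun y u => / 3 * (lift l y u + integral2 u0 a1 y u)).
assert (Si : smooth_on D (integral2 u0 a1)) by now apply integral2_smooth.
assert (SL : smooth_on D L) by (unfold L; smooth; trivial).
assert (Pl := lift_partials D l (fun y => a0 y u0) Dl).
assert (Pi : partials D (integral2 u0 a1) (integral2 u0 (d1 a1)) a1)
  by now apply integral2_partials.
assert (PL : partials D L
  (fun y u => 0 * (lift l y u + integral2 u0 a1 y u)
     + / 3 * (lift (fun y => a0 y u0) y u + integral2 u0 (d1 a1) y u))
  (fun y u => 0 * (lift l y u + integral2 u0 a1 y u) + / 3 * (0 + a1 y u))).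
{ unfold L; apply (partials_mult D (fun _ _ => / 3)); [apply partials_const |].
  now apply (partials_plus D (lift l) (integral2 u0 a1)). }
(* Both sides vanish on the axis, and their derivatives in u agree because the form is closed. *)
assert (Pa : forall y u, D (y, u) -> integral2 u0 (d1 a1) y u = a0 y u - a0 y u0).
{ intros y u Hyu.
  assert (Hd1 : smooth_on D (d1 a1)) by smooth.
  assert (K : integral2 u0 (d1 a1) y u - a0 y u = integral2 u0 (d1 a1) y u0 - a0 y u0).
  { apply (box_derive2_zero (fun y u => integral2 u0 (d1 a1) y u - a0 y u));
      [| exact Hyu].
    intros y' u' H'; replace 0 with (d1 a1 y' u' - d2 a0 y' u')
      by (rewrite closed_form; trivial; ring).
    apply (is_derive_minus (integral2 u0 (d1 a1) y') (a0 y')).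
    - exact (proj2 (integral2_partials y0 u0 r (d1 a1) Hd1 y' u' H')).
    - exact (proj2 (smooth_partials D a0 a0_smooth y' u' H')). }
  rewrite integral2_axis in K; lra. }
exists (fun y u => lift phi1 y u * exp (L y u)).
split; [smooth | split].
- intros y u [Hy _]; apply Rmult_lt_0_compat; [now apply phi1_pos | apply exp_pos].
- assert (PE : partials D (fun y u => exp (L y u))
    (fun y u => a0 y u / 3 * exp (L y u)) (fun y u => a1 y u / 3 * exp (L y u))).
  { intros y u Hyu; destruct (PL y u Hyu) as [L1 L2]; split.
    - replace (a0 y u / 3) with (0 * (lift l y u + integral2 u0 a1 y u)
        + / 3 * (lift (fun y => a0 y u0) y u + integral2 u0 (d1 a1) y u))
        by (rewrite Pa; trivial; unfold lift; field).
      apply (is_derive_Rcomp exp (fun z => L z u)); [apply is_derive_exp | exact L1].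
    - replace (a1 y u / 3) with (0 * (lift l y u + integral2 u0 a1 y u)
        + / 3 * (0 + a1 y u)) by field.
      apply (is_derive_Rcomp exp (fun z => L y z)); [apply is_derive_exp | exact L2]. }
  assert (Pphi : partials D (lift phi1) (lift (fun y => chi y * phi1 y)) (fun _ _ => 0)).
  { apply lift_partials; intros y u [Hy _]; now apply phi1_derive. }
  assert (PM := partials_mult D _ _ _ _ _ _ Pphi PE).
  intros y u Hyu; destruct (PM y u Hyu) as [M1 M2]; unfold lift in *; split.
  + replace ((a0 y u / 3 + chi y) * (phi1 y * exp (L y u))) with
      (chi y * phi1 y * exp (L y u) + phi1 y * (a0 y u / 3 * exp (L y u))) by ring.
    exact M1.
  + replace (a1 y u / 3 * (phi1 y * exp (L y u))) with
      (0 * exp (L y u) + phi1 y * (a1 y u / 3 * exp (L y u))) by ring.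
    exact M2.
Qed.

End Potential.

Lemma is_derive_Rminus (f g : R -> R) (x df dg : R) :
  is_derive f x df -> is_derive g x dg ->
  is_derive (fun z => f z - g z) x (df - dg).
Proof. exact (is_derive_minus f g x df dg). Qed.

Lemma is_derive_Rscal (k : R) (f : R -> R) (x df : R) :
  is_derive f x df -> is_derive (fun z => k * f z) x (k * df).
Proof. exact (is_derive_scal f x k df). Qed.

(** Each condition has its own task: the first makes a0 dy + a1 du closed, the second makes [G] and
    the fifth makes [c0] independent of u, and the third and fourth yield the equations for b2 and
    b3. *)
Lemma pullback_exists (y0 u0 r : R) (a0 a1 b0 b1 b2 b3 : R -> R -> R) :
  0 < r ->
  smooth_on (box y0 u0 r) a0 -> smooth_on (box y0 u0 r) a1 ->
  smooth_on (box y0 u0 r) b0 -> smooth_on (box y0 u0 r) b1 ->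
  (forall y u, box y0 u0 r (y, u) -> linearization_conditions a0 a1 b0 b1 b2 b3 y u) ->
  exists rho phi phi1 chi kappa psi, 0 < rho <= r /\
    smooth_on (box y0 u0 rho) (lift phi) /\ smooth_on (box y0 u0 rho) (lift chi) /\
    smooth_on (box y0 u0 rho) psi /\
    (forall y, Rabs (y - y0) < rho -> is_derive phi y (phi1 y) /\ 0 < phi1 y /\
       is_derive phi1 y (chi y * phi1 y)) /\
    (forall y u, box y0 u0 rho (y, u) -> 0 < d2 psi y u /\
       pullback_system a0 a1 b0 b1 b2 b3 psi (lift chi) (lift kappa) y u).
Proof.
intros Hr Ha0 Ha1 Hb0 Hb1 HC.
set (G := fun y u => 3 * b1 y u - a0 y u * a0 y u - 3 * d1 a0 y u).
assert (HO := box_open y0 u0 r).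
assert (SG : smooth_on (box y0 u0 r) G) by (unfold G; smooth).
destruct (fiber_coordinate y0 u0 r (fun y => G y u0) Hr (axis_smooth y0 u0 r Hr G SG))
  as (r1 & phi & phi1 & chi & Hr1 & Sphi & Sphi1 & Schi & HF).
assert (sub1 : forall a b, box y0 u0 r1 (a, b) -> box y0 u0 r (a, b))
  by (apply box_shrink; lra).
assert (GC : forall y u, box y0 u0 r1 (y, u) -> G y u = G y u0).
{ apply (box_derive2_zero y0 u0 r1 G); intros y u H; apply sub1 in H.
  eassert (PG : partials (box y0 u0 r) G _ _) by (unfold G; partials).
  destruct (PG y u H) as [_ K]; destruct (HC y u H) as (_ & C2 & _).
  match type of K with is_derive _ _ ?e => replace 0 with e by lra end; exact K. }
apply (smooth_subset _ _ _ sub1) in Ha0, Ha1, Hb0, Hb1; clear SG HO.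
assert (HC1 : forall y u, box y0 u0 r1 (y, u) ->
          linearization_conditions a0 a1 b0 b1 b2 b3 y u) by auto.
assert (Hr1' : 0 < r1) by lra.
clear HC; set (D := box y0 u0 r1) in *.
assert (HD : open D) by apply box_open.
destruct (potential y0 u0 r1 a0 a1 phi1 chi) as (E & SE & PE & EE); trivial.
{ intros y u H; apply (HC1 y u H). }
{ intros y H; apply (HF y H). }
{ intros y H; apply (HF y H). }
set (X := lift chi) in *.
assert (X1 : forall y u, D (y, u) -> d1 X y u = G y u / 6 + X y u ^ 2 / 2).
{ intros y u H; rewrite (GC y u H); apply is_derive_unique.
  destruct H as [H _]; now apply HF. }
assert (X2 : forall y u, D (y, u) -> d2 X y u = 0)
  by (intros y u _; exact (Derive_const (chi y) u)).
assert (X12 : forall y u, D (y, u) -> d2 (d1 X) y u = 0) by now apply d2_d1_zero.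
assert (X112 : forall y u, D (y, u) -> d2 (d1 (d1 X)) y u = 0)
  by (apply d2_d1_zero; trivial; smooth).
(* The value of P_y / P forced by the equation for a0. In terms of it, P_yy / P = B_y + B^2, and
   [F1] is the equation for b1 divided by P. *)
set (B := fun y u => / 3 * a0 y u + X y u).
assert (SB : smooth_on D B) by (unfold B; smooth; trivial).
assert (EB : forall y u, D (y, u) -> 3 * B y u = a0 y u + 3 * X y u)
  by (intros; unfold B; field).
assert (F1 : forall y u, D (y, u) -> b1 y u = 3 * d1 B y u + 3 * (B y u * B y u)
          - 6 * (X y u * B y u) + 2 * (X y u * X y u) - d1 X y u).
{ differentiate HD EB EBy EBu; intros y u H; specialize (EB y u H).
  assert (K1 : d1 B y u = / 3 * d1 a0 y u + d1 X y u) by (specialize (EBy y u H); lra).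
  rewrite K1, (X1 y u H); unfold B, G; field. }
differentiate HD EB EBy EBu.
differentiate HD F1 F1y F1u.
differentiate HD F1y F1yy F1yu.
(* The candidate for c: the equation for b0, differentiated in u and divided by P, solved for c with
   P_u / P = a1 / 3 and P_yyy / P = B_yy + 3 B B_y + B^3. *)
set (c0 := fun y u => d2 b0 y u + / 3 * (a1 y u * b0 y u)
  - (d1 (d1 B) y u + 3 * (B y u * d1 B y u) + B y u * (B y u * B y u)
     - 3 * (X y u * (d1 B y u + B y u * B y u))
     + (2 * (X y u * X y u) - d1 X y u) * B y u)).
assert (Sc0 : smooth_on D c0) by (unfold c0; smooth; trivial).
assert (Cc0 : forall y u, D (y, u) -> c0 y u = c0 y u0).
{ apply (box_derive2_zero y0 u0 r1 c0); intros y u H.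
  eassert (Pc : partials D c0 _ _) by (unfold c0; partials).
  destruct (Pc y u H) as [_ K]; destruct (HC1 y u H) as (C1 & _ & _ & _ & C5).
  match type of K with is_derive _ _ ?e => replace 0 with e; [exact K |] end.
  specialize (EB y u H); specialize (EBy y u H); specialize (EBu y u H).
  specialize (F1 y u H); specialize (F1y y u H); specialize (F1u y u H).
  specialize (F1yu y u H).
  assert (X1' := X12 y u H); assert (X0' := X2 y u H); assert (X11' := X112 y u H).
  rewrite X0', X1' in F1u; rewrite X0', X1', X11' in F1yu; rewrite X0' in EBu.
  rewrite X0', X1'.
  assert (V0 : a0 y u = 3 * B y u - 3 * X y u) by lra.
  assert (V1 : d1 a1 y u = 3 * d2 B y u) by lra.
  assert (V2 : d1 a0 y u = 3 * d1 B y u - 3 * d1 X y u) by lra.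
  rewrite V0, V1, V2, F1, F1u in C5.
  assert (V3 : d2 (d1 b1) y u = 3 * d2 (d1 (d1 B)) y u
    + 6 * (d2 B y u * d1 B y u + B y u * d2 (d1 B) y u)
    - 6 * (d1 X y u * d2 B y u + X y u * d2 (d1 B) y u)) by (rewrite F1yu; ring).
  rewrite V3 in C5; clear - C5.
  lra. }
assert (Ey : forall y u, D (y, u) -> d1 E y u = B y u * E y u).
{ intros y u H; rewrite (proj1 (partials_eq D E _ _ y u EE H)).
  unfold B, X, lift; field. }
assert (Eu : forall y u, D (y, u) -> d2 E y u = / 3 * (a1 y u * E y u)).
{ intros y u H; rewrite (proj2 (partials_eq D E _ _ y u EE H)); field. }
clear EE; differentiate HD Ey Eyy Eyu.
differentiate HD Eyy Eyyy Eyyu.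
differentiate HD Eu Euy Euu.
set (Q := fun y u => 2 * (X y u * X y u) - d1 X y u).
assert (SQ : smooth_on D Q) by (unfold Q; smooth).
assert (QC : forall y u, D (y, u) -> Q y u = Q y u0).
{ intros y u H; unfold Q; rewrite (X1 y u H), (X1 y u0), (GC y u H); trivial.
  exact (box_axis y0 u0 r1 Hr1' y u H). }
set (rhs := fun y u => b0 y u * E y u).
(* On the axis the integral part of psi vanishes, so there the equation for b0 is this third order
   equation for [h3]. *)
destruct (linear_ode y0 u0 r1 (fun y => rhs y u0) (fun y => 3 * X y u0)
  (fun y => - Q y u0) (fun y => - c0 y u0))
  as (rho & z & h1 & h2 & h3 & Hrho & _ & _ & _ & Sh1 & Sh2 & Sh3 & Hh); trivial.
{ apply (axis_smooth y0 u0 r1 Hr1' rhs); unfold rhs; smooth. }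
{ apply (axis_smooth y0 u0 r1 Hr1' (fun y u => 3 * X y u)); smooth; trivial. }
{ apply (axis_smooth y0 u0 r1 Hr1' (fun y u => - Q y u)); smooth. }
{ apply (axis_smooth y0 u0 r1 Hr1' (fun y u => - c0 y u)); smooth. }
assert (sub : forall a b, box y0 u0 rho (a, b) -> D (a, b))
  by (apply box_shrink; lra).
set (D' := box y0 u0 rho) in *.
assert (HD' : open D') by apply box_open.
assert (SE1 : smooth_on D (d1 E)) by smooth.
assert (SE2 : smooth_on D (d1 (d1 E))) by smooth.
assert (sm : forall F, smooth_on D F -> smooth_on D' F)
  by (intros F; now apply smooth_subset).
set (psi := fun y u => integral2 u0 E y u + lift h3 y u).
set (psi1 := fun y u => integral2 u0 (d1 E) y u + lift h2 y u).
set (psi2 := fun y u => integral2 u0 (d1 (d1 E)) y u + lift h1 y u).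
assert (step : forall F k k', smooth_on D F ->
  (forall y, Rabs (y - y0) < rho -> is_derive k y (k' y)) ->
  partials D' (fun y u => integral2 u0 F y u + lift k y u)
    (fun y u => integral2 u0 (d1 F) y u + lift k' y u) (fun y u => F y u + 0)).
{ intros F k k' SF Hk.
  apply (partials_plus D' (integral2 u0 F) (lift k) _ _ _ (fun _ _ => 0)).
  - apply (integral2_partials y0 u0 rho F); now apply sm.
  - apply lift_partials; intros y u [Hy _]; now apply Hk. }
assert (PP := step E h3 h2 SE (fun y Hy => proj1 (Hh y Hy))).
assert (PP1 := step (d1 E) h2 h1 SE1 (fun y Hy => proj1 (proj2 (Hh y Hy)))).
assert (PP2 := step (d1 (d1 E)) h1 z SE2
  (fun y Hy => proj1 (proj2 (proj2 (Hh y Hy))))).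
fold psi in PP; fold psi1 in PP1; fold psi2 in PP2.
assert (Y1 : forall y u, D' (y, u) -> d1 psi y u = psi1 y u)
  by (intros y u H; exact (proj1 (partials_eq D' _ _ _ y u PP H))).
assert (Y2 : forall y u, D' (y, u) -> d1 (d1 psi) y u = psi2 y u).
{ intros y u H; rewrite (d1_congr D' (d1 psi) psi1 y u HD' Y1 H).
  exact (proj1 (partials_eq D' _ _ _ y u PP1 H)). }
assert (Y3 : forall y u, D' (y, u) -> d1 (d1 (d1 psi)) y u
          = integral2 u0 (d1 (d1 (d1 E))) y u + z y).
{ intros y u H; rewrite (d1_congr D' (d1 (d1 psi)) psi2 y u HD' Y2 H).
  exact (proj1 (partials_eq D' _ _ _ y u PP2 H)). }
assert (P0 : forall y u, D' (y, u) -> d2 psi y u = E y u).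
{ intros y u H; rewrite (proj2 (partials_eq D' _ _ _ y u PP H)); ring. }
assert (P1' : forall y u, D' (y, u) -> d1 (d2 psi) y u = d1 E y u)
  by (intros; now apply (d1_congr D')).
assert (P2' : forall y u, D' (y, u) -> d2 (d2 psi) y u = d2 E y u)
  by (intros; now apply (d2_congr D')).
assert (P11 : forall y u, D' (y, u) -> d1 (d1 (d2 psi)) y u = d1 (d1 E) y u)
  by (intros; now apply (d1_congr D')).
assert (P12 : forall y u, D' (y, u) -> d2 (d1 (d2 psi)) y u = d2 (d1 E) y u)
  by (intros; now apply (d2_congr D')).
assert (P22 : forall y u, D' (y, u) -> d2 (d2 (d2 psi)) y u = d2 (d2 E) y u)
  by (intros; now apply (d2_congr D')).
(* The residual of the equation for b0. Its derivative in u vanishes by the choice of [c0], and on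
   the axis it vanishes by the differential equation for [h3]. *)
assert (Res : forall y u, D' (y, u) ->
  integral2 u0 (d1 (d1 (d1 E))) y u + z y - 3 * (X y u0 * psi2 y u)
    + Q y u0 * psi1 y u + c0 y u0 * psi y u - rhs y u = 0).
{ set (W := fun y u => integral2 u0 (d1 (d1 (d1 E))) y u + z y
    - 3 * (X y u0 * psi2 y u) + Q y u0 * psi1 y u + c0 y u0 * psi y u - rhs y u).
  intros y u H; change (W y u = 0); transitivity (W y u0).
  - apply (box_derive2_zero y0 u0 rho W); [clear y u H; intros y u H | exact H].
    assert (HDy := sub _ _ H).
    assert (SE3 : smooth_on D' (d1 (d1 (d1 E)))) by (apply sm; smooth).
    assert (I3 := proj2 (integral2_partials y0 u0 rho _ SE3 y u H)).
    destruct (PP y u H) as [_ I0]; destruct (PP1 y u H) as [_ I1];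
      destruct (PP2 y u H) as [_ I2].
    eassert (PR : partials D rhs _ _) by (unfold rhs; partials).
    destruct (PR y u HDy) as [_ IR].
    assert (K := is_derive_Rminus (fun v => integral2 u0 (d1 (d1 (d1 E))) y v + z y
        - 3 * (X y u0 * psi2 y v) + Q y u0 * psi1 y v + c0 y u0 * psi y v) _ _ _ _
      (is_derive_Rplus _ _ _ _ _ (is_derive_Rplus _ _ _ _ _
        (is_derive_Rminus _ _ _ _ _
          (is_derive_Rplus _ _ _ _ _ I3 (is_derive_const (z y) u))
          (is_derive_Rscal 3 _ _ _ (is_derive_Rscal (X y u0) _ _ _ I2)))
        (is_derive_Rscal (Q y u0) _ _ _ I1)) (is_derive_Rscal (c0 y u0) _ _ _ I0)) IR).
    match type of K with is_derive _ _ ?e => replace 0 with e; [exact K |] end.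
    cbv beta; change (@zero R_NormedModule) with 0.
    rewrite <- (Cc0 y u HDy), <- (QC y u HDy).
    specialize (Ey y u HDy); specialize (Eu y u HDy); specialize (Eyy y u HDy);
      specialize (Eyyy y u HDy).
    rewrite Eyyy, Eyy, Ey, Eu; unfold c0, Q, X, lift; ring.
  - unfold W, psi, psi1, psi2; rewrite !integral2_axis.
    destruct H as [Hy _]; destruct (Hh y Hy) as (_ & _ & _ & ->).
    unfold X, lift; ring. }
exists rho, phi, phi1, chi, (fun y => c0 y u0), psi.
split; [lra | split; [now apply sm | split; [now apply sm | split; [| split]]]].
- unfold psi; assert (SI := integral2_smooth y0 u0 rho E (sm E SE)); smooth.
- intros y Hy; destruct (HF y ltac:(lra)) as (K1 & K2 & K3 & _); auto.
- intros y u H; assert (HDy := sub _ _ H).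
  rewrite (P0 y u H); split; [now apply PE |].
  destruct (HC1 y u HDy) as (C1 & C2 & C3 & C4 & _).
  specialize (Ey y u HDy); specialize (Eu y u HDy); specialize (Eyy y u HDy);
    specialize (Eyu y u HDy); specialize (Euu y u HDy).
  specialize (EB y u HDy); specialize (EBu y u HDy); specialize (F1 y u HDy).
  specialize (Res y u H); specialize (X2 y u HDy).
  unfold pullback_system; cbv zeta; fold X.
  rewrite (P0 y u H), (P1' y u H), (P2' y u H), (P11 y u H), (P12 y u H), (P22 y u H),
    (Y1 y u H), (Y2 y u H), (Y3 y u H).
  split; [| split; [| split; [| split; [| split]]]].
  + rewrite Eu; field.
  + rewrite Ey; replace (a0 y u) with (3 * B y u - 3 * X y u) by lra; ring.
  + rewrite Euu, Eu; replace (b3 y u) with ((3 * d2 a1 y u + a1 y u ^ 2) / 9) by lra.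
    field.
  + rewrite Eyu, Eu; replace (b2 y u) with ((3 * d1 a1 y u + a0 y u * a1 y u) / 3) by lra.
    replace (d1 a1 y u) with (3 * d2 B y u) by lra.
    replace (a0 y u) with (3 * B y u - 3 * X y u) by lra; field.
  + rewrite Eyy, Ey, F1; ring.
  + rewrite <- (QC y u HDy) in Res; unfold Q, rhs in Res; unfold lift at 1.
    change (X y u0) with (X y u) in Res; lra.
Qed.

(** * The linearizing map and its inverse *)

Lemma open_preimage (D W : R * R -> Prop) (g h : R -> R -> R) :
  open D -> open W -> smooth_on D g -> smooth_on D h ->
  open (fun q => D q /\ W (g (fst q) (snd q), h (fst q) (snd q))).
Proof.
intros HD HW Hg Hh; apply open_of_locally_2d; intros a b [Hab Hw]; simpl in *.
destruct (open_locally_2d W _ _ HW Hw) as [d Hd].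
apply locally_2d_and; [now apply open_locally_2d |].
destruct (locally_2d_and _ _ a b (smooth_cont D g a b Hg Hab d)
  (smooth_cont D h a b Hh Hab d)) as [e He].
exists e; intros u v Hu Hv; destruct (He u v Hu Hv); now apply Hd.
Qed.

(** The map (phi(y), psi(y, u)) is triangular, so it is inverted by two implicit functions in turn:
    y from t, then u from y and s. *)
Lemma sufficiency (Omega : R * R -> Prop) (a0 a1 b0 b1 b2 b3 : R -> R -> R) :
  open Omega -> smooth_on Omega a0 -> smooth_on Omega a1 -> smooth_on Omega b0 ->
  smooth_on Omega b1 ->
  (forall y u, Omega (y, u) -> linearization_conditions a0 a1 b0 b1 b2 b3 y u) ->
  linearizable_by_point_transformation Omega (cubic_rhs a0 a1 b0 b1 b2 b3).
Proof.
intros HOm Ha0 Ha1 Hb0 Hb1 HC y0 u0 H0.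
destruct (box_in_open Omega y0 u0 HOm H0) as (r & Hr & Hbox).
destruct (pullback_exists y0 u0 r a0 a1 b0 b1 b2 b3)
  as (rho & phi & phi1 & chi & kappa & psi & Hrho & Sphi & Schi & Spsi & Dphi & HS);
  try (now apply smooth_subset with (1 := Hbox)); auto.
assert (sub : forall a b, box y0 u0 rho (a, b) -> Omega (a, b)).
{ intros a b H; apply Hbox; apply (box_shrink y0 u0 r rho); [lra | exact H]. }
assert (Prho : 0 < rho) by lra; clear r Hr Hbox Hrho.
set (U := box y0 u0 rho) in *.
assert (HU : open U) by apply box_open.
set (F := fun _ y : R => phi y).
assert (SF : smooth_on (box 0 y0 rho) F).
{ assert (HO := box_open 0 y0 rho).
  apply (smooth_comp (box 0 y0 rho) U (lift phi) (fun _ b => b) (fun _ _ => u0));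
    trivial.
  - now apply smooth_snd.
  - now apply smooth_const.
  - intros a b [_ Hb]; split; simpl in *; [exact Hb | now rewrite Rabs_minus_self]. }
assert (PF : forall a y, box 0 y0 rho (a, y) -> 0 < d2 F a y).
{ intros a y [_ Hy]; destruct (Dphi y Hy) as (K & Pp & _).
  replace (d2 F a y) with (phi1 y); [exact Pp |].
  symmetry; now apply is_derive_unique. }
assert (Ppsi : forall y u, U (y, u) -> 0 < d2 psi y u) by (intros; now apply HS).
set (V1 := implicit_domain 0 y0 rho F); set (V2 := implicit_domain y0 u0 rho psi).
set (eta := fun t _ : R => implicit_function 0 y0 rho F 0 t).
set (theta := fun t s => implicit_function y0 u0 rho psi (eta t s) s).
assert (HV1 : open V1) by (apply implicit_domain_open; trivial).
assert (HV2 : open V2) by (apply implicit_domain_open; trivial).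
set (W := fun q : R * R => True /\ V1 (0, fst q)).
assert (HW : open W).
{ apply (open_preimage (fun _ => True) V1 (fun _ _ => 0) (fun t _ => t));
    trivial; try exact open_full.
  - apply smooth_const, open_full.
  - apply smooth_fst, open_full. }
assert (Seta : smooth_on W eta).
{ apply (smooth_comp W V1 (implicit_function 0 y0 rho F) (fun _ _ => 0) (fun t _ => t));
    trivial.
  - now apply implicit_smooth.
  - now apply smooth_const.
  - now apply smooth_fst.
  - now intros t s [_ H]. }
set (V := fun q : R * R => W q /\ V2 (eta (fst q) (snd q), snd q)).
assert (HV : open V).
{ apply (open_preimage W V2 eta (fun _ s => s)); trivial; now apply smooth_snd. }
assert (eta_phi : forall y s, Rabs (y - y0) < rho -> W (phi y, s) /\ eta (phi y) s = y).
{ intros y s Hy; assert (B0 : box 0 y0 rho (0, y)).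
  { split; [simpl; now rewrite Rabs_minus_self | exact Hy]. }
  split; [split; [exact I | now exists y] |].
  exact (implicit_left 0 y0 rho F SF PF 0 y B0). }
exists U, V, (lift phi), psi, eta, theta,
  (* From c = alpha(phi) phi'^3, read at y = eta(t); the second argument 0 of [eta] is a dummy. *)
  (fun t => kappa (eta t 0) / phi1 (eta t 0) ^ 3).
split; [now apply box_center | split; [exact sub | split]].
- split; [exact HU | split; [exact HV | split; [exact Sphi | split; [exact Spsi |]]]].
  split; [| split; [| split]].
  + apply smooth_subset with (2 := Seta); now intros a b [].
  + apply (smooth_comp V V2 (implicit_function y0 u0 rho psi) eta (fun _ s => s));
      trivial.
    * now apply implicit_smooth.
    * apply smooth_subset with (2 := Seta); now intros a b [].
    * now apply smooth_snd.
    * now intros t s [_ H].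
  + intros y u Hyu; destruct (eta_phi y (psi y u) (proj1 Hyu)) as [K1 K2].
    unfold theta, lift; rewrite K2; split; [split; [exact K1 |] | split; [easy |]].
    * simpl; rewrite K2; now exists u.
    * now apply implicit_left.
  + intros t s [[_ H1] H2]; simpl in H1, H2.
    destruct (implicit_spec y0 u0 rho psi _ _ H2) as [K1 K2].
    split; [exact K1 | split; [| exact K2]].
    exact (proj2 (implicit_spec 0 y0 rho F 0 t H1)).
- intros u s y t Hy Hu _ Hs E.
  assert (T := third_derivative U (lift phi) psi u s y HU Sphi Spsi Hy Hu Hs E).
  cbv zeta in T; fold t in T.
  assert (Hy0 : Rabs (y - y0) < rho) by apply Hy.
  assert (Z2 : forall a b, U (a, b) -> d2 (lift phi) a b = 0)
    by (intros a b _; exact (Derive_const (phi a) b)).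
  assert (D1 : forall a b, U (a, b) -> d1 (lift phi) a b = lift phi1 a b).
  { intros a b [Ha _]; apply is_derive_unique; now apply (Dphi a). }
  assert (N1 : forall a b, U (a, b) -> d1 (lift phi) a b <> 0).
  { intros a b H; rewrite (D1 a b H); destruct H as [Ha _].
    generalize (proj1 (proj2 (Dphi a Ha))); unfold lift; simpl; lra. }
  assert (DX : forall a b, U (a, b) -> chi_of (lift phi) a b = lift chi a b).
  { intros a b H; unfold chi_of; generalize (N1 a b H).
    rewrite (d1_congr U (d1 (lift phi)) (lift phi1) a b HU D1 H), (D1 a b H).
    replace (d1 (lift phi1) a b) with (chi a * phi1 a).
    - intros N; unfold lift in *; now field.
    - symmetry; apply is_derive_unique; destruct H as [Ha _]; now apply (Dphi a). }
  set (p := Derive u y) in *; set (q := Derive_n u 2 y) in *;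
    set (w := Derive_n u 3 y) in *.
  destruct (transformed_third_fiber U (lift phi) psi HU Sphi Z2 N1 y (u y) p q w Hy)
    as [J K].
  destruct (jet_expansion U psi y (u y) p q w HU Spsi Hy) as (J1 & J2 & J3).
  rewrite J, K, (DX y (u y) Hy), (d1_congr U _ _ y (u y) HU DX Hy),
    (D1 y (u y) Hy), J1, J2, J3 in T; clear J K J1 J2 J3.
  destruct (HS y (u y) Hy) as (Pp & S1 & S2 & S3 & S4 & S5 & S6).
  assert (Ephi := proj1 (proj2 (Dphi y Hy0))).
  assert (Es := locally_singleton _ _ E); fold t in Es; cbv beta in Es.
  change (t y) with (phi y) in *.
  rewrite (proj2 (eta_phi y 0 Hy0)), Es.
  unfold lift in T, S2, S4, S5, S6.
  (* The two equations differ by the nonvanishing factor P / phi'^3, which gives both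
     implications. *)
  assert (M : (Derive_n s 3 (phi y) + kappa y / phi1 y ^ 3 * psi y (u y)) * phi1 y ^ 3
    = d2 psi y (u y) * (w - cubic_rhs a0 a1 b0 b1 b2 b3 y (u y) p q)).
  { apply Rmult_eq_reg_r with (phi1 y ^ 2); [| apply pow_nonzero; lra].
    transitivity (Derive_n s 3 (phi y) * phi1 y ^ 5
      + phi1 y ^ 2 * (kappa y * psi y (u y))); [field; lra |].
    transitivity (phi1 y ^ 2 * (d2 psi y (u y) * w
      + ((a1 y (u y) * d2 psi y (u y) * p + a0 y (u y) * d2 psi y (u y)) * q
         + b3 y (u y) * d2 psi y (u y) * p ^ 3 + b2 y (u y) * d2 psi y (u y) * p ^ 2
         + b1 y (u y) * d2 psi y (u y) * p + b0 y (u y) * d2 psi y (u y))));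
      [| unfold cubic_rhs; ring].
    rewrite T, S1, S2, S3, S4, S5, S6; ring. }
  assert (N3 : phi1 y ^ 3 <> 0) by (apply pow_nonzero; lra).
  split; intros H.
  + rewrite H, Rminus_diag, Rmult_0_r in M.
    apply Rmult_integral in M; tauto.
  + rewrite H, Rmult_0_l in M; symmetry in M.
    apply Rmult_integral in M; destruct M as [M | M]; lra.
Qed.

(** * The criterion in terms of the coefficients of the fourth order equation *)

Section Reduction.

Variables (Omega : R * R -> Prop) (A0 A1 B0 B1 B2 B3 : R -> R -> R).
Hypothesis Omega_open : open Omega.
Hypothesis Omega_nz : forall y u, Omega (y, u) -> u <> 0.
Hypothesis A0_smooth : smooth_on Omega A0.
Hypothesis A1_smooth : smooth_on Omega A1.
Hypothesis B0_smooth : smooth_on Omega B0.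
Hypothesis B1_smooth : smooth_on Omega B1.

Definition red_a1 (y u : R) : R := A1 y u + 4 / u.
Definition red_a0 (y u : R) : R := A0 y u / u.
Definition red_b3 (y u : R) : R := B3 y u + A1 y u / u + 1 / u ^ 2.
Definition red_b2 (y u : R) : R := B2 y u / u + A0 y u / u ^ 2.
Definition red_b1 (y u : R) : R := B1 y u / u ^ 2.
Definition red_b0 (y u : R) : R := B0 y u / u ^ 3.

Lemma red_a1_smooth : smooth_on Omega red_a1.
Proof. unfold red_a1; smooth; trivial. Qed.

Lemma red_a0_smooth : smooth_on Omega red_a0.
Proof. unfold red_a0; smooth; trivial. Qed.

Lemma red_b1_smooth : smooth_on Omega red_b1.
Proof. unfold red_b1; smooth; trivial; intros; apply pow_nonzero; eauto. Qed.

Lemma red_b0_smooth : smooth_on Omega red_b0.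
Proof. unfold red_b0; smooth; trivial; intros; apply pow_nonzero; eauto. Qed.

(** Relations such as red_b0 u^3 = B0 are differentiated instead of quotients, and the original
    coefficients are then eliminated in favour of the reduced ones. *)
Lemma linearization_conditions_reduced (y u : R) : Omega (y, u) ->
  (linearization_conditions red_a0 red_a1 red_b0 red_b1 red_b2 red_b3 y u <->
     u ^ 2 * d1 A1 y u - u * d2 A0 y u + A0 y u = 0
  /\ - 3 * u ^ 2 * d2 (d1 A0) y u
     + u * (3 * d2 B1 y u + 3 * d1 A0 y u - 2 * A0 y u * d2 A0 y u)
     + (- 6 * B1 y u + 2 * A0 y u ^ 2) = 0
  /\ 3 * u ^ 2 * d1 A1 y u + u * (A0 y u * A1 y u - 3 * B2 y u) + A0 y u = 0
  /\ u ^ 2 * (3 * d2 A1 y u - 9 * B3 y u + A1 y u ^ 2) - u * A1 y u - 5 = 0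
  /\ - 6 * u ^ 4 * d1 A0 y u * d1 A1 y u
     + u ^ 3 * (9 * B1 y u * d1 A1 y u - 2 * A0 y u ^ 2 * d1 A1 y u
                + 9 * d2 (d1 B1) y u)
     + u ^ 2 * (- 18 * d1 B1 y u - 9 * A1 y u * d2 B0 y u
                - 9 * B0 y u * d2 A1 y u + 3 * A0 y u * d2 B1 y u
                - 27 * d2 (d2 B0) y u)
     + u * (27 * A1 y u * B0 y u - 6 * A0 y u * B1 y u + 126 * d2 B0 y u)
     - 180 * B0 y u = 0).
Proof.
intros Hyu; assert (N := Omega_nz y u Hyu).
assert (Sa1 := red_a1_smooth); assert (Sa0 := red_a0_smooth);
assert (Sb1 := red_b1_smooth); assert (Sb0 := red_b0_smooth).
assert (Pu := partials_id2 Omega).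
assert (Ea1 : forall a b, Omega (a, b) -> red_a1 a b * b = A1 a b * b + 4)
  by (intros a b H; unfold red_a1; field; eauto).
assert (Ea0 : forall a b, Omega (a, b) -> red_a0 a b * b = A0 a b)
  by (intros a b H; unfold red_a0; field; eauto).
assert (Eb1 : forall a b, Omega (a, b) -> red_b1 a b * (b * b) = B1 a b)
  by (intros a b H; unfold red_b1; field; eauto).
assert (Eb0 : forall a b, Omega (a, b) -> red_b0 a b * (b * (b * b)) = B0 a b)
  by (intros a b H; unfold red_b0; field; eauto).
differentiate Omega_open Ea1 Ea1y Ea1u.
differentiate Omega_open Ea0 Ea0y Ea0u.
differentiate Omega_open Ea0y Ea0yy Ea0yu.
differentiate Omega_open Eb1 Eb1y Eb1u.
differentiate Omega_open Eb1y Eb1yy Eb1yu.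
differentiate Omega_open Eb0 Eb0y Eb0u.
differentiate Omega_open Eb0u Eb0uy Eb0uu.
unfold linearization_conditions.
assert (VA1 : A1 y u = red_a1 y u - 4 / u) by (unfold red_a1; field; exact N).
assert (VA1y : d1 A1 y u = d1 red_a1 y u).
{ apply Rmult_eq_reg_r with u; [| exact N]; specialize (Ea1y y u Hyu); lra. }
assert (VA1u : d2 A1 y u = d2 red_a1 y u + 4 / u ^ 2).
{ apply Rmult_eq_reg_r with u; [| exact N]; specialize (Ea1u y u Hyu).
  rewrite VA1 in Ea1u; transitivity (d2 red_a1 y u * u + 4 / u); [lra | now field]. }
assert (VB2 : B2 y u = (red_b2 y u - A0 y u / u ^ 2) * u)
  by (unfold red_b2; field; exact N).
assert (VB3 : B3 y u = red_b3 y u - A1 y u / u - 1 / u ^ 2)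
  by (unfold red_b3; field; exact N).
rewrite VB2, VB3, VA1y, VA1u, VA1, <- (Ea0yu y u Hyu), <- (Eb1yu y u Hyu),
  <- (Eb1y y u Hyu), <- (Eb0uu y u Hyu), <- (Ea0y y u Hyu), <- (Ea0u y u Hyu),
  <- (Eb1u y u Hyu), <- (Eb0u y u Hyu), <- (Ea0 y u Hyu), <- (Eb1 y u Hyu),
  <- (Eb0 y u Hyu).
(* Each identity is the corresponding condition times a power of u; the exponents are 2, 3, 2, 2,
   5. *)
assert (scale : forall k x e, e = u ^ k * x -> (x = 0 <-> e = 0)).
{ intros k x e ->; split; [intros ->; ring |]; intros E.
  apply Rmult_integral in E; destruct E as [E | E]; [| exact E].
  now apply pow_nonzero in E. }
assert (move : d2 red_a0 y u = d1 red_a1 y u <-> d1 red_a1 y u - d2 red_a0 y u = 0)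
  by (split; lra).
rewrite move; clear move.
apply Morphisms_Prop.and_iff_morphism; [apply (scale 2%nat); field; exact N |].
apply Morphisms_Prop.and_iff_morphism; [apply (scale 3%nat); field; exact N |].
apply Morphisms_Prop.and_iff_morphism; [apply (scale 2%nat); field; exact N |].
apply Morphisms_Prop.and_iff_morphism; [apply (scale 2%nat); field; exact N |].
apply (scale 5%nat); field; exact N.
Qed.

End Reduction.

Theorem theorem1 (Omega : R * R -> Prop) (A0 A1 B0 B1 B2 B3 : R -> R -> R)
  (Omega_open : open Omega)
  (Omega_nz : forall y p, Omega (y, p) -> p <> 0)
  (A0_smooth : smooth_on Omega A0) (A1_smooth : smooth_on Omega A1)
  (B0_smooth : smooth_on Omega B0) (B1_smooth : smooth_on Omega B1)
  (B2_smooth : smooth_on Omega B2) (B3_smooth : smooth_on Omega B3) :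
  linearizable_by_point_transformation Omega (reduced_rhs A0 A1 B0 B1 B2 B3)
  <->
  (forall y p, Omega (y, p) ->
     p ^ 2 * d1 A1 y p - p * d2 A0 y p + A0 y p = 0
  /\ - 3 * p ^ 2 * d2 (d1 A0) y p
     + p * (3 * d2 B1 y p + 3 * d1 A0 y p - 2 * A0 y p * d2 A0 y p)
     + (- 6 * B1 y p + 2 * A0 y p ^ 2) = 0
  /\ 3 * p ^ 2 * d1 A1 y p + p * (A0 y p * A1 y p - 3 * B2 y p) + A0 y p = 0
  /\ p ^ 2 * (3 * d2 A1 y p - 9 * B3 y p + A1 y p ^ 2) - p * A1 y p - 5 = 0
  /\ - 6 * p ^ 4 * d1 A0 y p * d1 A1 y p
     + p ^ 3 * (9 * B1 y p * d1 A1 y p - 2 * A0 y p ^ 2 * d1 A1 y p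
                + 9 * d2 (d1 B1) y p)
     + p ^ 2 * (- 18 * d1 B1 y p - 9 * A1 y p * d2 B0 y p
                - 9 * B0 y p * d2 A1 y p + 3 * A0 y p * d2 B1 y p
                - 27 * d2 (d2 B0) y p)
     + p * (27 * A1 y p * B0 y p - 6 * A0 y p * B1 y p + 126 * d2 B0 y p)
     - 180 * B0 y p = 0).
Proof.
set (a0 := red_a0 A0); set (a1 := red_a1 A1); set (b0 := red_b0 B0).
set (b1 := red_b1 B1); set (b2 := red_b2 A0 B2); set (b3 := red_b3 A1 B3).
assert (Sa0 : smooth_on Omega a0) by now apply red_a0_smooth.
assert (Sa1 : smooth_on Omega a1) by now apply red_a1_smooth.
assert (Sb0 : smooth_on Omega b0) by now apply red_b0_smooth.
assert (Sb1 : smooth_on Omega b1) by now apply red_b1_smooth.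
(* The two right sides are convertible: the reduced coefficients were defined by the very
   expressions in [reduced_rhs]. *)
change (reduced_rhs A0 A1 B0 B1 B2 B3) with (cubic_rhs a0 a1 b0 b1 b2 b3).
split.
- intros H y u Hyu.
  apply (linearization_conditions_reduced Omega A0 A1 B0 B1 B2 B3); trivial.
  destruct (H y u Hyu) as (U & V & phi & psi & eta & theta & alpha & HU & sub & CV & TL).
  assert (OU : open U) by apply CV.
  apply (necessity U a0 a1 b0 b1 b2 b3 phi psi alpha); trivial;
    try (now apply smooth_subset with (1 := sub)); try apply CV.
  intros y' u' H'; now apply (jacobian_nonzero U V phi psi eta theta).
- intros H; apply sufficiency; trivial; intros y u Hyu.
  apply (linearization_conditions_reduced Omega A0 A1 B0 B1 B2 B3); auto.
Qed.
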